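(* Let $r>\frac12$ and suppose that the exact solution $u$ of the periodic RLW problem $$u_t+au_x-\sigma u_{xxt}+\big(\tfrac{\gamma}{2}u^2\big)_x=0,\quad u(x,0)=u_0(x),\quad u(x,t)=u(x+L,t),\quad t\in[0,T],$$ satisfies $u\in C^3(0,T;H^{r+1}_p(\Omega))$. Let $\mathbf{U}^0,\dots,\mathbf{U}^{N_t}\in\mathbb{R}^N$ be the numerical solution of the LLF-MP scheme $$(\mathbb{I}-\sigma\mathbb{D}_2)\,\delta_t\mathbf{U}^n+\mathbb{D}(\mathbf{U}^n)\,\widehat{\mathbf{U}}^{n}=0\ (n\ge1),\qquad (\mathbb{I}-\sigma\mathbb{D}_2)\,\delta_t^+\mathbf{U}^0+\mathbb{D}\big(\mathbf{U}^{\frac12}\big)\mathbf{U}^{\frac12}=0,$$ with $U_j^0=u_0(x_j)$. Then, without any restriction on the grid ratio between $\tau$ and $h$, $\mathbf{U}^n$ converges to $u$ with order $\mathcal{O}(\tau^2+N^{-r})$ in the discrete $L^\infty$ norm: there is a constant $C>0$ independent of $N$, $\tau$ and $n$ such that $$\|u^n-\mathbf{U}^n\|_{\infty,h}\le C(\tau^2+N^{-r}),\qquad 0\le n\le N_t,$$ where $u^n=(u(x_j,t_n))_{j=0}^{N-1}$.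
   Context: Constants: $a,\sigma,\gamma>0$, $T>0$. $\Omega=[x_L,x_R]$, $L=x_R-x_L$, $\mu=2\pi/L$. $H^s_p(\Omega)$ is the closure in $H^s(\Omega)$ of the smooth $L$-periodic functions (the $L$-periodic Sobolev space of order $s$). $C^3(0,T;X)$ denotes three times continuously differentiable functions of $t\in[0,T]$ with values in $X$. The solution $u$ is real-valued. $N$ is a positive even integer, $h=L/N$, $x_j=x_L+jh$ for $0\le j\le N-1$. Time step $\tau=T/N_t$ with $N_t$ a positive integer, $t_n=n\tau$. Grid functions are vectors $\mathbf{U}=(U_0,\dots,U_{N-1})$, with $\|\mathbf{U}\|_{\infty,h}=\max_{0\le j\le N-1}|U_j|$. Fourier differentiation matrices: $g_j(x)=\frac1N\sum_{k=-N/2}^{N/2}\frac1{c_k}e^{ik\mu(x-x_j)}$ with $c_k=1$ for $|k|\ne N/2$ and $c_{\pm N/2}=2$; $(\mathbb{D}_k)_{jl}=\frac{d^k g_l}{dx^k}(x_j)$, $0\le j,l\le N-1$. $\mathbb{I}$ is the identity matrix. $\mathbb{D}(\mathbf{U})=a\mathbb{D}_1+\frac{\gamma}{3}\big(\mathrm{diag}(\mathbf{U})\mathbb{D}_1+\mathbb{D}_1\mathrm{diag}(\mathbf{U})\big)$. Time notation: $\delta_t\mathbf{U}^n=\frac{\mathbf{U}^{n+1}-\mathbf{U}^{n-1}}{2\tau}$, $\widehat{\mathbf{U}}^{n}=\frac{\mathbf{U}^{n+1}+\mathbf{U}^{n-1}}{2}$, $\delta_t^+\mathbf{U}^0=\frac{\mathbf{U}^{1}-\mathbf{U}^0}{\tau}$,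 $\mathbf{U}^{\frac12}=\frac{\mathbf{U}^{1}+\mathbf{U}^0}{2}$. *)

(* Defs.v *)
From HB Require Import structures.
From mathcomp Require Import all_boot all_order all_algebra.
From mathcomp Require Import all_classical all_reals all_analysis.
From mathcomp Require Import complex.

Set Implicit Arguments.
Unset Strict Implicit.
Unset Printing Implicit Defensive.

Import Order.TTheory GRing.Theory Num.Theory.
Import numFieldNormedType.Exports.

Local Open Scope classical_set_scope.
Local Open Scope ring_scope.
Local Open Scope complex_scope.

Definition domain (R : realType) (xL xR : R) : set R := `[xL, xR]%classic.

Definition wavenumber (R : realType) (xL xR : R) : R := 2 * pi / (xR - xL).

Definition periodic (R : realType) (L : R) (f : R -> R) : Prop :=
  forall x, f (x + L) = f x.

Definition smooth_periodic (R : realType) (L : R) (f : R -> R) : Prop :=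
  periodic L f /\ forall n x, derivable (derive1n n f) x 1.

Definition square_integrable (R : realType) (xL xR : R) (f : R -> R) : Prop :=
  measurable_fun (domain xL xR) f /\
  lebesgue_measure.-integrable (domain xL xR) (fun x => (f x ^+ 2)%:E).

(* (1/L) \int_Omega f(x) e^{-i k mu x} dx, for a real-valued f *)
Definition fourier_coef (R : realType) (xL xR : R) (f : R -> R) (k : int) :
    R[i] :=
  let mu := wavenumber xL xR in
  ((xR - xL)^-1 * (\int[lebesgue_measure]_(x in domain xL xR)
                     (f x * cos (k%:~R * mu * x))))
  -i* ((xR - xL)^-1 * (\int[lebesgue_measure]_(x in domain xL xR)
                     (f x * sin (k%:~R * mu * x)))).

(* Squared norm of the L-periodic Sobolev space of real order s, with value
   +oo allowed.  The factor L makes it the squared L^2(Omega) norm at s = 0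
   and the squared H^1(Omega) norm at s = 1 on smooth periodic functions. *)
Definition sobolev_sqnorm (R : realType) (xL xR s : R) (f : R -> R) : \bar R :=
  let mu := wavenumber xL xR in
  \esum_(k in [set: int])
    ((xR - xL) * (1 + (k%:~R * mu) ^+ 2) `^ s *
     (complex.Re (fourier_coef xL xR f k) ^+ 2 +
      complex.Im (fourier_coef xL xR f k) ^+ 2))%:E.

(* H^s_p(Omega): the closure of the smooth L-periodic functions.  Elements are
   represented by functions on R, of which only the values on Omega matter. *)
Definition sobolev_periodic (R : realType) (xL xR s : R) (f : R -> R) : Prop :=
  square_integrable xL xR f /\
  forall eps : R, 0 < eps ->
    exists phi : R -> R, smooth_periodic (xR - xL) phi /\
      (sobolev_sqnorm xL xR s (fun x => f x - phi x)%R < eps%:E)%E.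

Definition times (R : realType) (T : R) : set R := `[0, T]%classic.

(* A curve v is given as t |-> (x |-> v t x).  Limits in t are taken within
   [0, T], hence one-sided at the end points. *)
Definition sobolev_continuous (R : realType) (xL xR s T : R)
    (v : R -> R -> R) : Prop :=
  forall t, times T t ->
    sobolev_sqnorm xL xR s (fun x => v t' x - v t x)
      @[t' --> within (times T) (nbhs t)] --> 0%E.

Definition sobolev_derivative_at (R : realType) (xL xR s T : R)
    (v : R -> R -> R) (t : R) (w : R -> R) : Prop :=
  sobolev_sqnorm xL xR s (fun x => (v t' x - v t x) / (t' - t) - w x)
    @[t' --> within (times T) t^'] --> 0%E.

(* v \in C^k(0, T; H^s_p(Omega)) *)
Fixpoint sobolev_Ck (R : realType) (k : nat) (xL xR s T : R)
    (v : R -> R -> R) : Prop :=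
  [/\ forall t, times T t -> sobolev_periodic xL xR s (v t),
      sobolev_continuous xL xR s T v &
      if k is k'.+1 then
        exists w : R -> R -> R,
          (forall t, times T t ->
             sobolev_derivative_at xL xR s T v t (w t)) /\
          sobolev_Ck k' xL xR s T w
      else True].

(* u x t solves the periodic RLW problem on [0, T].  At every time, u_t is the
   time derivative of u in L^2(Omega) (order-0 norm) and the equation holds in
   the sense of periodic distributions in x: for a solution with values in
   H^{r+1} and r > 1/2 only, u_xxt need not be a function.  u(., t) is the
   continuous representative of its class, so that its grid values make
   sense. *)
Definition RLW_solution (R : realType) (a sigma gamma xL xR T : R)
    (u0 : R -> R) (u : R -> R -> R) : Prop :=
  [/\ forall t, times T t -> continuous (u^~ t),
      forall t, times T t -> periodic (xR - xL) (u^~ t),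
      forall x, u x 0 = u0 x &
      forall t, times T t -> exists ut : R -> R,
        [/\ square_integrable xL xR ut,
            sobolev_derivative_at xL xR 0 T (fun t x => u x t) t ut &
            forall phi : R -> R, smooth_periodic (xR - xL) phi ->
              \int[lebesgue_measure]_(x in domain xL xR)
                (ut x * phi x - a * u x t * derive1n 1 phi x
                 - sigma * ut x * derive1n 2 phi x
                 - gamma / 2 * u x t ^+ 2 * derive1n 1 phi x) = 0]].

Definition grid (R : realType) (xL xR : R) (N : nat) (j : nat) : R :=
  xL + j%:R * ((xR - xL) / N%:R).

Definition expi (R : realType) (theta : R) : R[i] := cos theta +i* sin theta.

Definition ck (R : realType) (N : nat) (k : int) : R[i] :=
  if absz k == N./2 then 2 else 1.

(* The index i : 'I_N.+1 stands for k = i - N/2, which runs over -N/2..N/2. *)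
Definition gF (R : realType) (xL xR : R) (N : nat) (j : nat) (x : R) : R[i] :=
  N%:R^-1 * \sum_(i < N.+1)
    let k := i%:Z - (N./2)%:Z in
    (ck R N k)^-1 * expi (k%:~R * wavenumber xL xR * (x - grid xL xR N j)).

(* g_j is real-valued, so nothing is lost by taking real parts in fourier_D. *)
Lemma gF_real (R : realType) (xL xR : R) (N j : nat) (x : R) :
  ~~ odd N -> complex.Im (gF xL xR N j x) = 0.
Proof.
move=> Nev; set z := gF xL xR N j x.
have NE : N = (N./2 + N./2)%N.
  by rewrite addnn -[LHS]odd_double_half (negbTE Nev).
suff zJ : complex.conjc z = z.
  case: z zJ => p q /= [] /eqP; rewrite eq_sym -addr_eq0 -mulr2n mulrn_eq0 /=.
  by move/eqP.
rewrite /z /gF rmorphM rmorph_sum /= fmorphV rmorph_nat.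
congr (_ * _); rewrite (reindex_inj rev_ord_inj) /=.
apply: eq_bigr => i _.
have -> : (N.+1 - i.+1)%N%:Z - (N./2)%:Z = - (i%:Z - (N./2)%:Z).
  rewrite subSS -subzn; last by rewrite -ltnS.
  by rewrite [X in X%:Z - _ - _]NE PoszD opprB addrAC addrK.
set k := i%:Z - _.
rewrite rmorphM fmorphV /ck abszN; congr (_^-1 * _).
  by case: ifP => _; rewrite (rmorph1, rmorph_nat).
by rewrite /expi rmorphN /= !mulNr cosN sinN opprK.
Qed.

Definition fourier_D (R : realType) (xL xR : R) (N k : nat) : 'M[R]_N :=
  \matrix_(j, l) derive1n k (fun x => complex.Re (gF xL xR N l x)) (grid xL xR N j).

Definition LLF_D (R : realType) (a gamma xL xR : R) (N : nat)
    (U : 'cV[R]_N) : 'M[R]_N :=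
  let D1 := fourier_D xL xR N 1 in
  a *: D1 + (gamma / 3) *: (diag_mx U^T *m D1 + D1 *m diag_mx U^T).

Definition LLF_MP_scheme (R : realType) (a sigma gamma xL xR tau : R)
    (N Nt : nat) (U : nat -> 'cV[R]_N) : Prop :=
  let A := 1%:M - sigma *: fourier_D xL xR N 2 in
  let Uhalf := 2^-1 *: (U 1%N + U 0%N) in
  (forall n, (1 <= n < Nt)%N ->
     A *m ((2 * tau)^-1 *: (U n.+1 - U n.-1)) +
     LLF_D a gamma xL xR (U n) *m (2^-1 *: (U n.+1 + U n.-1)) = 0) /\
  A *m (tau^-1 *: (U 1%N - U 0%N)) + LLF_D a gamma xL xR Uhalf *m Uhalf = 0.

Definition norm_infty_h (R : realType) (N : nat) (V : 'cV[R]_N) : R :=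
  \big[Num.max/0]_(j < N) `|V j 0|.

(* Main.v *)
Require Import Defs.
From HB Require Import structures.
From mathcomp Require Import all_boot all_order all_algebra.
From mathcomp Require Import all_classical all_reals all_analysis.
From mathcomp Require Import measurable_realfun.
From mathcomp Require Import complex.
From mathcomp Require Import zify ring lra.

Set Implicit Arguments.
Unset Strict Implicit.
Unset Printing Implicit Defensive.

Import Order.TTheory GRing.Theory Num.Theory.
Import numFieldNormedType.Exports.

Local Open Scope ring_scope.

(** The error is measured in the discrete energy norm nE, whose square is the
    quadratic form of 1 - sigma D2; it dominates the maximum over the grid with
    a constant independent of N ([grid_le_nE]).  The numerical solution U is
    compared with the grid values of the Fourier partial sum p of u, truncated
    at degree (N-1)/4.

    Stability holds without a grid ratio because D(U) is skew-symmetric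
    ([LLF_D_skew]): testing the error equation with the averaged error removes
    the operator that contains the numerical solution, and what is left is
    linear in the error, with coefficients that involve p only.  As the error
    enters this remainder at the middle level n, an explicit Gronwall argument
    suffices for n >= 1; in the implicit first step, a large tau is dealt with
    by conservation of the energy ([scheme_stability]).

    The defect of p has two parts.  In time, pairing p(t) with a fixed vector
    gives a scalar function of class C^3, so that the central difference and
    the average are accurate to O(tau^2) in the energy norm by duality
    ([comparison_difference], [comparison_average]).  In space, p^2 has degree
    below N/2 and is not aliased by the grid, so the discrete flux derivative of
    p is exact ([LLF_D_psum]).  There remain the Fourier coefficients of the
    difference between the fluxes of p and u, each of which is at most a
    constant times sup |p - u| = O(N^(-1/2-r)), and there are fewer than N of
    them; dividing by the symbol 1 + sigma (k mu)^2 absorbs the derivative, and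
    the sum is O(N^(-r)) in the dual norm ([spatial_residual_le]).  The one
    place where aliasing occurs is the initial error; Schur's test on residue
    classes modulo N bounds it by O(N^(-1-r)) in the discrete L2 norm
    ([ip_alias_le]), and an inverse inequality costs one factor N
    ([initial_error_le]).

    On the analytic side, the hypotheses on u are used through its Fourier
    coefficients only.  The coefficients of a smooth periodic function decay
    faster than any power, so that approximation by such functions makes the
    Sobolev norm finite ([sobolev_periodic_bound]), uniformly in t by
    compactness of [0, T] ([curve_bound]).  The weak form of the equation tested
    with cos and sin gives an ordinary differential equation for each
    coefficient ([rlw_coef]).  Pointwise bounds come from estimating a
    continuous function by the sum of the moduli of its coefficients, with a
    concentrating nonnegative trigonometric kernel ([norm_le_coef]). *)

(** * Finite sums *)

(** Weighted Cauchy-Schwarz over pairs, the form taken by the quadratic forms in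
    cosine and sine coefficients.  The binary form [quad] is nonnegative; as the
    weights may vanish, so may its leading coefficient. *)
Lemma cauchy_schwarz_sum (R : realFieldType) (I : Type) (s : seq I)
    (P : pred I) (g a b c d : I -> R) :
  (forall i, P i -> 0 <= g i) ->
  (\sum_(i <- s | P i) g i * (a i * c i + b i * d i)) ^+ 2 <=
  (\sum_(i <- s | P i) g i * (a i ^+ 2 + b i ^+ 2)) *
  (\sum_(i <- s | P i) g i * (c i ^+ 2 + d i ^+ 2)).
Proof.
move=> g0.
set Z := \sum_(i <- s | P i) _; set X := \sum_(i <- s | P i) _.
set Y := \sum_(i <- s | P i) _.
have quad p q : 0 <= p ^+ 2 * X + p * q * (2 * Z) + q ^+ 2 * Y.
  have -> : p ^+ 2 * X + p * q * (2 * Z) + q ^+ 2 * Y = \sum_(i <- s | P i)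
      g i * ((p * a i + q * c i) ^+ 2 + (p * b i + q * d i) ^+ 2).
    rewrite /X /Y /Z !mulr_sumr -!big_split /=; apply: eq_bigr => i _; ring.
  by apply: sumr_ge0 => i /g0 gi; rewrite mulr_ge0// addr_ge0// sqr_ge0.
have X0 : 0 <= X by have := quad 1 0; rewrite !expr2; nra.
have Y0 : 0 <= Y by have := quad 0 1; rewrite !expr2; nra.
have := quad Y (- Z); have := quad (- Z) X.
have := quad 1 1; have := quad 1 (- 1).
have [Y1|Y1] := eqVneq Y 0.
  have [X1|X1] := eqVneq X 0.
    rewrite X1 Y1 => h1 h2 _ _; have -> : Z = 0 by lra.
    by rewrite expr0n mul0r.
  move=> _ _ h _; rewrite Y1 mulr0.
  have Xgt0 : 0 < X by rewrite lt_neqAle eq_sym X1.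
  rewrite -(@pmulr_lle0 _ X)//; move: h; rewrite Y1 mulr0 addr0.
  have -> : (- Z) ^+ 2 * X + - Z * X * (2 * Z) = - (Z ^+ 2 * X) by ring.
  by rewrite oppr_ge0.
move=> _ _ _ h.
have Ygt0 : 0 < Y by rewrite lt_neqAle eq_sym Y1.
have : 0 <= Y * (X * Y - Z ^+ 2) by move: h; rewrite !expr2; nra.
by rewrite pmulr_rge0// subr_ge0.
Qed.

Lemma cauchy_schwarz_sqrt (R : rcfType) (x X Y : R) :
  0 <= X -> 0 <= Y -> x ^+ 2 <= X * Y -> `|x| <= Num.sqrt X * Num.sqrt Y.
Proof.
move=> X0 Y0 h; rewrite -sqrtrM// -sqrtr_sqr ler_sqrt//; exact: mulr_ge0.
Qed.

Lemma sum_inv_sqr_le (R : realFieldType) (m n : nat) : (0 < m)%N ->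
  \sum_(m <= k < n) (k%:R ^+ 2 : R)^-1 <= 2 / m%:R.
Proof.
move=> m0; have [mn|nm] := leqP m n; last first.
  by rewrite big_geq ?divr_ge0//; exact: ltnW.
have m0' : (0 : R) < m%:R by rewrite ltr0n.
(* 1/k^2 <= 2/k - 2/(k+1) for k >= 1, so the sum telescopes. *)
suff : \sum_(m <= k < n) (k%:R ^+ 2 : R)^-1 <= 2 / m%:R - 2 / n%:R.
  by move=> /le_trans; apply; rewrite gerBl divr_ge0.
elim: n mn => [|n IHn]; first by rewrite leqn0 => /eqP mE; rewrite mE in m0.
rewrite leq_eqVlt => /predU1P[<-|mn].
  by rewrite big_geq// subrr.
rewrite big_nat_recr//=; apply: le_trans (lerD (IHn mn) (lexx _)) _.
have n1 : (1 : R) <= n%:R by rewrite ler1n; exact: (leq_trans m0).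
have : (2 / n%:R - 2 / (n%:R + 1)) - (n%:R ^+ 2)^-1 =
    (n%:R - 1) / (n%:R ^+ 2 * (n%:R + 1)) :> R.
  by field; rewrite !gt_eqF//; lra.
have : 0 <= (n%:R - 1) / (n%:R ^+ 2 * (n%:R + 1)) :> R.
  by rewrite divr_ge0 ?mulr_ge0//; lra.
by rewrite -(@natr1 _ n); lra.
Qed.

(** A block of N consecutive integers meets a residue class modulo N once. *)
Lemma residue_block_le (R : realFieldType) (N c Q : nat) (B : R) :
  (0 < N)%N -> 0 <= B ->
  (forall l, (N <= 4 * l)%N -> (Q * N <= l)%N -> (l%:R ^+ 2)^-1 <= B) ->
  \sum_(Q * N <= l < Q.+1 * N | (N <= 4 * l)%N && (l %% N == c)%N)
     (l%:R ^+ 2 : R)^-1 <= B.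
Proof.
move=> N0 B0 hB; rewrite -{1}[(Q * N)%N]add0n big_addn.
have -> : (Q.+1 * N - Q * N = N)%N by rewrite mulSn addnK.
rewrite big_mkcond/= big_mkord.
apply: le_trans (_ : \sum_(i < N) (if i == c :> nat then B else 0) <= _).
  apply: ler_sum => i _; case: ifP => [/andP[h1]|_]; last by case: ifP.
  rewrite addnC modnMDl modn_small// => ->.
  by apply: hB; rewrite ?leq_addr// addnC.
have [cN|Nc] := ltnP c N; last first.
  by rewrite big1// => i _; case: eqP => // ic; have := ltn_ord i; lia.
rewrite (bigD1 (Ordinal cN))//= eqxx big1 ?addr0// => i.
by rewrite -val_eqE/= => /negbTE ->.
Qed.

(** The block [0, N) contributes at most (4/N)^2, and the block [Q N, (Q+1) N)
    at most (Q N)^-2, where the sum of Q^-2 is at most 2. *)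
Lemma sum_inv_sqr_residue_le (R : realFieldType) (N c M : nat) : (0 < N)%N ->
  \sum_(l < M | (N <= 4 * l)%N && (l %% N == c)%N) (l%:R ^+ 2 : R)^-1 <=
  18 / N%:R ^+ 2.
Proof.
move=> N0; have N0' : (0 : R) < N%:R by rewrite ltr0n.
pose P l := (N <= 4 * l)%N && (l %% N == c)%N.
have F0 l : P l -> 0 <= (l%:R ^+ 2 : R)^-1 by rewrite invr_ge0 sqr_ge0.
apply: le_trans (_ : \sum_(0 <= l < M * N | P l) (l%:R ^+ 2 : R)^-1 <= _).
  rewrite [leRHS](big_cat_nat _ (n := M))//=; last by rewrite leq_pmulr.
  by rewrite big_mkord lerDl big_nat_cond sumr_ge0// => l /andP[_ /F0].
suff h Q : \sum_(0 <= l < Q.+1 * N | P l) (l%:R ^+ 2 : R)^-1 <=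
    16 / N%:R ^+ 2 + (\sum_(1 <= q < Q.+1) (q%:R ^+ 2 : R)^-1) / N%:R ^+ 2.
  case: M => [|M]; first by rewrite mul0n big_geq// divr_ge0 ?sqr_ge0.
  apply: le_trans (h M) _; rewrite -mulrDl ler_wpM2r ?invr_ge0 ?sqr_ge0//.
  have := @sum_inv_sqr_le R 1 M.+1 isT; rewrite divr1; lra.
elim: Q => [|Q IH].
  rewrite [X in _ + X / _]big_geq// mul0r addr0; 
  apply: (@residue_block_le R N c 0 _ N0 (divr_ge0 (ler0n _ 16) (sqr_ge0 _))).
  move=> l Nl _; have l0 : (0 < l)%N by lia.
  have -> : (16 / N%:R ^+ 2 : R) = ((N%:R / 4) ^+ 2)^-1 by field; rewrite gt_eqF.
  have l0' : (0 : R) < l%:R by rewrite ltr0n.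
  rewrite lef_pV2 ?posrE ?exprn_gt0 ?divr_gt0// ler_sqr ?nnegrE ?divr_ge0 ?(ltW l0') ?(ltW N0')//.
  by rewrite ler_pdivrMr// -natrM ler_nat mulnC.
rewrite (big_cat_nat _ (n := Q.+1 * N)%N)//=; last by rewrite leq_mul2r leqnSn orbT.
rewrite [X in _ + X / _]big_nat_recr//= [X in _ <= _ + X]mulrDl [leRHS]addrA lerD//.
have B0 : 0 <= (Q.+1%:R ^+ 2)^-1 / N%:R ^+ 2 :> R.
  by rewrite divr_ge0 ?sqr_ge0// invr_ge0 sqr_ge0.
apply: (@residue_block_le R N c Q.+1 _ N0 B0) => l _ Ql.
rewrite -invfM -exprMn -natrM lef_pV2 ?posrE ?exprn_gt0 ?ltr0n ?muln_gt0//.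
  by rewrite ler_sqr ?nnegrE// ler_nat.
by apply: leq_trans Ql; rewrite muln_gt0.
Qed.

(** * Trigonometric polynomials *)

Definition trig (R : realType) (mu : R) (A B : nat -> R) (n : nat) (x : R) :=
  \sum_(k < n) (A k * cos (k%:R * mu * x) + B k * sin (k%:R * mu * x)).

Definition is_trig (R : realType) (mu : R) (n : nat) (f : R -> R) :=
  exists A B, forall x, f x = trig mu A B n x.

Section Trig.
Variables (R : realType) (mu : R).
Implicit Types (A B : nat -> R) (f g : R -> R) (x : R) (k l n m : nat).

Lemma trigD A B A' B' n x :
  trig mu A B n x + trig mu A' B' n x =
  trig mu (fun k => A k + A' k) (fun k => B k + B' k) n x.
Proof. by rewrite /trig -big_split/=; apply: eq_bigr => k _; ring. Qed.

Lemma trigZ c A B n x :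
  c * trig mu A B n x = trig mu (fun k => c * A k) (fun k => c * B k) n x.
Proof. by rewrite /trig mulr_sumr; apply: eq_bigr => k _; ring. Qed.

Lemma eq_trig A B A' B' n x :
  (forall k, (k < n)%N -> A k = A' k) -> (forall k, (k < n)%N -> B k = B' k) ->
  trig mu A B n x = trig mu A' B' n x.
Proof. by move=> eA eB; apply: eq_bigr => k _; rewrite eA ?eB. Qed.

Lemma trig_widen A B n m x : (n <= m)%N ->
  trig mu A B n x = trig mu (fun k => if (k < n)%N then A k else 0)
                            (fun k => if (k < n)%N then B k else 0) m x.
Proof.
move=> nm; rewrite /trig (big_ord_widen _
  (fun k => A k * cos (k%:R * mu * x) + B k * sin (k%:R * mu * x)) nm).
rewrite big_mkcond; apply: eq_bigr => k _.
by case: ifP => // _; rewrite !mul0r addr0.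
Qed.

Lemma is_derive_mode k x :
  is_derive x 1 (fun x => cos (k%:R * mu * x)) (- (k%:R * mu * sin (k%:R * mu * x))) /\
  is_derive x 1 (fun x => sin (k%:R * mu * x)) (k%:R * mu * cos (k%:R * mu * x)).
Proof.
split; apply: is_derive_eq; rewrite !scaler1 -?mulrA /GRing.scale /= ; ring.
Qed.

Lemma is_derive_trig A B n x :
  is_derive x 1 (trig mu A B n)
   (trig mu (fun k => k%:R * mu * B k) (fun k => - (k%:R * mu * A k)) n x).
Proof.
have -> : trig mu A B n = \sum_(k < n) (fun x =>
    A k * cos (k%:R * mu * x) + B k * sin (k%:R * mu * x)).
  by apply/funext => y; rewrite fct_sumE.
rewrite /trig; elim/big_ind2 : _.
- exact: is_derive_cst.
- by move=> f df g dg hf hg; exact: is_deriveD.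
move=> k _.
have [dc ds] := is_derive_mode k x.
apply: is_derive_eq; rewrite /GRing.scale /=; ring.
Qed.

Lemma derive1_trig A B n :
  derive1 (trig mu A B n) =
  trig mu (fun k => k%:R * mu * B k) (fun k => - (k%:R * mu * A k)) n.
Proof.
apply/funext => x; rewrite derive1E.
exact: (@derive_val _ _ _ _ _ _ _ (is_derive_trig A B n x)).
Qed.

Lemma derivable_trig A B n x : derivable (trig mu A B n) x 1.
Proof. by have [] := is_derive_trig A B n x. Qed.

Lemma continuous_trig A B n : continuous (trig mu A B n).
Proof.
by move=> x; apply/differentiable_continuous/derivable1_diffP/derivable_trig.
Qed.

Lemma derive1n_trig A B n j : exists A' B', derive1n j (trig mu A B n) = trig mu A' B' n.
Proof.
elim: j => [|j [A' [B' IH]]]; first by exists A, B.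
by rewrite derive1nS IH derive1_trig; eexists; eexists.
Qed.

Lemma eq_is_trig f g n : f =1 g -> is_trig mu n f -> is_trig mu n g.
Proof. by move=> fg [A [B h]]; exists A, B => x; rewrite -fg. Qed.

Lemma is_trigD f g n : is_trig mu n f -> is_trig mu n g ->
  is_trig mu n (fun x => f x + g x).
Proof.
move=> [A [B fE]] [A' [B' gE]].
by eexists; eexists => x; rewrite fE gE trigD.
Qed.

Lemma is_trigZ c f n : is_trig mu n f -> is_trig mu n (fun x => c * f x).
Proof. by move=> [A [B fE]]; eexists; eexists => x; rewrite fE trigZ. Qed.

Lemma is_trigW f n m : (n <= m)%N -> is_trig mu n f -> is_trig mu m f.
Proof.
by move=> nm [A [B fE]]; eexists; eexists => x; rewrite fE (trig_widen _ _ _ nm).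
Qed.

Lemma is_trig0 n : is_trig mu n (fun=> 0).
Proof.
exists (fun=> 0), (fun=> 0) => x.
by rewrite /trig big1// => k _; rewrite !mul0r addr0.
Qed.

Lemma is_trig_sum (I : Type) (s : seq I) (F : I -> R -> R) n :
  (forall i, is_trig mu n (F i)) -> is_trig mu n (fun x => \sum_(i <- s) F i x).
Proof.
move=> h; elim: s => [|i s IH].
  by apply: eq_is_trig (is_trig0 n) => x; rewrite big_nil.
by apply: eq_is_trig (is_trigD (h i) IH) => x; rewrite big_cons.
Qed.

Lemma is_trig_mode k n : (k < n)%N ->
  is_trig mu n (fun x => cos (k%:R * mu * x)) /\
  is_trig mu n (fun x => sin (k%:R * mu * x)).
Proof.
move=> kn; split.
- exists (fun i => (i == k)%:R), (fun=> 0) => x.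
  rewrite /trig (bigD1 (Ordinal kn))//= eqxx mul1r mul0r addr0 big1 ?addr0//.
  by move=> i /negbTE; rewrite -val_eqE /= => ->; rewrite !mul0r addr0.
- exists (fun=> 0), (fun i => (i == k)%:R) => x.
  rewrite /trig (bigD1 (Ordinal kn))//= eqxx mul1r mul0r add0r big1 ?addr0//.
  by move=> i /negbTE; rewrite -val_eqE /= => ->; rewrite !mul0r addr0.
Qed.

Lemma is_trig_shift (z : R) n : (exists2 d : nat, (d < n)%N & z = d%:R \/ z = - d%:R) ->
  is_trig mu n (fun x => cos (z * mu * x)) /\
  is_trig mu n (fun x => sin (z * mu * x)).
Proof.
move=> [d dn]; have [hc hs] := is_trig_mode dn.
case=> ->; first by [].
split; first by apply: eq_is_trig hc => x; rewrite !mulNr cosN.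
by apply: eq_is_trig (is_trigZ (- 1) hs) => x; rewrite !mulNr sinN mul1r.
Qed.

(** Product-to-sum formulas: degrees add up, which is what decides whether the
    square of a truncated series is aliased on the grid. *)
Lemma is_trigM f g n m : is_trig mu n.+1 f -> is_trig mu m.+1 g ->
  is_trig mu (n + m).+1 (fun x => f x * g x).
Proof.
move=> [A [B fE]] [A' [B' gE]].
apply: (@eq_is_trig (fun x => \sum_(k < n.+1) \sum_(l < m.+1)
  (A k * cos (k%:R * mu * x) + B k * sin (k%:R * mu * x)) *
  (A' l * cos (l%:R * mu * x) + B' l * sin (l%:R * mu * x)))) => [x|].
  by rewrite fE gE /trig big_distrlr.
apply: is_trig_sum => k; apply: is_trig_sum => l.
have kn : (k <= n)%N by rewrite -ltnS.
have lm : (l <= m)%N by rewrite -ltnS.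
have [c1 s1] := @is_trig_shift (k%:R + l%:R) (n + m).+1
  (ex_intro2 _ _ (k + l)%N (leq_add kn lm) (or_introl (esym (natrD _ _ _)))).
have [c2 s2] : is_trig mu (n + m).+1 (fun x => cos ((k%:R - l%:R) * mu * x)) /\
               is_trig mu (n + m).+1 (fun x => sin ((k%:R - l%:R) * mu * x)).
  apply: is_trig_shift; have [lk|/ltnW kl] := leqP l k.
    exists (k - l)%N; last by left; rewrite natrB.
    by rewrite ltnS (leq_trans (leq_subr _ _))// (leq_trans kn)// leq_addr.
  exists (l - k)%N; last by right; rewrite natrB// opprB.
  by rewrite ltnS (leq_trans (leq_subr _ _))// (leq_trans lm)// leq_addl.
apply: eq_is_trig (is_trigD
  (is_trigD (is_trigZ ((A k * A' l + B k * B' l) / 2) c2)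
            (is_trigZ ((A k * A' l - B k * B' l) / 2) c1))
  (is_trigD (is_trigZ ((B k * A' l - A k * B' l) / 2) s2)
            (is_trigZ ((B k * A' l + A k * B' l) / 2) s1))) => x.
rewrite !mulrDl !mulNr !(cosB, cosD, sinB, sinD).
by field.
Qed.

End Trig.
(** * Trigonometric sums over the grid *)

(** 2 sin (a/2) cos y = sin (y + a/2) - sin (y - a/2). *)
Lemma sum_cos_telescope (R : realType) (a b : R) n :
  2 * sin (a / 2) * \sum_(j < n) cos (b + j%:R * a) =
  sin (b + n%:R * a - a / 2) - sin (b - a / 2).
Proof.
elim: n => [|n IH]; first by rewrite big_ord0 mulr0 mul0r addr0 subrr.
rewrite big_ord_recr/= mulrDr IH -(@natr1 _ n).
have -> : b + (n%:R + 1) * a - a / 2 = (b + n%:R * a) + a / 2 by field.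
rewrite sinB (sinD (b + _)); ring.
Qed.

Lemma sinDnpi (R : realType) (x : R) n : sin (x + n%:R * pi) = (-1) ^+ n * sin x.
Proof.
elim: n => [|n IH]; first by rewrite mul0r addr0 expr0 mul1r.
by rewrite -(@natr1 _ n) mulrDl mul1r addrA sinDpi IH exprS; ring.
Qed.

Lemma sin_rational_neq0 (R : realType) (N d : nat) :
  (0 < N)%N -> ~~ (N %| d)%N -> sin (d%:R * pi / N%:R : R) != 0.
Proof.
move=> N0 Nd; have N0' : (0 : R) < N%:R by rewrite ltr0n.
have -> : (d%:R * pi / N%:R : R) =
    (d %% N)%:R * pi / N%:R + (d %/ N)%:R * pi.
  rewrite [in LHS](divn_eq d N) natrD natrM; field; exact: lt0r_neq0.
have dN : (0 < d %% N)%N by rewrite lt0n.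
rewrite sinDnpi mulf_neq0 ?signr_eq0// gt_eqF//.
apply: sin_gt0_pi; rewrite divr_gt0 ?mulr_gt0 ?pi_gt0 ?ltr0n//=.
by rewrite ltr_pdivrMr// mulrC ltr_pM2l ?pi_gt0// ltr_nat ltn_mod.
Qed.

Lemma sum_cos_roots (R : realType) (N d : nat) (b s : R) :
  (0 < N)%N -> ~~ (N %| d)%N -> s = 1 \/ s = -1 ->
  \sum_(j < N) cos (b + j%:R * (s * (d%:R * (2 * pi / N%:R)))) = 0.
Proof.
move=> N0 Nd hs; have N0' : (N%:R : R) != 0 by rewrite pnatr_eq0 -lt0n.
set a := s * _; have := sum_cos_telescope a b N.
have -> : sin (a / 2) = s * sin (d%:R * pi / N%:R).
  have -> : a / 2 = s * (d%:R * pi / N%:R) by rewrite /a; field.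
  by case: hs => ->; rewrite ?mul1r// mulN1r sinN mulN1r.
have -> : sin (b + N%:R * a - a / 2) = sin (b - a / 2).
  have -> : b + N%:R * a - a / 2 = b - a / 2 + s * ((d * 2)%:R * pi).
    by rewrite /a natrM; field.
  case: hs => ->; rewrite ?mul1r ?mulN1r.
    by rewrite sinDnpi -signr_odd mulnC mul2n odd_double mul1r.
  rewrite -[in RHS](subrK ((d * 2)%:R * pi) (b - a / 2)) sinDnpi.
  by rewrite -signr_odd mulnC mul2n odd_double mul1r.
rewrite subrr => /eqP; rewrite !mulf_eq0 pnatr_eq0/= (negbTE (sin_rational_neq0 _ N0 Nd)).
by case: hs => ->; rewrite ?oppr_eq0 oner_eq0/= => /eqP.
Qed.

(** The cardinal functions g_j run over signed frequencies, while [trig] uses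
    nonnegative ones. *)
Lemma sum_fold (R : nzRingType) (g : nat -> R) (m : nat) :
  \sum_(i < m.*2.+1) g `|i%:Z - m%:Z|%N =
  \sum_(k < m.+1) (if k == 0%N :> nat then 1 else 2) * g k.
Proof.
have -> : m.*2.+1 = (m + m.+1)%N by lia.
rewrite big_split_ord/=.
have -> : \sum_(i < m) g `|i%:Z - m%:Z|%N = \sum_(k < m) g k.+1.
  rewrite (reindex_inj rev_ord_inj)/=; apply: eq_bigr => i _; congr (g _).
  have := ltn_ord i; lia.
have -> : \sum_(i < m.+1) g `|(m + i)%N%:Z - m%:Z|%N = \sum_(k < m.+1) g k.
  by apply: eq_bigr => i _; congr (g _); lia.
rewrite !big_ord_recl/= mul1r addrCA -big_split/=; congr (_ + _).
by apply: eq_bigr => i _; rewrite mulr2n mulrDl mul1r.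
Qed.

Section Grid.
Variables (R : realType) (xL xR mu sigma : R) (N m : nat).
Hypotheses (xLR : xL < xR) (muE : mu = wavenumber xL xR).
Hypotheses (sigma0 : 0 < sigma) (NE : N = m.*2) (m0 : (0 < m)%N).
Local Notation x_ := (grid xL xR N).
Implicit Types (v w f : 'cV[R]_N) (A B : nat -> R) (k l n : nat).

Let N0 : (0 < N)%N. Proof. by rewrite NE double_gt0. Qed.
Let N0' : (0 : R) < N%:R. Proof. by rewrite ltr0n. Qed.
Let L0 : 0 < xR - xL. Proof. by rewrite subr_gt0. Qed.

Lemma wavenumber_gt0 : 0 < mu.
Proof. by rewrite muE divr_gt0 ?mulr_gt0 ?pi_gt0. Qed.

Lemma wavenumber_grid j : mu * x_ j = mu * xL + j%:R * (2 * pi / N%:R).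
Proof.
rewrite /grid mulrDr; congr (_ + _); rewrite muE /wavenumber.
by field; rewrite !lt0r_neq0.
Qed.

(** From one grid point to the next the phase advances by a multiple of 2 pi / N
    that is not a multiple of 2 pi, so the telescoped sum over a period is 0. *)
Lemma sum_grid_cos (d : nat) (s b : R) : ~~ (N %| d)%N -> s = 1 \/ s = - 1 ->
  \sum_(j < N) cos (s * d%:R * mu * x_ j + b) = 0.
Proof.
move=> Nd hs; rewrite -[RHS](sum_cos_roots (b + s * d%:R * mu * xL) N0 Nd hs).
by apply: eq_bigr => j _; rewrite -[_ * mu * x_ j]mulrA wavenumber_grid; congr cos; ring.
Qed.

Lemma sum_grid_cos_diff k l (b : R) : ~~ (N %| `|k%:Z - l%:Z|)%N ->
  \sum_(j < N) cos ((k%:R - l%:R) * mu * x_ j + b) = 0.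
Proof.
move=> Nd; have [lk|/ltnW kl] := leqP l k.
  rewrite -[RHS](sum_grid_cos b Nd (or_introl erefl)); apply: eq_bigr => j _.
  by rewrite mul1r distnEl// natrB.
rewrite -[RHS](sum_grid_cos b Nd (or_intror erefl)); apply: eq_bigr => j _.
by rewrite mulN1r distnEr// natrB// opprB.
Qed.

Lemma sum_grid_cos_add k l (b : R) : ~~ (N %| k + l)%N ->
  \sum_(j < N) cos ((k%:R + l%:R) * mu * x_ j + b) = 0.
Proof.
move=> Nd; rewrite -[RHS](sum_grid_cos b Nd (or_introl erefl)).
by apply: eq_bigr => j _; rewrite mul1r natrD.
Qed.

Definition dcos w k := \sum_(l < N) w l 0 * cos (k%:R * mu * x_ l).
Definition dsin w k := \sum_(l < N) w l 0 * sin (k%:R * mu * x_ l).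

(** Fourier weights after folding the frequency -k onto k.  The frequencies m and
    -m coincide on the grid and carry the weight 1/2 each. *)
Definition wfold k : R := if (k == 0%N) || (k == m) then 1 else 2.

Definition interp w :=
  trig mu (fun k => wfold k / N%:R * dcos w k)
          (fun k => wfold k / N%:R * dsin w k) m.+1.

Lemma wfold_ge1 k : 1 <= wfold k.
Proof. by rewrite /wfold; case: ifP => _; rewrite ?lexx// ler1n. Qed.

Lemma wfold_le2 k : wfold k <= 2.
Proof. by rewrite /wfold; case: ifP => _; rewrite ?lexx// ler1n. Qed.

(** The cardinal function g_l is a trigonometric polynomial, so that the matrices
    [fourier_D] differentiate the interpolant of a grid vector. *)
Lemma gF_trig l x : complex.Re (gF xL xR N l x) =
  trig mu (fun k => wfold k / N%:R * cos (k%:R * mu * x_ l))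
          (fun k => wfold k / N%:R * sin (k%:R * mu * x_ l)) m.+1 x.
Proof.
have ReM (c : R) (z : R[i]) : complex.Re (c%:C%C * z) = c * complex.Re z.
  by case: z => p q /=; rewrite mul0r subr0.
rewrite /gF.
have -> : (N%:R : R[i])^-1 = (N%:R^-1)%:C%C by rewrite fmorphV rmorph_nat.
rewrite ReM raddf_sum/=.
pose g k := (if k == m then 2 else 1)^-1 * cos (k%:R * (mu * (x - x_ l))).
rewrite (eq_bigr (fun i : 'I_N.+1 => g `|i%:Z - m%:Z|%N)) => [|i _]; last first.
  have N2 : N./2 = m by rewrite NE doubleK.
  rewrite /ck N2; set k := i%:Z - m%:Z.
  have -> : (if `|k|%N == m then 2 else 1 : R[i])^-1 =
            (((if `|k|%N == m then 2 else 1)^-1 : R)%:C)%C.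
    by case: ifP => _; rewrite fmorphV ?rmorph1// rmorph_nat.
  rewrite ReM /g /expi/=; congr (_ * _).
  rewrite -muE -mulrA.
  have [->|->] : k = `|k|%N \/ k = - (`|k|%N)%:Z by lia.
    by [].
  by rewrite abszN absz_nat rmorphN/= mulNr cosN.
have -> : \sum_(i < N.+1) g `|i%:Z - m%:Z|%N =
  \sum_(k < m.+1) (if k == 0%N :> nat then 1 else 2) * g k.
  by rewrite -sum_fold; rewrite NE.
rewrite mulr_sumr /trig; apply: eq_bigr => k _.
rewrite /g /wfold mulrBr mulrBr cosB !mulrA.
case: eqP => [->|_] /=; last by case: eqP => _; field; rewrite lt0r_neq0.
by rewrite (ltn_eqF m0); field; rewrite lt0r_neq0.
Qed.

Lemma fourier_D1_interp w j :
  (fourier_D xL xR N 1 *m w) j 0 = derive1 (interp w) (x_ j).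
Proof.
rewrite /interp derive1_trig mxE /trig.
have -> : \sum_l fourier_D xL xR N 1 j l * w l 0 = \sum_(l < N) \sum_(k < m.+1)
  (k%:R * mu * (wfold k / N%:R * (w l 0 * sin (k%:R * mu * x_ l))) * cos (k%:R * mu * x_ j) +
   - (k%:R * mu * (wfold k / N%:R * (w l 0 * cos (k%:R * mu * x_ l)))) * sin (k%:R * mu * x_ j)).
  apply: eq_bigr => l _; rewrite mxE /=.
  rewrite (funext (gF_trig l)).
  rewrite derive1_trig /trig mulr_suml; apply: eq_bigr => k _; ring.
rewrite exchange_big /=; apply: eq_bigr => k _.
rewrite /dsin /dcos !mulr_sumr -sumrN !mulr_suml -big_split/=.
by apply: eq_bigr => l _; ring.
Qed.

Lemma fourier_D2_interp w j :
  (fourier_D xL xR N 2 *m w) j 0 = derive1n 2 (interp w) (x_ j).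
Proof.
rewrite /interp /= !derive1_trig mxE /trig.
have -> : \sum_l fourier_D xL xR N 2 j l * w l 0 = \sum_(l < N) \sum_(k < m.+1)
  (k%:R * mu * - (k%:R * mu * (wfold k / N%:R * (w l 0 * cos (k%:R * mu * x_ l)))) * cos (k%:R * mu * x_ j) +
   - (k%:R * mu * (k%:R * mu * (wfold k / N%:R * (w l 0 * sin (k%:R * mu * x_ l))))) * sin (k%:R * mu * x_ j)).
  apply: eq_bigr => l _; rewrite mxE /=.
  rewrite (funext (gF_trig l)).
  rewrite !derive1_trig /trig mulr_suml; apply: eq_bigr => k _; ring.
rewrite exchange_big /=; apply: eq_bigr => k _.
rewrite /dsin /dcos !(mulr_sumr, =^~ sumrN) !mulr_suml -big_split/=.
by apply: eq_bigr => l _; ring.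
Qed.

Definition sample (f : R -> R) : 'cV[R]_N := \col_j f (x_ j).

(** With theta = mu (x_j - x_l), a multiple of pi / m, the folded sum of cosines
    telescopes to a multiple of sin (m theta) = 0 when j and l differ. *)
Lemma interp_grid w (j : 'I_N) : interp w (x_ j) = w j 0.
Proof.
have -> : interp w (x_ j) = \sum_(l < N) w l 0 *
    (N%:R^-1 * \sum_(k < m.+1) wfold k * cos (k%:R * (mu * x_ j - mu * x_ l))).
  rewrite /interp /trig.
  rewrite [RHS](eq_bigr (fun l : 'I_N => \sum_(k < m.+1) w l 0 * (N%:R^-1 * (wfold k *
    cos (k%:R * (mu * x_ j - mu * x_ l)))))); last first.
    by move=> l _; rewrite !mulr_sumr.
  rewrite exchange_big; apply: eq_bigr => k _ /=.
  rewrite /dsin /dcos !mulr_sumr !mulr_suml -big_split/=.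
  by apply: eq_bigr => l _; rewrite mulrBr cosB !mulrA; ring.
have sumE th : \sum_(k < m.+1) wfold k * cos (k%:R * th) =
    \sum_(k < m) cos (0 + k%:R * th) + \sum_(k < m) cos (th + k%:R * th).
  have -> : \sum_(k < m) cos (0 + k%:R * th) = \sum_(k < m.+1) (k != m :> nat)%:R * cos (k%:R * th).
    rewrite big_ord_recr/= eqxx mul0r addr0; apply: eq_bigr => k _.
    by rewrite ltn_eqF// mul1r add0r.
  have -> : \sum_(k < m) cos (th + k%:R * th) = \sum_(k < m.+1) (k != 0%N :> nat)%:R * cos (k%:R * th).
    rewrite big_ord_recl/= mul0r add0r; apply: eq_bigr => k _.
    by rewrite /= /bump mul1r natrD mulrDl mul1r.
  rewrite -big_split/=; apply: eq_bigr => k _; rewrite -mulrDl /wfold.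
  have [->|k0] := eqVneq (k : nat) 0%N; first by rewrite (ltn_eqF m0)/= addr0.
  by case: eqVneq => _ /=; rewrite ?add0r -?natrD.
rewrite (bigD1 j)//= [X in _ + X]big1 => [|l lj].
  rewrite subrr sumE; under eq_bigr do rewrite add0r mulr0 cos0.
  by rewrite addr0 sumr_const card_ord -natrD addnn -NE mulVf ?mulr1// lt0r_neq0.
set th := _ - _.
suff -> : \sum_(k < m.+1) wfold k * cos (k%:R * th) = 0 by rewrite !mulr0.
have thE : exists2 s : R, s = 1 \/ s = -1 & exists2 d, (0 < d < N)%N &
    th = s * (d%:R * (2 * pi / N%:R)).
  rewrite /th !wavenumber_grid.
  have [jl|lj'] := ltnP j l.
    exists (-1); [by right | exists (l - j)%N; last by rewrite natrB ?(ltnW jl)//; ring].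
    by rewrite subn_gt0 jl/=; have := ltn_ord l; lia.
  exists 1; [by left | exists (j - l)%N; last by rewrite natrB//; ring].
  move: lj; rewrite -val_eqE/= => lj; have := ltn_ord j; lia.
have [s hs [d /andP[d0 dN] thd]] := thE.
have Nd : ~~ (N %| d)%N by rewrite gtnNdvd.
have sinth : sin (th / 2) != 0.
  have -> : th / 2 = s * (d%:R * pi / N%:R) by rewrite thd; field; rewrite lt0r_neq0.
  have := sin_rational_neq0 R N0 Nd.
  by case: hs => ->; rewrite ?mul1r// mulN1r sinN oppr_eq0.
have sinm : sin (m%:R * th) = 0.
  have -> : m%:R * th = s * (0 + d%:R * pi).
    rewrite thd add0r NE -muln2 natrM; field.
    by rewrite pnatr_eq0 -lt0n m0.
  have := sinDnpi (0 : R) d; rewrite sin0 mulr0.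
  by case: hs => -> h; rewrite ?mul1r// mulN1r sinN h oppr0.
suff : 2 * sin (th / 2) * \sum_(k < m.+1) wfold k * cos (k%:R * th) = 0.
  move/eqP; rewrite mulf_eq0 => /orP[|/eqP//].
  by rewrite mulf_eq0 pnatr_eq0/= (negbTE sinth).
rewrite sumE mulrDr !sum_cos_telescope.
have -> : th - th / 2 = th / 2 by field.
have -> : th + m%:R * th - th / 2 = m%:R * th + th / 2 by field.
by rewrite !add0r sinN sinB sinD sinm; ring.
Qed.

(** * Discrete inner products and the energy norm *)

(** The symbol of 1 - sigma d^2/dx^2. *)
Definition omega k : R := 1 + sigma * (k%:R * mu) ^+ 2.

Definition ip v w : R := N%:R^-1 * \sum_(j < N) v j 0 * w j 0.
Definition opA : 'M[R]_N := 1%:M - sigma *: fourier_D xL xR N 2.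
Definition n2 v : R := Num.sqrt (ip v v).
(** The energy conserved by the scheme: a discrete H^1 norm. *)
Definition nE v : R := Num.sqrt (ip (opA *m v) v).

Lemma omega_ge1 k : 1 <= omega k.
Proof. by rewrite lerDl mulr_ge0 ?sqr_ge0// ltW. Qed.

Lemma omega_gt0 k : 0 < omega k.
Proof. exact: lt_le_trans ltr01 (omega_ge1 k). Qed.

Lemma omega_ge0 k : 0 <= omega k.
Proof. exact: ltW (omega_gt0 k). Qed.

Lemma ip_sumE v w (f : 'I_N -> R) : (forall j, v j 0 = f j) ->
  ip v w = N%:R^-1 * \sum_(j < N) f j * w j 0.
Proof. by move=> h; congr (_ * _); apply: eq_bigr => j _; rewrite h. Qed.

Lemma ipDl v v' w : ip (v + v') w = ip v w + ip v' w.
Proof.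
rewrite /ip -mulrDr -big_split/=; congr (_ * _).
by apply: eq_bigr => j _; rewrite mxE mulrDl.
Qed.

Lemma ipZl c v w : ip (c *: v) w = c * ip v w.
Proof.
rewrite /ip [RHS]mulrCA; congr (_ * _); rewrite mulr_sumr.
by apply: eq_bigr => j _; rewrite mxE mulrA.
Qed.

Lemma ipC v w : ip v w = ip w v.
Proof. by rewrite /ip; congr (_ * _); apply: eq_bigr => j _; rewrite mulrC. Qed.

Lemma ipNl v w : ip (- v) w = - ip v w.
Proof. by rewrite -scaleN1r ipZl mulN1r. Qed.

Lemma ipBl v v' w : ip (v - v') w = ip v w - ip v' w.
Proof. by rewrite ipDl ipNl. Qed.

Lemma ipDr v w w' : ip v (w + w') = ip v w + ip v w'.
Proof. by rewrite ipC ipDl !(ipC v). Qed.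

Lemma ipZr c v w : ip v (c *: w) = c * ip v w.
Proof. by rewrite ipC ipZl (ipC v). Qed.

Lemma ip_trig v w A B n : (forall j : 'I_N, v j 0 = trig mu A B n (x_ j)) ->
  ip v w = N%:R^-1 * \sum_(k < n) (A k * dcos w k + B k * dsin w k).
Proof.
move=> /ip_sumE ->; congr (_ * _); rewrite /trig.
rewrite (eq_bigr (fun j : 'I_N => \sum_(k < n) (w j 0 * (A k * cos (k%:R * mu * x_ j) +
  B k * sin (k%:R * mu * x_ j))))); last first.
  by move=> j _; rewrite mulrC mulr_sumr.
rewrite exchange_big; apply: eq_bigr => k _ /=.
by rewrite /dcos /dsin !mulr_sumr -big_split/=; apply: eq_bigr => j _; ring.
Qed.

(** The forms of the identity and of 1 - sigma D2 are diagonal in the discrete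
    Fourier variables, which reduces their estimates to Cauchy-Schwarz. *)
Definition diag_form (g : nat -> R) v w : R := \sum_(k < m.+1)
  wfold k * g k * (dcos v k / N%:R * (dcos w k / N%:R) +
                   dsin v k / N%:R * (dsin w k / N%:R)).

Lemma ip_diag v w : ip v w = diag_form (fun=> 1) v w.
Proof.
rewrite (ip_trig w (fun j => esym (interp_grid v j))) /diag_form mulr_sumr.
by apply: eq_bigr => k _; ring.
Qed.

Lemma opA_trig v A B n :
  (forall j : 'I_N, (fourier_D xL xR N 2 *m v) j 0 = derive1n 2 (trig mu A B n) (x_ j)) ->
  (forall j : 'I_N, v j 0 = trig mu A B n (x_ j)) ->
  forall j : 'I_N, (opA *m v) j 0 =
    trig mu (fun k => omega k * A k) (fun k => omega k * B k) n (x_ j).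
Proof.
move=> h2 h0 j; rewrite mulmxBl mul1mx -scalemxAl 2!mxE h0 [X in _ + - X]mxE h2.
rewrite /= !derive1_trig -mulNr trigZ trigD; apply: eq_trig => k _; rewrite /omega; ring.
Qed.

Lemma ip_opA v w : ip (opA *m v) w = diag_form omega v w.
Proof.
rewrite (ip_trig w (opA_trig (fourier_D2_interp v) (fun j => esym (interp_grid v j)))).
rewrite /diag_form mulr_sumr.
by apply: eq_bigr => k _; ring.
Qed.

Lemma ip_D1 v w : ip (fourier_D xL xR N 1 *m v) w = \sum_(k < m.+1)
  wfold k * (k%:R * mu * dsin v k / N%:R * (dcos w k / N%:R) +
             - (k%:R * mu * dcos v k / N%:R) * (dsin w k / N%:R)).
Proof.
rewrite (@ip_trig _ w (fun k => k%:R * mu * (wfold k / N%:R * dsin v k))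
  (fun k => - (k%:R * mu * (wfold k / N%:R * dcos v k))) m.+1); last first.
  by move=> j; rewrite fourier_D1_interp /interp derive1_trig.
by rewrite mulr_sumr; apply: eq_bigr => k _; ring.
Qed.

Lemma ip_D1_skew v w :
  ip (fourier_D xL xR N 1 *m v) w = - ip v (fourier_D xL xR N 1 *m w).
Proof.
by rewrite (ipC v) !ip_D1 -sumrN; apply: eq_bigr => k _; ring.
Qed.

Lemma ip_opA_sym v w : ip (opA *m v) w = ip (opA *m w) v.
Proof. by rewrite !ip_opA; apply: eq_bigr => k _; ring. Qed.

Let wfold_ge0 k : 0 <= wfold k.
Proof. exact: le_trans ler01 (wfold_ge1 k). Qed.

Lemma diag_form_ge0 g v : (forall k, 0 <= g k) -> 0 <= diag_form g v v.
Proof.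
move=> g0; apply: sumr_ge0 => k _.
by rewrite mulr_ge0 ?addr_ge0 -?expr2 ?sqr_ge0// mulr_ge0.
Qed.

Lemma ip_ge0 v : 0 <= ip v v.
Proof. by rewrite ip_diag diag_form_ge0. Qed.

Lemma ipE_ge0 v : 0 <= ip (opA *m v) v.
Proof. by rewrite ip_opA diag_form_ge0// => k; exact: omega_ge0. Qed.

Lemma n2_ge0 v : 0 <= n2 v. Proof. exact: sqrtr_ge0. Qed.
Lemma nE_ge0 v : 0 <= nE v. Proof. exact: sqrtr_ge0. Qed.

Lemma n2_sqr v : n2 v ^+ 2 = ip v v.
Proof. by rewrite sqr_sqrtr ?ip_ge0. Qed.

Lemma nE_sqr v : nE v ^+ 2 = ip (opA *m v) v.
Proof. by rewrite sqr_sqrtr ?ipE_ge0. Qed.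

Lemma diag_form_cs g v w : (forall k, 0 <= g k) ->
  `|diag_form g v w| <= Num.sqrt (diag_form g v v) * Num.sqrt (diag_form g w w).
Proof.
move=> g0; apply: cauchy_schwarz_sqrt; try exact: diag_form_ge0.
apply: (@cauchy_schwarz_sum _ _ _ _ (fun k : 'I_m.+1 => wfold k * g k)).
by move=> k _; rewrite mulr_ge0.
Qed.

Lemma ip_le v w : `|ip v w| <= n2 v * n2 w.
Proof. by rewrite /n2 !ip_diag diag_form_cs. Qed.

Lemma ipE_le v w : `|ip (opA *m v) w| <= nE v * nE w.
Proof. by rewrite /nE !ip_opA diag_form_cs// => k; exact: omega_ge0. Qed.

Lemma n2_le_nE v : n2 v <= nE v.
Proof.
rewrite /n2 /nE ip_diag ip_opA ler_sqrt; last first.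
  by rewrite diag_form_ge0// => k; exact: omega_ge0.
apply: ler_sum => k _; rewrite ler_wpM2r ?addr_ge0 -?expr2 ?sqr_ge0//.
by rewrite ler_wpM2l// omega_ge1.
Qed.

(** (k mu)^2 <= omega k / sigma: a derivative is controlled by the energy. *)
Lemma ip_D1_le v w :
  `|ip (fourier_D xL xR N 1 *m v) w| <= (Num.sqrt sigma)^-1 * nE v * n2 w.
Proof.
rewrite /nE /n2 -sqrtrV ?(ltW sigma0)// -sqrtrM ?invr_ge0 ?(ltW sigma0)//.
apply: cauchy_schwarz_sqrt; [|exact: ip_ge0|].
  by rewrite mulr_ge0 ?ipE_ge0// invr_ge0 ltW.
rewrite ip_D1; apply: le_trans (cauchy_schwarz_sum _ _ _ _ _ _) _; first by [].
rewrite [X in _ * X](_ : _ = ip w w); last first.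
  by rewrite ip_diag; apply: eq_bigr => k _; rewrite !expr2 mulr1.
rewrite ler_wpM2r ?ip_ge0// ip_opA mulr_sumr; apply: ler_sum => k _.
have -> : (k%:R * mu * dsin v k / N%:R) ^+ 2 + (- (k%:R * mu * dcos v k / N%:R)) ^+ 2 =
   (k%:R * mu) ^+ 2 * (dcos v k / N%:R * (dcos v k / N%:R) +
               dsin v k / N%:R * (dsin v k / N%:R)) by ring.
rewrite [leRHS]mulrA [sigma^-1 * _]mulrCA -[leRHS]mulrA ler_wpM2l//.
rewrite ler_wpM2r ?addr_ge0 -?expr2 ?sqr_ge0//.
by rewrite /omega mulrDr mulrA mulVf ?gt_eqF// mul1r lerDr mulr1 invr_ge0 ltW.
Qed.

Lemma n2_D1_le v : n2 (fourier_D xL xR N 1 *m v) <= (Num.sqrt sigma)^-1 * nE v.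
Proof.
set y := _ *m v; have := ip_D1_le v y.
rewrite ger0_norm ?ip_ge0// -n2_sqr expr2.
have [->|y0] := eqVneq (n2 y) 0.
  by rewrite mulr_ge0 ?invr_ge0 ?sqrtr_ge0.
by rewrite ler_pM2r// lt_neqAle eq_sym y0 n2_ge0.
Qed.

Lemma n2D v w : n2 (v + w) <= n2 v + n2 w.
Proof.
rewrite -ler_sqr ?nnegrE ?addr_ge0 ?n2_ge0// sqrrD !n2_sqr ipDl !ipDr (ipC w v).
have := ip_le v w; rewrite ler_norml => /andP[_ h]; rewrite -mulr_natr; lra.
Qed.

Lemma nED v w : nE (v + w) <= nE v + nE w.
Proof.
rewrite -ler_sqr ?nnegrE ?addr_ge0 ?nE_ge0// sqrrD !nE_sqr mulmxDr ipDl !ipDr.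
rewrite (ip_opA_sym w v).
have := ipE_le v w; rewrite ler_norml => /andP[_ h]; rewrite -mulr_natr; lra.
Qed.

Lemma nEZ c v : nE (c *: v) = `|c| * nE v.
Proof.
by rewrite /nE -scalemxAr ipZl ipZr mulrA -expr2 sqrtrM ?sqr_ge0// sqrtr_sqr.
Qed.

Lemma nEN v : nE (- v) = nE v.
Proof. by rewrite -scaleN1r nEZ normrN1 mul1r. Qed.

Lemma nEB v w : nE (v - w) <= nE v + nE w.
Proof. by rewrite -(nEN w) nED. Qed.

(** Cauchy-Schwarz with the weights 1 / omega and omega: on the left stands the
    dual of the energy norm. *)
Lemma ip_trig_le A B n w : (n <= m.+1)%N ->
  `|ip (sample (trig mu A B n)) w| <=
  Num.sqrt (\sum_(k < n) (A k ^+ 2 + B k ^+ 2) / omega k) * nE w.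
Proof.
move=> nm; apply: cauchy_schwarz_sqrt; [|exact: ipE_ge0|].
  by apply: sumr_ge0 => k _; rewrite divr_ge0 ?omega_ge0 ?addr_ge0 ?sqr_ge0.
rewrite (@ip_trig _ _ A B n); last by move=> j; rewrite mxE.
rewrite mulr_sumr (eq_bigr (fun k : 'I_n => omega k *
  (A k / omega k * (dcos w k / N%:R) + B k / omega k * (dsin w k / N%:R)))); last first.
  by move=> k _; field; rewrite !gt_eqF ?omega_gt0.
apply: le_trans (cauchy_schwarz_sum _ _ _ _ _ _) _ => [k _|]; first exact: omega_ge0.
apply: ler_pM.
- apply: sumr_ge0 => k _.
  by rewrite mulr_ge0 ?omega_ge0 ?addr_ge0 ?sqr_ge0.
- apply: sumr_ge0 => k _.
  by rewrite mulr_ge0 ?omega_ge0 ?addr_ge0 ?sqr_ge0.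
- apply: ler_sum => k _; rewrite le_eqVlt; apply/orP; left; apply/eqP.
  by field; rewrite gt_eqF ?omega_gt0.
rewrite ip_opA /diag_form (big_ord_widen _ (fun k => omega k *
  ((dcos w k / N%:R) ^+ 2 + (dsin w k / N%:R) ^+ 2)) nm) big_mkcond/=.
apply: ler_sum => k _; rewrite -!expr2 -mulrA.
have h : 0 <= omega k * ((dcos w k / N%:R) ^+ 2 + (dsin w k / N%:R) ^+ 2).
  by rewrite mulr_ge0 ?omega_ge0 ?addr_ge0 ?sqr_ge0.
by case: ifP => _; [rewrite ler_peMl// wfold_ge1|rewrite mulr_ge0].
Qed.

Definition sup_const : R := Num.sqrt (2 + 4 / (sigma * mu ^+ 2)).

(** Discrete Sobolev embedding of H^1 into the bounded functions, with a
    constant independent of N because the sum of 1 / omega k converges. *)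
Lemma grid_le_nE w j : `|w j 0| <= sup_const * nE w.
Proof.
apply: cauchy_schwarz_sqrt; [|exact: ipE_ge0|].
  by rewrite addr_ge0// divr_ge0// mulr_ge0 ?sqr_ge0// ltW.
rewrite -interp_grid /interp /trig.
rewrite (eq_bigr (fun k : 'I_m.+1 => (wfold k * omega k) *
  (cos (k%:R * mu * x_ j) / omega k * (dcos w k / N%:R) +
   sin (k%:R * mu * x_ j) / omega k * (dsin w k / N%:R)))); last first.
  by move=> k _; field; rewrite !gt_eqF ?omega_gt0.
apply: le_trans (cauchy_schwarz_sum _ _ _ _ _ _) _ => [k _|].
  by rewrite mulr_ge0// omega_ge0.
rewrite ip_opA ler_wpM2r ?diag_form_ge0// => [k|]; first exact: omega_ge0.
apply: le_trans (_ : \sum_(k < m.+1) 2 / omega k <= _).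
  apply: ler_sum => k _.
  have -> : wfold k * omega k * ((cos (k%:R * mu * x_ j) / omega k) ^+ 2 +
     (sin (k%:R * mu * x_ j) / omega k) ^+ 2) = wfold k / omega k *
     (cos (k%:R * mu * x_ j) ^+ 2 + sin (k%:R * mu * x_ j) ^+ 2).
    by field; rewrite gt_eqF ?omega_gt0.
  by rewrite cos2Dsin2 mulr1 ler_wpM2r ?wfold_le2// invr_ge0 omega_ge0.
rewrite big_ord_recl/= {1}/omega mul0r expr0n/= mulr0 addr0 divr1 lerD2l.
have mu0 := wavenumber_gt0; have s0 := sigma0.
apply: le_trans (_ : \sum_(k < m) 2 / (sigma * mu ^+ 2) * (k.+1%:R ^+ 2)^-1 <= _).
  apply: ler_sum => k _; rewrite /bump/= add1n -mulrA ler_wpM2l// -invfM.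
  rewrite lef_pV2 ?posrE ?omega_gt0 ?mulr_gt0 ?exprn_gt0 ?ltr0n//.
  by rewrite /omega exprMn mulrAC mulrA; lra.
rewrite -mulr_sumr.
have := @sum_inv_sqr_le R 1 m.+1 isT; rewrite big_add1/= big_mkord divr1 => h.
have -> : 4 / (sigma * mu ^+ 2) = 2 / (sigma * mu ^+ 2) * 2 :> R.
  by field; rewrite !gt_eqF.
by rewrite ler_wpM2l// divr_ge0// mulr_ge0 ?sqr_ge0// ltW.
Qed.

(** Inverse inequality: omega k is at most omega m on the grid. *)
Lemma nE_le_n2 w : nE w <= Num.sqrt (omega m) * n2 w.
Proof.
rewrite /nE /n2 -sqrtrM ?omega_ge0// ler_sqrt; last first.
  by rewrite mulr_ge0 ?ip_ge0 ?omega_ge0.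
rewrite ip_opA ip_diag mulr_sumr; apply: ler_sum => k _.
rewrite [leRHS]mulrA mulr1 ler_wpM2r ?addr_ge0 -?expr2 ?sqr_ge0//.
rewrite mulrC ler_wpM2r// /omega lerD2l ler_wpM2l ?(ltW sigma0)//.
have mu0 := ltW wavenumber_gt0.
rewrite ler_sqr ?nnegrE ?mulr_ge0// ler_wpM2r// ler_nat; exact: (ltn_ord k).
Qed.

(** For l < m and k <= m, both k + l and |k - l| lie below N, so no aliasing
    occurs; l = m is excluded since sin (m mu x) may vanish on the grid. *)
Lemma dcos_dsin_mode l k : (l < m)%N -> (k <= m)%N ->
  [/\ dcos (sample (fun x => cos (l%:R * mu * x))) k = (l == k)%:R * (N%:R / wfold k),
      dsin (sample (fun x => cos (l%:R * mu * x))) k = 0,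
      dcos (sample (fun x => sin (l%:R * mu * x))) k = 0 &
      (0 < l)%N -> dsin (sample (fun x => sin (l%:R * mu * x))) k = (l == k)%:R * (N%:R / wfold k)].
Proof.
move=> lm km.
pose S b := \sum_(j < N) cos ((l%:R - k%:R) * mu * x_ j + b).
pose T b := \sum_(j < N) cos ((l%:R + k%:R) * mu * x_ j + b).
have SE b : S b = (l == k)%:R * (N%:R * cos b).
  rewrite /S; case: eqVneq => [->|lk].
    under eq_bigr do rewrite subrr !mul0r add0r.
    by rewrite sumr_const card_ord mul1r mulr_natl.
  rewrite mul0r sum_grid_cos_diff// gtnNdvd; lia.
have TE b : T b = ((l == 0%N) && (k == 0%N))%:R * (N%:R * cos b).
  rewrite /T; case: eqVneq => [->|l0]; last first.
    rewrite mul0r sum_grid_cos_add// gtnNdvd; lia.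
  case: eqVneq => [->|k0].
    under eq_bigr do rewrite addr0 !mul0r add0r.
    by rewrite sumr_const card_ord mul1r mulr_natl.
  rewrite mul0r sum_grid_cos_add// gtnNdvd; lia.
have N1 : (N%:R : R) != 0 by rewrite gt_eqF.
split.
- have -> : dcos (sample (fun x => cos (l%:R * mu * x))) k = (S 0 + T 0) / 2.
    rewrite /S /T -big_split/= mulr_suml; apply: eq_bigr => j _.
    rewrite mxE !addr0 !mulrBl !mulrDl cosB cosD; by field.
  rewrite SE TE cos0 mulr1 /wfold; case: eqVneq => [<-|lk].
    have -> : (l == m) = false by lia.
    by rewrite andbb orbF; case: eqVneq => _ /=; field.
  rewrite (_ : _ && _ = false) ?mul0r ?addr0 ?mul0r//; lia.
- have -> : dsin (sample (fun x => cos (l%:R * mu * x))) k =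
      (S (pi / 2) - T (pi / 2)) / 2.
    rewrite /S /T -sumrB/= mulr_suml; apply: eq_bigr => j _.
    rewrite mxE !cosDpihalf !mulrBl !mulrDl sinB sinD; by field.
  by rewrite SE TE cos_pihalf !mulr0 subrr mul0r.
- have -> : dcos (sample (fun x => sin (l%:R * mu * x))) k =
      - (S (pi / 2) + T (pi / 2)) / 2.
    rewrite /S /T -big_split/= -sumrN mulr_suml; apply: eq_bigr => j _.
    rewrite mxE !cosDpihalf !mulrBl !mulrDl sinB sinD; by field.
  by rewrite SE TE cos_pihalf !mulr0 addr0 oppr0 mul0r.
move=> l0.
have -> : dsin (sample (fun x => sin (l%:R * mu * x))) k = (S 0 - T 0) / 2.
  rewrite /S /T -sumrB/= mulr_suml; apply: eq_bigr => j _.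
  rewrite mxE !addr0 !mulrBl !mulrDl cosB cosD; by field.
rewrite SE TE cos0 mulr1 /wfold; case: eqVneq => [<-|lk].
  have -> : (l == m) = false by lia.
  by rewrite andbb orbF; case: eqVneq => [|_] /=; [lia|field].
rewrite (_ : _ && _ = false) ?mul0r ?subr0 ?mul0r//; lia.
Qed.

(** Grid orthogonality recovers the coefficients below the Nyquist mode, hence
    the differentiation matrices are exact there. *)
Lemma interp_sample A B n x : (n <= m)%N ->
  interp (sample (trig mu A B n)) x = trig mu A B n x.
Proof.
move=> nm.
have dcosE k : (k <= m)%N -> dcos (sample (trig mu A B n)) k =
    (k < n)%:R * A k * (N%:R / wfold k).
  move=> km; have -> : dcos (sample (trig mu A B n)) k = \sum_(l < n)
     (A l * dcos (sample (fun x => cos (l%:R * mu * x))) k +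
      B l * dcos (sample (fun x => sin (l%:R * mu * x))) k).
    rewrite (eq_bigr (fun l : 'I_n => \sum_(j < N)
      (A l * cos (l%:R * mu * x_ j) + B l * sin (l%:R * mu * x_ j)) * cos (k%:R * mu * x_ j))).
      by rewrite exchange_big; apply: eq_bigr => j _; rewrite mxE /trig mulr_suml.
    move=> l _; rewrite /dcos !mulr_sumr -big_split/=.
    by apply: eq_bigr => j _; rewrite !mxE; ring.
  rewrite (eq_bigr (fun l : 'I_n => (l == k :> nat)%:R * A l * (N%:R / wfold k))).
    case: ltnP => [kn|nk]; last first.
      rewrite !mul0r big1// => l _; rewrite (_ : _ == _ = false) ?mul0r//.
      by have := ltn_ord l; lia.
    rewrite (bigD1 (Ordinal kn))//= eqxx big1 ?addr0// => l.
    by rewrite -val_eqE/= => /negbTE ->; rewrite !mul0r.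
  move=> l _; have [-> _ -> _] := dcos_dsin_mode (leq_trans (ltn_ord l) nm) km.
  by ring.
have dsinE k : (0 < k <= m)%N -> dsin (sample (trig mu A B n)) k =
    (k < n)%:R * B k * (N%:R / wfold k).
  move=> /andP[k0 km]; have -> : dsin (sample (trig mu A B n)) k = \sum_(l < n)
     (A l * dsin (sample (fun x => cos (l%:R * mu * x))) k +
      B l * dsin (sample (fun x => sin (l%:R * mu * x))) k).
    rewrite (eq_bigr (fun l : 'I_n => \sum_(j < N)
      (A l * cos (l%:R * mu * x_ j) + B l * sin (l%:R * mu * x_ j)) * sin (k%:R * mu * x_ j))).
      by rewrite exchange_big; apply: eq_bigr => j _; rewrite mxE /trig mulr_suml.
    move=> l _; rewrite /dsin !mulr_sumr -big_split/=.
    by apply: eq_bigr => j _; rewrite !mxE; ring.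
  rewrite (eq_bigr (fun l : 'I_n => (l == k :> nat)%:R * B l * (N%:R / wfold k))).
    case: ltnP => [kn|nk]; last first.
      rewrite !mul0r big1// => l _; rewrite (_ : _ == _ = false) ?mul0r//.
      by have := ltn_ord l; lia.
    rewrite (bigD1 (Ordinal kn))//= eqxx big1 ?addr0// => l.
    by rewrite -val_eqE/= => /negbTE ->; rewrite !mul0r.
  move=> l _; have [_ -> _ h] := dcos_dsin_mode (leq_trans (ltn_ord l) nm) km.
  have [l0|l0] := posnP l.
    rewrite mulr0 add0r {1}/dsin big1 => [|j _]; last by rewrite mxE l0 !mul0r sin0 mul0r.
    by rewrite l0 (_ : _ == _ = false) ?mul0r ?mulr0//; lia.
  by rewrite h//; ring.
have b1 : true%:R = 1 :> R by [].
have b0 : false%:R = 0 :> R by [].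
have wf0 k : wfold k != 0 by rewrite gt_eqF// (lt_le_trans ltr01)// wfold_ge1.
have N1 : (N%:R : R) != 0 by rewrite gt_eqF.
rewrite (trig_widen mu A B x (leq_trans nm (leqnSn m))) /interp.
apply: eq_bigr => -[k km] _ /=; rewrite dcosE//.
have [->|k0] := posnP k.
  rewrite !mul0r sin0 !mulr0 !addr0; congr (_ * _).
  by case: ifP => _; rewrite ?b1 ?b0; field; rewrite wf0.
rewrite dsinE ?k0//; congr (_ * _ + _ * _); by case: ifP => _; rewrite ?b1 ?b0; field; rewrite wf0.
Qed.

Lemma D1_sample A B n j : (n <= m)%N ->
  (fourier_D xL xR N 1 *m sample (trig mu A B n)) j 0 =
  derive1 (trig mu A B n) (x_ j).
Proof.
by move=> nm; rewrite fourier_D1_interp (funext (fun x => interp_sample A B x nm)).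
Qed.

Lemma opA_sample A B n : (n <= m)%N -> opA *m sample (trig mu A B n) =
  sample (trig mu (fun k => omega k * A k) (fun k => omega k * B k) n).
Proof.
move=> nm; apply/matrixP => j i; rewrite !ord1 [RHS]mxE; apply: opA_trig => {}j.
  by rewrite fourier_D2_interp (funext (fun x => interp_sample A B x nm)).
by rewrite mxE.
Qed.

Lemma nE_sample_le A B n : (n <= m)%N ->
  nE (sample (trig mu A B n)) <=
  Num.sqrt (\sum_(k < n) omega k * (A k ^+ 2 + B k ^+ 2)).
Proof.
move=> nm; set v := sample _.
have := @ip_trig_le (fun k => omega k * A k) (fun k => omega k * B k) n v (leqW nm).
rewrite -opA_sample// -nE_sqr ger0_norm ?sqr_ge0// expr2.
rewrite [X in Num.sqrt X](eq_bigr (fun k : 'I_n => omega k * (A k ^+ 2 + B k ^+ 2))); last first.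
  by move=> k _; field; rewrite gt_eqF ?omega_gt0.
have [->|v0] := eqVneq (nE v) 0; first by rewrite sqrtr_ge0.
by rewrite ler_pM2r// lt_neqAle eq_sym v0 nE_ge0.
Qed.

(** Modes of frequencies k and l interact on the grid only if they are
    aliases, k = l or k = - l modulo N; along one residue class the weights
    1/l^2 with l >= N/4 add up to O(N^-2), and Schur's test concludes. *)
Lemma ip_alias_le A B n :
  (forall k, (4 * k < N)%N -> A k = 0 /\ B k = 0) ->
  ip (sample (trig mu A B n)) (sample (trig mu A B n)) <=
  72 / N%:R ^+ 2 * \sum_(k < n) k%:R ^+ 2 * (A k ^+ 2 + B k ^+ 2).
Proof.
move=> AB0; pose y k := `|A k| + `|B k|.
pose al k l := (N %| `|k%:Z - l%:Z|)%N || (N %| k + l)%N.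
have y0 k : 0 <= y k by rewrite addr_ge0.
have yz k : (4 * k < N)%N -> y k = 0.
  by move=> /AB0[a0 b0]; rewrite /y a0 b0 normr0 addr0.
have y2 k : y k ^+ 2 <= 2 * (A k ^+ 2 + B k ^+ 2).
  rewrite -(real_normK (num_real (A k))) -(real_normK (num_real (B k))) /y.
  have := sqr_ge0 (`|A k| - `|B k|); rewrite !expr2; nra.
pose md k j := A k * cos (k%:R * mu * x_ j) + B k * sin (k%:R * mu * x_ j).
have md_le k j : `|md k j| <= y k.
  rewrite (le_trans (ler_normD _ _))// lerD// normrM ler_piMr//.
    exact: cos_max.
  exact: sin_max.
have md_sum k l : `|\sum_(j < N) md k j * md l j| <= (al k l)%:R * (N%:R * (y k * y l)).
  case: (boolP (al k l)) => [_|].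
    rewrite mul1r; apply: le_trans (ler_norm_sum _ _ _) _.
    apply: le_trans (_ : \sum_(j < N) y k * y l <= _).
      by apply: ler_sum => j _; rewrite normrM ler_pM.
    by rewrite sumr_const card_ord mulr_natl.
  rewrite negb_or => /andP[n1 n2'].
  have d1 b := sum_grid_cos_diff b n1; have d2 b := sum_grid_cos_add b n2'.
  suff -> : \sum_(j < N) md k j * md l j =
    (A k * A l + B k * B l) / 2 * (\sum_(j < N) cos ((k%:R - l%:R) * mu * x_ j + 0)) +
    (A k * A l - B k * B l) / 2 * (\sum_(j < N) cos ((k%:R + l%:R) * mu * x_ j + 0)) -
    (B k * A l - A k * B l) / 2 * (\sum_(j < N) cos ((k%:R - l%:R) * mu * x_ j + pi / 2)) -
    (B k * A l + A k * B l) / 2 * (\sum_(j < N) cos ((k%:R + l%:R) * mu * x_ j + pi / 2)).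
    by rewrite !d1 !d2 !mulr0 addr0 !subr0 normr0 mul0r.
  rewrite !mulr_sumr -!(big_split, sumrB)/=; apply: eq_bigr => j _.
  rewrite /md !cosDpihalf !addr0 !mulrBl !mulrDl cosB cosD sinB sinD; by field.
have al_sum k : \sum_(l < n | (N <= 4 * l)%N) (al k l)%:R * (l%:R ^+ 2)^-1 <=
    36 / N%:R ^+ 2 :> R.
  have h c := @sum_inv_sqr_residue_le R N c n N0.
  apply: le_trans (_ : \sum_(l < n | (N <= 4 * l)%N && (l %% N == k %% N)%N) (l%:R ^+ 2)^-1 +
     \sum_(l < n | (N <= 4 * l)%N && (l %% N == (N - k %% N) %% N)%N) (l%:R ^+ 2)^-1 <= _); last first.
    apply: le_trans (lerD (h _) (h _)) _.
    by rewrite -mulrDl -natrD.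
  rewrite [X in X <= _]big_mkcond [X in _ <= X + _]big_mkcond [X in _ <= _ + X]big_mkcond.
  rewrite -big_split/=; apply: ler_sum => l _.
  case: (N <= 4 * l)%N => /=; last by rewrite addr0.
  have i0 : 0 <= (l%:R ^+ 2 : R)^-1 by rewrite invr_ge0 sqr_ge0.
  rewrite /al; case: (boolP (N %| `|_|)%N) => [d1|_] /=.
    have -> : (l %% N == k %% N)%N.
      have [lk|/ltnW kl] := leqP l k.
        by move: d1; rewrite distnEl// -eqn_mod_dvd// eq_sym.
      by move: d1; rewrite distnEr// -eqn_mod_dvd.
    by rewrite mul1r lerDl; case: ifP.
  case: (boolP (N %| k + l)%N) => [d1|_] /=; last first.
    by rewrite mul0r addr_ge0//; case: ifP.
  have -> : (l %% N == (N - k %% N) %% N)%N.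
    rewrite -(eqn_modDr (k %% N)) subnK; last by rewrite ltnW// ltn_mod.
    by rewrite modnn modnDmr addnC.
  by rewrite mul1r lerDr; case: ifP.
have -> : ip (sample (trig mu A B n)) (sample (trig mu A B n)) =
    N%:R^-1 * \sum_(k < n) \sum_(l < n) \sum_(j < N) md k j * md l j.
  congr (_ * _).
  under eq_bigr do rewrite !mxE /trig big_distrlr/=.
  by rewrite exchange_big; apply: eq_bigr => k _ /=; rewrite exchange_big.
apply: le_trans (_ : \sum_(k < n) \sum_(l < n) (al k l)%:R * (y k * y l) <= _).
  rewrite mulr_sumr; apply: ler_sum => k _.
  rewrite mulr_sumr; apply: ler_sum => l _.
  rewrite ler_pdivrMl// mulrCA; exact: le_trans (ler_norm _) (md_sum _ _).
pose W k l : R := (if (N <= 4 * l)%N then (al k l)%:R * (l%:R ^+ 2)^-1 else 0) * (k%:R * y k) ^+ 2.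
apply: le_trans (_ : \sum_(k < n) \sum_(l < n) (W k l + W l k) / 2 <= _).
  apply: ler_sum => k _; apply: ler_sum => l _.
  have alC : al l k = al k l by rewrite /al distnC addnC.
  have W0 k' l' : 0 <= W k' l'.
    by rewrite mulr_ge0 ?sqr_ge0//; case: ifP => // _; rewrite mulr_ge0 ?invr_ge0 ?sqr_ge0.
  have [k4|k4] := ltnP (4 * k) N.
    by rewrite (yz _ k4) mul0r mulr0 divr_ge0// addr_ge0.
  have [l4|l4] := ltnP (4 * l) N.
    by rewrite (yz _ l4) !mulr0 divr_ge0// addr_ge0.
  rewrite /W k4 l4 alC; set t := (al k l)%:R.
  have k0 : (0 : R) < k%:R by rewrite ltr0n; move: N0; lia.
  have l0 : (0 : R) < l%:R by rewrite ltr0n; move: N0; lia.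
  have -> : (t * (l%:R ^+ 2)^-1 * (k%:R * y k) ^+ 2 +
      t * (k%:R ^+ 2)^-1 * (l%:R * y l) ^+ 2) / 2 =
      t * (((k%:R * y k / l%:R) ^+ 2 + (l%:R * y l / k%:R) ^+ 2) / 2).
    by field; rewrite !gt_eqF.
  rewrite ler_wpM2l// ?ler0n//.
  have -> : y k * y l = (k%:R * y k / l%:R) * (l%:R * y l / k%:R).
    by field; rewrite !gt_eqF.
  have := sqr_ge0 (k%:R * y k / l%:R - l%:R * y l / k%:R); rewrite !expr2; nra.
have -> : \sum_(k < n) \sum_(l < n) (W k l + W l k) / 2 = \sum_(k < n) \sum_(l < n) W k l.
  under eq_bigr do rewrite -mulr_suml big_split/=.
  rewrite -mulr_suml big_split/= [X in _ + X]exchange_big/=; by field.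
rewrite mulr_sumr; apply: ler_sum => k _.
rewrite /W -mulr_suml -big_mkcond/=.
apply: le_trans (ler_wpM2r (sqr_ge0 _) (al_sum k)) _.
have -> : (72 : R) / N%:R ^+ 2 = 36 / N%:R ^+ 2 * 2 by field; rewrite gt_eqF.
rewrite -[leRHS]mulrA ler_wpM2l ?divr_ge0 ?sqr_ge0//.
by rewrite exprMn [leRHS]mulrCA ler_wpM2l ?sqr_ge0.
Qed.

End Grid.
(** * Stability of the scheme in the energy norm *)

(** The scheme couples the levels n-1, n and n+1, and the middle one enters with
    the factor K; as that level is already computed, K need not be small. *)
Lemma three_level_gronwall (R : realFieldType) (E : nat -> R) (K b d : R) (Nt : nat) :
  0 <= K -> 0 <= b -> 0 <= d -> E 0%N <= b -> E 1%N <= b ->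
  (forall n, (1 <= n < Nt)%N -> E n.+1 <= E n.-1 + K * E n + d) ->
  forall n, (n <= Nt)%N -> (0 < Nt)%N ->
  E n <= (b + n%:R * d) * (1 + K) ^+ n.
Proof.
move=> K0 b0 d0 E0 E1 rec.
have K1 : 1 <= 1 + K by rewrite lerDl.
suff h n : (n < Nt)%N -> E n <= (b + n%:R * d) * (1 + K) ^+ n /\
    E n.+1 <= (b + n.+1%:R * d) * (1 + K) ^+ n.+1.
  case=> [|n] nNt _; last by have [] := h n nNt.
  by rewrite mul0r addr0 expr0 mulr1.
elim: n => [_|n IH nNt].
  rewrite mul0r addr0 expr0 mulr1; split=> //.
  by rewrite expr1 mul1r; apply: le_trans E1 _; rewrite -[leLHS]mulr1 ler_pM// lerDl.
have [En En1] := IH (ltnW nNt); split=> //.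
apply: le_trans (rec n.+1 _) _; first by rewrite nNt.
have p0 : 1 <= (1 + K) ^+ n.+1 by rewrite exprn_ege1.
have B0 : 0 <= b + n.+1%:R * d by rewrite addr_ge0// mulr_ge0.
have h1 : E n <= (b + n.+1%:R * d) * (1 + K) ^+ n.+1.
  apply: le_trans En _; rewrite ler_pM//.
  - by rewrite addr_ge0// mulr_ge0.
  - by rewrite exprn_ge0// addr_ge0.
  - by rewrite lerD2l ler_wpM2r// ler_nat.
  - by rewrite exprS ler_peMl// exprn_ge0// addr_ge0.
have -> : b + n.+2%:R * d = (b + n.+1%:R * d) + d.
  by rewrite -(@natr1 _ n.+1) [(_ + 1) * d]mulrDl mul1r addrA.
rewrite [X in _ <= _ * X]exprS.
set B := b + _ in h1 En1 B0 *; set q := (1 + K) ^+ _ in h1 En1 p0 *.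
have h2 : K * E n.+1 <= K * (B * q) by rewrite ler_wpM2l.
have h3 : d <= d * ((1 + K) * q).
  by rewrite ler_peMr// mulr_ege1.
rewrite /=; lra.
Qed.

Section Stability.
Variables (R : realType) (a sigma gamma xL xR mu : R) (N m : nat).
Hypotheses (xLR : xL < xR) (muE : mu = wavenumber xL xR).
Hypotheses (sigma0 : 0 < sigma) (gamma0 : 0 < gamma).
Hypotheses (NE : N = m.*2) (m0 : (0 < m)%N).
Implicit Types (u v w e p U : 'cV[R]_N).

Local Notation D1 := (fourier_D xL xR N 1).
Local Notation A := (opA xL xR sigma N).
Local Notation D := (LLF_D a gamma xL xR).
Local Notation nE := (nE xL xR sigma).
Let s1 := (Num.sqrt sigma)^-1.
Let Cs := sup_const mu sigma.

Let ip_D1_skew' := ip_D1_skew xLR muE sigma0 NE m0.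
Let ip_le' := ip_le xLR muE sigma0 NE m0.
Let n2_D1_le' := n2_D1_le xLR muE sigma0 NE m0.
Let n2_le_nE' := n2_le_nE xLR muE sigma0 NE m0.
Let nE_ge0' := @nE_ge0 R xL xR sigma N.
Let n2_ge0' := @n2_ge0 R N.
Let s1_ge0 : 0 <= s1. Proof. by rewrite invr_ge0 sqrtr_ge0. Qed.
Let Cs_ge0 : 0 <= Cs. Proof. exact: sqrtr_ge0. Qed.

(** The entrywise product, written as diag(u) v. *)
Definition had u v : 'cV[R]_N := diag_mx u^T *m v.

Lemma hadE u v j : had u v j 0 = u j 0 * v j 0.
Proof. by rewrite /had mul_diag_mx mxE mxE. Qed.

Lemma hadBl u u' v : had (u - u') v = had u v - had u' v.
Proof. by apply/colP => j; rewrite !(hadE, mxE) mulrBl. Qed.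

Lemma hadDr u v v' : had u (v + v') = had u v + had u v'.
Proof. by rewrite /had mulmxDr. Qed.

Lemma hadZr c u v : had u (c *: v) = c *: had u v.
Proof. by rewrite /had -scalemxAr. Qed.

Lemma hadNr u v : had u (- v) = - had u v.
Proof. by rewrite /had mulmxN. Qed.

Lemma ip_had u v w : ip (had u v) w = ip v (had u w).
Proof. by rewrite /ip; congr (_ * _); apply: eq_bigr => j _; rewrite !hadE; ring. Qed.

Lemma n2_had_le u v c : (forall j, `|u j 0| <= c) -> n2 (had u v) <= c * n2 v.
Proof.
move=> uc; have N0 : (0 < N)%N by rewrite NE double_gt0.
have c0 : 0 <= c := le_trans (normr_ge0 _) (uc (Ordinal N0)).
rewrite /n2 -[c]ger0_norm// -sqrtr_sqr -sqrtrM ?sqr_ge0// ler_sqrt; last first.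
  rewrite mulr_ge0 ?sqr_ge0// mulr_ge0 ?invr_ge0// sumr_ge0// => j _.
  by rewrite -expr2 sqr_ge0.
rewrite /ip mulrCA ler_wpM2l ?invr_ge0// mulr_sumr; apply: ler_sum => j _.
rewrite hadE -!expr2 exprMn ler_wpM2r ?sqr_ge0//.
by rewrite -(real_normK (num_real (u j 0))) ler_sqr ?nnegrE.
Qed.

Lemma LLF_DE U v : D U *m v =
  a *: (D1 *m v) + (gamma / 3) *: (had U (D1 *m v) + D1 *m had U v).
Proof. by rewrite /LLF_D mulmxDl -!scalemxAl mulmxDl /had !mulmxA. Qed.

(** The nonlinear part is discretized in the split form diag(U) D1 + D1 diag(U)
    exactly so that D(U) is skew-symmetric. *)
Lemma LLF_D_skew U v : ip (D U *m v) v = 0.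
Proof.
have D1v : ip (D1 *m v) v = 0.
  have := ip_D1_skew' v v; rewrite (ipC v) => /eqP; rewrite -addr_eq0 -mulr2n mulrn_eq0/=.
  by move/eqP.
rewrite LLF_DE ipDl !ipZl ipDl D1v mulr0 add0r ip_had (ip_D1_skew' (had U v)).
by rewrite (ipC (had U v)) subrr mulr0.
Qed.

(** The part of the nonlinearity that skew-symmetry does not remove. *)
Definition trilin e p w : R := ip (had e (D1 *m p)) w + ip (D1 *m had e p) w.

Lemma trilin_le e p w M : nE p <= M ->
  `|trilin e p w| <= 2 * Cs * s1 * M * nE e * nE w.
Proof.
move=> pM; have sup_e := grid_le_nE xLR muE sigma0 NE m0 e.
have sup_p := grid_le_nE xLR muE sigma0 NE m0 p.
have Ce0 : 0 <= Cs * nE e by rewrite mulr_ge0.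
have h1 : `|ip (had e (D1 *m p)) w| <= Cs * nE e * (s1 * M) * nE w.
  apply: le_trans (ip_le' _ _) _; rewrite ler_pM//.
  apply: le_trans (n2_had_le _ sup_e) _; rewrite ler_wpM2l//.
  by apply: le_trans (n2_D1_le' _) _; rewrite ler_wpM2l.
have h2 : `|ip (D1 *m had e p) w| <= Cs * nE e * M * (s1 * nE w).
  rewrite ip_D1_skew' normrN; apply: le_trans (ip_le' _ _) _; rewrite ler_pM//.
  apply: le_trans (n2_had_le _ sup_e) _; rewrite ler_wpM2l//.
  exact: le_trans (n2_le_nE' p) pM.
apply: le_trans (ler_normD _ _) _; lra.
Qed.

(** The growth rate of the error, proportional to the energy of the comparison
    function. *)
Definition Kstab (M : R) := gamma / 3 * (2 * Cs * s1 * M).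

Lemma Kstab_ge0 M : 0 <= M -> 0 <= Kstab M.
Proof. by move=> M0; rewrite !mulr_ge0// ltW. Qed.

(** Testing the difference of the two schemes with the averaged error kills
    D(U), and the remaining terms are linear in the error: one step of the
    scheme amplifies the energy norm of the error by an explicit increment. *)
Lemma error_step (c M Rs : R) (P U p0 p2 U0 U2 : 'cV[R]_N) :
  0 < c -> 0 <= M -> 0 <= Rs -> nE p0 <= M -> nE p2 <= M ->
  A *m (c *: (U2 - U0)) + D U *m (2^-1 *: (U2 + U0)) = 0 ->
  (forall w, `|ip (A *m (c *: (p2 - p0)) + D P *m (2^-1 *: (p2 + p0))) w| <=
     Rs * nE w) ->
  nE (p2 - U2) - nE (p0 - U0) <= c^-1 * (Kstab M * nE (P - U) + Rs).
Proof.
move=> c0 M0 Rs0 pM0 pM2 sch res.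
set rho := _ + _ in res.
set e2 := p2 - U2; set e0 := p0 - U0; set e := P - U.
pose eh : 'cV[R]_N := 2^-1 *: (e2 + e0); pose ph : 'cV[R]_N := 2^-1 *: (p2 + p0).
have phM : nE ph <= M.
  rewrite nEZ ger0_norm ?invr_ge0//; have := nED xLR muE sigma0 NE m0 p2 p0; lra.
have ehE : nE eh <= (nE e2 + nE e0) / 2.
  rewrite nEZ ger0_norm ?invr_ge0//; have := nED xLR muE sigma0 NE m0 e2 e0; lra.
have rhoE : ip rho eh = c / 2 * (nE e2 ^+ 2 - nE e0 ^+ 2) + gamma / 3 * trilin e ph eh.
  have -> : rho = A *m (c *: (e2 - e0)) + D U *m eh +
      (gamma / 3) *: (had e (D1 *m ph) + D1 *m had e ph).
    rewrite -[rho]subr0 -sch /rho !LLF_DE /eh /ph /e2 /e0 /e.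
    rewrite !(hadBl, mulmxBr, =^~scalemxAr, mulmxDr, mulmxN, hadDr, hadZr, hadNr, scalerDr, scalerBr).
      apply/colP => j; rewrite !mxE; ring.
  rewrite !ipDl LLF_D_skew addr0 ipZl ipDl; congr (_ + _).
  rewrite -scalemxAr ipZl /eh ipZr mulrA; congr (_ * _).
  rewrite (nE_sqr xLR muE sigma0 NE m0 e2) (nE_sqr xLR muE sigma0 NE m0 e0).
  by rewrite mulmxBr ipDr !ipBl (ip_opA_sym xLR muE sigma0 NE m0 e0 e2); ring.
have main : c / 2 * (nE e2 ^+ 2 - nE e0 ^+ 2) <= (Kstab M * nE e + Rs) * nE eh.
  have := res eh; have := trilin_le e eh phM; rewrite rhoE.
  rewrite !ler_norml => /andP[t1 t2] /andP[r1 r2].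
  have g0 : 0 < gamma / 3 by rewrite divr_gt0.
  have : - (gamma / 3 * trilin e ph eh) <= Kstab M * nE e * nE eh.
    have -> : Kstab M * nE e * nE eh = gamma / 3 * (2 * Cs * s1 * M * nE e * nE eh).
      by rewrite /Kstab; ring.
    by rewrite -mulrN ler_pM2l//; lra.
  lra.
have K0 := Kstab_ge0 M0.
rewrite ler_pdivlMl//.
have h0 := nE_ge0' e0; have h2 := nE_ge0' e2; have he := nE_ge0' e.
have K1 : 0 <= Kstab M * nE e + Rs by rewrite addr_ge0// mulr_ge0.
have [E0|E0] := eqVneq (nE e2 + nE e0) 0.
  have -> : nE e2 = 0 by lra.
  have -> : nE e0 = 0 by lra.
  by rewrite subrr mulr0.
have Epos : 0 < nE e2 + nE e0 by rewrite lt_neqAle eq_sym E0 addr_ge0.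
rewrite -(ler_pM2r Epos).
have := le_trans main (ler_wpM2l K1 ehE).
rewrite !expr2; lra.
Qed.

Lemma nE0 : nE (0 : 'cV[R]_N) = 0.
Proof. by rewrite -(scale0r (0 : 'cV[R]_N)) nEZ normr0 mul0r. Qed.

(** Only the first step is implicit in the error, and it can be absorbed when
    K tau <= 1.  Otherwise the energy does not grow in the first step, hence the
    new error is at most 2 M plus the initial one, and 1 <= (K tau)^2. *)
Theorem scheme_stability (tau M Rs : R) (Nt : nat) (U p : nat -> 'cV[R]_N) :
  0 < tau -> 0 <= M -> 0 <= Rs -> (0 < Nt)%N ->
  LLF_MP_scheme a sigma gamma xL xR tau Nt U ->
  (forall n, (n <= Nt)%N -> nE (p n) <= M) ->
  (forall n w, (1 <= n < Nt)%N ->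
    `|ip (A *m ((2 * tau)^-1 *: (p n.+1 - p n.-1)) +
          D (p n) *m (2^-1 *: (p n.+1 + p n.-1))) w| <= Rs * nE w) ->
  (forall w,
    `|ip (A *m (tau^-1 *: (p 1%N - p 0%N)) +
          D (2^-1 *: (p 1%N + p 0%N)) *m (2^-1 *: (p 1%N + p 0%N))) w| <= Rs * nE w) ->
  forall n, (n <= Nt)%N ->
  nE (p n - U n) <=
    (3 * nE (p 0%N - U 0%N) + 2 * tau * Rs + 2 * M * (Kstab M * tau) ^+ 2 +
     2 * (Nt%:R * tau) * Rs) * expR (2 * (Nt%:R * tau) * Kstab M).
Proof.
move=> tau0 M0 Rs0 Nt0 [sch sch0] pM res res0 n nNt.
have K0 := Kstab_ge0 M0; have [K KE] : exists K, K = Kstab M by eexists.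
rewrite -!KE in K0 *.
pose E k := nE (p k - U k); have E0 k : 0 <= E k by exact: nE_ge0'.
rewrite -/(E 0%N) -/(E n).
have tauV : 0 < tau^-1 by rewrite invr_gt0.
have first : E 1%N <= 3 * E 0%N + 2 * tau * Rs + 2 * M * (K * tau) ^+ 2.
  have q0 : 0 <= 2 * M * (K * tau) ^+ 2 by rewrite mulr_ge0 ?sqr_ge0// mulr_ge0.
  have t0 : 0 <= tau * Rs by rewrite mulr_ge0// ltW.
  have [small|big] := leP (K * tau) 1.
    have := error_step tauV M0 Rs0 (pM _ (leq0n _)) (pM _ Nt0) sch0 res0.
    rewrite invrK -scalerBr -KE -/(E 0%N) -/(E 1%N).
    have -> : p 1%N + p 0%N - (U 1%N + U 0%N) = (p 1%N - U 1%N) + (p 0%N - U 0%N).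
      by rewrite opprD addrACA.
    rewrite nEZ ger0_norm ?invr_ge0//.
    have := nED xLR muE sigma0 NE m0 (p 1%N - U 1%N) (p 0%N - U 0%N).
    rewrite -/(E 0%N) -/(E 1%N); set X := nE (_ + _) => h1 h2.
    have h3 : tau * (K * (2^-1 * X) + Rs) <= (K * tau) * ((E 1%N + E 0%N) / 2) + tau * Rs.
      have -> : tau * (K * (2^-1 * X) + Rs) = K * tau * (X / 2) + tau * Rs by ring.
      by rewrite lerD2r ler_wpM2l ?mulr_ge0 ?(ltW tau0)//; lra.
    have h4 : (K * tau) * ((E 1%N + E 0%N) / 2) <= 1 * ((E 1%N + E 0%N) / 2).
      by rewrite ler_wpM2r// divr_ge0// addr_ge0.
    lra.
  have cons : nE (U 1%N) <= nE (U 0%N).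
    have res' w : `|ip (A *m (tau^-1 *: (0 - 0 : 'cV[R]_N)) +
        D 0 *m (2^-1 *: (0 + 0 : 'cV[R]_N))) w| <= 0 * nE w.
      rewrite subrr addr0 !scaler0 !mulmx0 addr0 mul0r /ip big1 ?mulr0 ?normr0//.
      by move=> j _; rewrite mxE mul0r.
    have nE00 : nE (0 : 'cV[R]_N) <= 0 by rewrite nE0.
    have := error_step tauV (lexx 0) (lexx 0) nE00 nE00 sch0 res'.
    by rewrite /Kstab !(mulr0, mul0r) addr0 mulr0 !sub0r !nEN subr_le0.
  have h1 : E 1%N <= M + nE (U 1%N).
    exact: le_trans (nEB xLR muE sigma0 NE m0 _ _) (lerD (pM _ Nt0) (lexx _)).
  have h2 : nE (U 0%N) <= M + E 0%N.
    have -> : U 0%N = p 0%N - (p 0%N - U 0%N) by rewrite opprB addrC subrK.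
    exact: le_trans (nEB xLR muE sigma0 NE m0 _ _) (lerD (pM _ (leq0n _)) (lexx _)).
  have h3 : 2 * M * 1 <= 2 * M * (K * tau) ^+ 2.
    by rewrite ler_wpM2l ?mulr_ge0// expr_ge1// ltW// (lt_trans ltr01).
  have := E0 0%N; lra.
set b := 3 * E 0%N + _ + _ in first *.
have b0 : 0 <= b := le_trans (E0 _) first.
have Eb : E 0%N <= b.
  have : 0 <= 2 * tau * Rs by rewrite !mulr_ge0// ltW.
  have : 0 <= 2 * M * (K * tau) ^+ 2 by rewrite mulr_ge0 ?sqr_ge0// mulr_ge0.
  rewrite /b; have := E0 0%N; lra.
have d0 : 0 <= 2 * tau * Rs by rewrite !mulr_ge0// ltW.
have k0 : 0 <= 2 * tau * K by rewrite !mulr_ge0// ltW.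
have rec k : (1 <= k < Nt)%N -> E k.+1 <= E k.-1 + 2 * tau * K * E k + 2 * tau * Rs.
  move=> /[dup] k1 /andP[_ kN].
  have c0 : 0 < (2 * tau)^-1 by rewrite invr_gt0 mulr_gt0.
  have kN' : (k.-1 <= Nt)%N by rewrite (leq_trans (leq_pred _))// ltnW.
  have := error_step c0 M0 Rs0 (pM _ kN') (pM _ kN) (sch _ k1) (fun w => res _ w k1).
  by rewrite invrK -/(E k.+1) -/(E k.-1) -/(E k) -KE; lra.
apply: le_trans (three_level_gronwall k0 b0 d0 Eb first rec nNt Nt0) _.
have nT : n%:R * tau <= Nt%:R * tau by rewrite ler_wpM2r ?ler_nat// ltW.
apply: ler_pM.
- by rewrite addr_ge0// mulr_ge0.
- by rewrite exprn_ge0// addr_ge0.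
- rewrite lerD2l.
  have -> : n%:R * (2 * tau * Rs) = 2 * (n%:R * tau) * Rs by ring.
  by rewrite ler_wpM2r// ler_wpM2l.
apply: le_trans (_ : expR (2 * tau * K) ^+ n <= _).
  by rewrite lerXn2r ?nnegrE ?addr_ge0 ?expR_ge0// expR_ge1Dx.
rewrite -expRM_natl ler_expR.
have -> : n%:R * (2 * tau * K) = 2 * (n%:R * tau) * K by ring.
by rewrite ler_wpM2r// ler_wpM2l.
Qed.

End Stability.
(** * Fourier coefficients and partial sums *)

Section Coefficients.
Local Open Scope classical_set_scope.
Local Open Scope ring_scope.
Variables (R : realType) (xL xR mu : R).
Hypotheses (xLR : xL < xR) (muE : mu = wavenumber xL xR).
Implicit Types (f g F : R -> R) (c : R) (k l n d : nat).

Local Notation Om := (domain xL xR).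
Local Notation L := (xR - xL).

Definition intg f : R := \int[lebesgue_measure]_(x in domain xL xR) f x.
Definition itg f : Prop :=
  lebesgue_measure.-integrable (domain xL xR) (EFin \o f).

Let mOm : @measurable _ (measurableTypeR R) Om. Proof. exact: measurable_itv. Qed.
Let L0 : 0 < L. Proof. by rewrite subr_gt0. Qed.
Let L1 : L != 0. Proof. by rewrite gt_eqF. Qed.
Let muL : mu * L = 2 * pi.
Proof. by rewrite muE /wavenumber divfK. Qed.
Let mu0 : 0 < mu. Proof. by rewrite muE divr_gt0 ?mulr_gt0 ?pi_gt0. Qed.

Lemma measure_domain : lebesgue_measure Om = L%:E.
Proof. by rewrite /domain lebesgue_measure_itv/= lte_fin xLR -EFinB. Qed.

Lemma itg_cont f : continuous f -> itg f.
Proof.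
move=> cf; apply: continuous_compact_integrable; first exact: segment_compact.
exact: continuous_subspaceT.
Qed.

Lemma eq_intg f g : f =1 g -> intg f = intg g.
Proof. by move=> fg; rewrite /intg (funext fg). Qed.

Lemma eq_itg f g : f =1 g -> itg f -> itg g.
Proof. by move=> /funext ->. Qed.

Lemma itgD f g : itg f -> itg g -> itg (fun x => f x + g x).
Proof. by move=> fi gi; have := integrableD mOm fi gi. Qed.

Lemma itgZ c f : itg f -> itg (fun x => c * f x).
Proof. by move=> fi; have := integrableZl mOm c fi. Qed.

Lemma itgB f g : itg f -> itg g -> itg (fun x => f x - g x).
Proof.
move=> fi gi; apply: eq_itg (itgD fi (itgZ (- 1) gi)) => x.
by rewrite mulN1r.
Qed.

Lemma intgD f g : itg f -> itg g -> intg (fun x => f x + g x) = intg f + intg g.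
Proof. exact: RintegralD. Qed.

Lemma intgZ c f : itg f -> intg (fun x => c * f x) = c * intg f.
Proof. exact: RintegralZl. Qed.

Lemma intgB f g : itg f -> itg g -> intg (fun x => f x - g x) = intg f - intg g.
Proof. exact: RintegralB. Qed.

Lemma intg0 : intg (fun=> 0) = 0.
Proof. by rewrite /intg Rintegral_cst// mul0r. Qed.

Lemma itg_sum (F : nat -> R -> R) n : (forall k, itg (F k)) ->
  itg (fun x => \sum_(k < n) F k x).
Proof.
move=> Fi; elim: n => [|n IH].
  apply: eq_itg (itg_cont (@cst_continuous _ _ 0)) => x; by rewrite big_ord0.
by apply: eq_itg (itgD IH (Fi n)) => x; rewrite big_ord_recr.
Qed.

Lemma intg_sum (F : nat -> R -> R) n : (forall k, itg (F k)) ->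
  intg (fun x => \sum_(k < n) F k x) = \sum_(k < n) intg (F k).
Proof.
move=> Fi; elim: n => [|n IH].
  by rewrite big_ord0 -[RHS]intg0; apply: eq_intg => x; rewrite big_ord0.
rewrite big_ord_recr/= -IH -intgD//; last exact: itg_sum.
by apply: eq_intg => x; rewrite big_ord_recr.
Qed.

Lemma le_intg f g : itg f -> itg g -> (forall x, xL <= x <= xR -> f x <= g x) ->
  intg f <= intg g.
Proof.
by move=> fi gi fg; exact: le_Rintegral.
Qed.

Lemma intg_cst c : intg (fun=> c) = c * L.
Proof.
rewrite /intg Rintegral_cst//; congr (_ * _).
by rewrite -[RHS]/(fine L%:E) -measure_domain.
Qed.

Lemma itg_cst c : itg (fun=> c).
Proof. exact: itg_cont (@cst_continuous _ _ c). Qed.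

Lemma intg_norm_le c f : itg f -> (forall x, xL <= x <= xR -> `|f x| <= c) ->
  `|intg f| <= c * L.
Proof.
move=> fi fc; rewrite ler_norml; apply/andP; split.
  rewrite -mulNr -intg_cst; apply: le_intg => //; first exact: itg_cst.
  by move=> x /fc; rewrite ler_norml => /andP[].
rewrite -intg_cst; apply: le_intg => //; first exact: itg_cst.
by move=> x /fc; rewrite ler_norml => /andP[].
Qed.

Lemma itgM_cont f g : itg f -> continuous g -> itg (fun x => f x * g x).
Proof.
move=> fi cg; have cgw : {within Om, continuous g} by exact: continuous_subspaceT.
have := @integrableMl _ _ _ lebesgue_measure _ mOm _ g fi; apply.
  exact: (measurable_funTS (continuous_measurable_fun cg)).
have /compact_bounded[M [_ mrt]] := continuous_compact cgw (@segment_compact _ xL xR).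
by exists M; split; rewrite ?num_real // => ? ? ? ?; exact: mrt.
Qed.

Lemma intg_derive F f : (forall x : R, is_derive x 1 F (f x)) -> continuous f ->
  intg f = F xR - F xL.
Proof.
move=> dF cf.
have cF : continuous F.
  by move=> x; apply/differentiable_continuous/derivable1_diffP; have [] := dF x.
rewrite /intg /Rintegral (@continuous_FTC2 _ f F xL xR)//.
- exact: continuous_subspaceT.
- split.
  + by move=> x _; have [] := dF x.
  + exact/cvg_at_right_filter/cF.
  + exact/cvg_at_left_filter/cF.
by move=> x _; rewrite derive1E; exact: (@derive_val _ _ _ _ _ _ _ (dF x)).
Qed.

Lemma continuousMc c f : continuous f -> continuous (fun x => c * f x).
Proof.
by move=> cf x; apply: (@cvgM _ _ _ _ (fun=> c) f); [exact: cvg_cst|exact: cf].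
Qed.

Lemma continuous_mode k :
  continuous (fun x => cos (k%:R * mu * x)) /\
  continuous (fun x => sin (k%:R * mu * x)).
Proof.
split=> x; apply/differentiable_continuous/derivable1_diffP.
- by have [[]] := is_derive_mode mu k x.
- by have [_ []] := is_derive_mode mu k x.
Qed.

Lemma mode_period k :
  cos (k%:R * mu * xR) = cos (k%:R * mu * xL) /\
  sin (k%:R * mu * xR) = sin (k%:R * mu * xL).
Proof.
have -> : k%:R * mu * xR = k%:R * mu * xL + k%:R * (mu * L) by ring.
rewrite muL [2 * pi]mulr_natl [k%:R * (pi *+ 2)]mulr_natl.
by rewrite (periodicn (@cosD2pi R)) (periodicn (@sinD2pi R)).
Qed.

Lemma intg_mode k :
  intg (fun x => cos (k%:R * mu * x)) = (k == 0%N)%:R * L /\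
  intg (fun x => sin (k%:R * mu * x)) = 0.
Proof.
have [cc cs] := continuous_mode k; have [pc ps] := mode_period k.
have [->|k0] := eqVneq k 0%N.
  split.
    by rewrite -intg_cst; apply: eq_intg => x; rewrite !mul0r cos0.
  by rewrite -[RHS]intg0; apply: eq_intg => x; rewrite !mul0r sin0.
have z0 : k%:R * mu != 0 by rewrite mulf_neq0 ?pnatr_eq0 ?(gt_eqF mu0).
have hd x := is_derive_mode mu k x.
split.
  apply: (mulfI z0); rewrite mul0r mulr0 -intgZ; last exact: itg_cont.
  apply: (etrans (@intg_derive (fun x => sin (k%:R * mu * x)) _ _ _)).
  - by move=> x; have [] := hd x.
  - exact: continuousMc.
  by rewrite ps subrr.
have z1 : - (k%:R * mu) != 0 by rewrite oppr_eq0.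
apply: (mulfI z1); rewrite mulr0 -intgZ; last exact: itg_cont.
apply: (etrans (@intg_derive (fun x => cos (k%:R * mu * x)) _ _ _)).
- by move=> x; have [+ _] := hd x; rewrite mulNr.
- exact: continuousMc.
by rewrite pc subrr.
Qed.

(** The complex Fourier coefficient of a real function is fc - i fs. *)
Definition fc f k : R := L^-1 * intg (fun x => f x * cos (k%:R * mu * x)).
Definition fs f k : R := L^-1 * intg (fun x => f x * sin (k%:R * mu * x)).

Lemma itg_fc f k : itg f -> itg (fun x => f x * cos (k%:R * mu * x)).
Proof. by move=> fi; apply: itgM_cont => //; have [] := continuous_mode k. Qed.

Lemma itg_fs f k : itg f -> itg (fun x => f x * sin (k%:R * mu * x)).
Proof. by move=> fi; apply: itgM_cont => //; have [] := continuous_mode k. Qed.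

Lemma fcD f g k : itg f -> itg g -> fc (fun x => f x + g x) k = fc f k + fc g k.
Proof.
move=> fi gi; rewrite /fc -mulrDr -intgD; try exact: itg_fc.
by congr (_ * _); apply: eq_intg => x; rewrite mulrDl.
Qed.

Lemma fsD f g k : itg f -> itg g -> fs (fun x => f x + g x) k = fs f k + fs g k.
Proof.
move=> fi gi; rewrite /fs -mulrDr -intgD; try exact: itg_fs.
by congr (_ * _); apply: eq_intg => x; rewrite mulrDl.
Qed.

Lemma fcZ c f k : itg f -> fc (fun x => c * f x) k = c * fc f k.
Proof.
move=> fi; rewrite /fc mulrCA -(intgZ c (itg_fc k fi)).
by congr (_ * _); apply: eq_intg => x; rewrite mulrA.
Qed.

Lemma fsZ c f k : itg f -> fs (fun x => c * f x) k = c * fs f k.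
Proof.
move=> fi; rewrite /fs mulrCA -(intgZ c (itg_fs k fi)).
by congr (_ * _); apply: eq_intg => x; rewrite mulrA.
Qed.

Lemma fcB f g k : itg f -> itg g -> fc (fun x => f x - g x) k = fc f k - fc g k.
Proof.
move=> fi gi; rewrite /fc -mulrBr -intgB; try exact: itg_fc.
by congr (_ * _); apply: eq_intg => x; rewrite mulrBl.
Qed.

Lemma fsB f g k : itg f -> itg g -> fs (fun x => f x - g x) k = fs f k - fs g k.
Proof.
move=> fi gi; rewrite /fs -mulrBr -intgB; try exact: itg_fs.
by congr (_ * _); apply: eq_intg => x; rewrite mulrBl.
Qed.

Lemma coef_le f k c : itg f -> (forall x, xL <= x <= xR -> `|f x| <= c) ->
  `|fc f k| <= c /\ `|fs f k| <= c.
Proof.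
move=> fi fle; have LV : 0 <= L^-1 by rewrite invr_ge0 ltW.
rewrite /fc /fs !normrM !(ger0_norm LV) !ler_pdivrMl//; split.
  rewrite [leRHS]mulrC; apply: intg_norm_le => [|x /fle]; first exact: itg_fc.
  by rewrite normrM; apply: le_trans; rewrite ler_piMr// cos_max.
rewrite [leRHS]mulrC; apply: intg_norm_le => [|x /fle]; first exact: itg_fs.
by rewrite normrM; apply: le_trans; rewrite ler_piMr// sin_max.
Qed.

(** Folding the frequency -k onto k doubles all modes but the constant. *)
Definition hw k : R := if k == 0%N then 1 else 2.

Lemma hw_gt0 k : 0 < hw k. Proof. by rewrite /hw; case: ifP. Qed.

Lemma hw_le2 k : hw k <= 2.
Proof. by rewrite /hw; case: ifP => _; rewrite ?lexx// ler1n. Qed.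

Lemma intg_mode_mul l k :
  [/\ intg (fun x => cos (l%:R * mu * x) * cos (k%:R * mu * x)) =
        (l == k)%:R * (L / hw k),
      intg (fun x => sin (l%:R * mu * x) * cos (k%:R * mu * x)) = 0,
      intg (fun x => cos (l%:R * mu * x) * sin (k%:R * mu * x)) = 0 &
      intg (fun x => sin (l%:R * mu * x) * sin (k%:R * mu * x)) =
        ((l == k) && (0 < k)%N)%:R * (L / hw k)].
Proof.
pose d := `|l%:Z - k%:Z|%N.
have [s [cd sd]] : exists s : R,
    (forall x, cos ((l%:R - k%:R) * mu * x) = cos (d%:R * mu * x)) /\
    (forall x, sin ((l%:R - k%:R) * mu * x) = s * sin (d%:R * mu * x)).
  rewrite /d; have [kl|/ltnW lk] := leqP k l.
    exists 1; rewrite distnEl//; split=> x; by rewrite natrB ?mul1r.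
  exists (- 1); rewrite distnEr// natrB//.
  have -> : l%:R - k%:R = - (k%:R - l%:R) :> R by rewrite opprB.
  by split=> x; rewrite !mulNr ?cosN// sinN mul1r.
have [Cd Sd] := intg_mode d; have [Ca Sa] := intg_mode (l + k).
have ic j : itg (fun x => cos (j%:R * mu * x)).
  by apply: itg_cont; have [] := continuous_mode j.
have is_ j : itg (fun x => sin (j%:R * mu * x)).
  by apply: itg_cont; have [] := continuous_mode j.
have d0 : (d == 0%N) = (l == k) by rewrite /d; lia.
have a0 : (l + k == 0)%N = (l == 0%N) && (k == 0%N) by lia.
split.
- rewrite (@eq_intg _ (fun x => 2^-1 * (cos (d%:R * mu * x) + cos ((l + k)%N%:R * mu * x)))).
    rewrite intgZ; last by apply: itgD; exact: ic.
    rewrite (intgD (ic _) (ic _)) Cd Ca d0 a0 /hw; have [->|lk] := eqVneq l k.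
      by rewrite andbb; case: eqP => _ /=; field.
    have -> : (l == 0%N) && (k == 0%N) = false by lia.
    by rewrite !mul0r addr0 mulr0.
  by move=> x; rewrite -cd natrD !mulrBl !mulrDl cosB cosD; field.
- rewrite (@eq_intg _ (fun x => 2^-1 * (s * sin (d%:R * mu * x) + sin ((l + k)%N%:R * mu * x)))).
    rewrite intgZ; last by apply: itgD; [exact: itgZ|exact: is_].
    by rewrite intgD ?intgZ//; [rewrite Sd Sa !(mulr0, addr0)|exact: itgZ].
  by move=> x; rewrite -sd natrD !mulrBl !mulrDl sinB sinD; field.
- rewrite (@eq_intg _ (fun x => 2^-1 * (sin ((l + k)%N%:R * mu * x) - s * sin (d%:R * mu * x)))).
    rewrite intgZ; last by apply: itgB; [exact: is_|exact: itgZ].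
    by rewrite intgB ?intgZ//; [rewrite Sd Sa !(mulr0, subr0)|exact: itgZ].
  by move=> x; rewrite -sd natrD !mulrBl !mulrDl sinB sinD; field.
rewrite (@eq_intg _ (fun x => 2^-1 * (cos (d%:R * mu * x) - cos ((l + k)%N%:R * mu * x)))).
  rewrite intgZ; last by apply: itgB; exact: ic.
  rewrite (intgB (ic _) (ic _)) Cd Ca d0 a0 /hw; have [->|lk] := eqVneq l k.
    by rewrite andbb; case: posnP => k0 /=; rewrite ?k0 ?(gtn_eqF k0)/=; field.
  have -> : (l == 0%N) && (k == 0%N) = false by lia.
  by rewrite !mul0r subr0 mulr0.
by move=> x; rewrite -cd natrD !mulrBl !mulrDl cosB cosD; field.
Qed.

Lemma intg_mul_trig f A B n : itg f ->
  intg (fun x => f x * trig mu A B n x) =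
  L * \sum_(k < n) (A k * fc f k + B k * fs f k).
Proof.
move=> fi; have ic k := itg_fc k fi; have is_ k := itg_fs k fi.
rewrite (@eq_intg _ (fun x => \sum_(k < n) (A k * (f x * cos (k%:R * mu * x)) +
    B k * (f x * sin (k%:R * mu * x))))); last first.
  by move=> x; rewrite /trig mulr_sumr; apply: eq_bigr => k _; ring.
rewrite (@intg_sum (fun k x => A k * (f x * cos (k%:R * mu * x)) +
    B k * (f x * sin (k%:R * mu * x)))); last first.
  by move=> k; apply: itgD; apply: itgZ.
rewrite mulr_sumr; apply: eq_bigr => k _.
rewrite intgD; try exact: itgZ.
by rewrite !intgZ// /fc /fs; field.
Qed.

Lemma coef_trig A B n k :
  hw k * fc (trig mu A B n) k = (k < n)%N%:R * A k /\
  hw k * fs (trig mu A B n) k = (0 < k < n)%N%:R * B k.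
Proof.
have [cc cs] := continuous_mode k.
have h0 : hw k != 0 by rewrite gt_eqF ?hw_gt0.
have E l : fc (fun x => cos (k%:R * mu * x)) l = (l == k)%:R / hw k /\
           fs (fun x => cos (k%:R * mu * x)) l = 0 /\
           fc (fun x => sin (k%:R * mu * x)) l = 0 /\
           fs (fun x => sin (k%:R * mu * x)) l = ((l == k) && (0 < k)%N)%:R / hw k.
  have [e1 e2 e3 e4] := intg_mode_mul k l; rewrite /fc /fs e1 e2 e3 e4 eq_sym.
  split; last split; last split; rewrite ?mulr0//.
    by case: eqVneq => [->|_]; rewrite ?mul0r ?mulr0// !mul1r; field; rewrite h0.
  case: eqVneq => [->|_]; rewrite ?mul0r ?mulr0//=.
  by case: (0 < k)%N; rewrite ?mul0r ?mulr0// !mul1r; field; rewrite h0.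
have pick (b : nat -> R) (C : nat -> R) : (forall l, b l = (l == k)%:R * b k) ->
    \sum_(l < n) C l * b l = (k < n)%N%:R * (C k * b k).
  move=> hb; case: ltnP => [kn|nk].
    rewrite (bigD1 (Ordinal kn))//= mul1r big1 ?addr0// => l.
    by rewrite -val_eqE/= hb => /negbTE ->; rewrite mul0r mulr0.
  rewrite mul0r big1// => l _; rewrite hb (_ : _ == _ = false) ?mul0r ?mulr0//.
  by have := ltn_ord l; lia.
have b1 : true%:R = 1 :> R by [].
have b0 : false%:R = 0 :> R by [].
split.
- rewrite {1}/fc (@eq_intg _ (fun x => cos (k%:R * mu * x) * trig mu A B n x)); last first.
    by move=> x; rewrite mulrC.
  rewrite intg_mul_trig; last exact: itg_cont.
  rewrite (eq_bigr (fun l : 'I_n => A l * fc (fun x => cos (k%:R * mu * x)) l)); last first.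
    by move=> l _; have [_ [-> _]] := E l; rewrite mulr0 addr0.
  rewrite pick; last by move=> l; have [-> _] := E l; have [-> _] := E k; rewrite eqxx mul1r.
  have [-> _] := E k; rewrite eqxx b1; by field; rewrite h0.
- rewrite {1}/fs (@eq_intg _ (fun x => sin (k%:R * mu * x) * trig mu A B n x)); last first.
    by move=> x; rewrite mulrC.
  rewrite intg_mul_trig; last exact: itg_cont.
  rewrite (eq_bigr (fun l : 'I_n => B l * fs (fun x => sin (k%:R * mu * x)) l)); last first.
    by move=> l _; have [_ [_ [-> _]]] := E l; rewrite mulr0 add0r.
  rewrite pick; last first.
    move=> l; have [_ [_ [_ ->]]] := E l; have [_ [_ [_ ->]]] := E k.
    by rewrite eqxx/=; case: eqP; rewrite ?mul1r ?mul0r.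
  have [_ [_ [_ ->]]] := E k; rewrite eqxx/=.
  by case: (0 < k)%N; case: (k < n)%N; rewrite /= ?b1 ?b0; field; rewrite h0.
Qed.

Definition psum f n : R -> R :=
  trig mu (fun k => hw k * fc f k) (fun k => hw k * fs f k) n.

Lemma fs0 f : fs f 0 = 0.
Proof.
rewrite /fs (@eq_intg _ (fun=> 0)) ?intg0 ?mulr0// => x.
by rewrite !mul0r sin0 mulr0.
Qed.

Lemma coef_psum f n k :
  fc (psum f n) k = (k < n)%N%:R * fc f k /\
  fs (psum f n) k = (k < n)%N%:R * fs f k.
Proof.
have h0 : hw k != 0 by rewrite gt_eqF ?hw_gt0.
have [e1 e2] := coef_trig (fun k => hw k * fc f k) (fun k => hw k * fs f k) n k.
split; apply: (mulfI h0); rewrite /psum ?e1 ?e2; first by ring.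
by have [->|k0] := posnP k; rewrite ?fs0 /=; ring.
Qed.

Lemma psum_trig f n : is_trig mu n f -> f =1 psum f n.
Proof.
move=> [A [B fE]] x; rewrite (funext fE) /psum /trig; apply: eq_bigr => k _.
have [-> ->] := coef_trig A B n k; rewrite ltn_ord mul1r andbT.
by have [->|k0] := posnP k; rewrite ?mul1r// !mul0r sin0 !mulr0.
Qed.

Lemma continuous_psum f n : continuous (psum f n).
Proof. exact: continuous_trig. Qed.

Lemma intg_indic (p q : R) : xL <= p -> p <= q -> q <= xR ->
  itg (\1_(`[p, q]) : R -> R) /\ intg (\1_(`[p, q]) : R -> R) = q - p.
Proof.
move=> xp pq qx; split.
  have h := @integrable_indic_itv R p q true false.
  exact: integrableS h.
rewrite /intg /Rintegral integral_indic//=.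
have -> : `[p, q]%classic `&` Om = `[p, q]%classic.
  apply/setIidPl => x; rewrite /domain/= !in_itv/= => /andP[px xq].
  by rewrite (le_trans xp px) (le_trans xq qx).
rewrite lebesgue_measure_itv/= lte_fin.
by move: pq; rewrite le_eqVlt => /predU1P[->|->]; rewrite ?ltxx ?subrr.
Qed.

(** The nonnegative trigonometric polynomial ((1 + cos (mu (x - x0)))/2)^n, which
    concentrates at x0 as n grows. *)
Definition peak (x0 : R) n x : R := ((1 + cos (mu * (x - x0))) / 2) ^+ n.

Lemma half_1Dcos_ge0 (t : R) : 0 <= (1 + cos t) / 2.
Proof. by rewrite divr_ge0// -lerBlDl sub0r cos_geN1. Qed.

Lemma peak_ge0 x0 n x : 0 <= peak x0 n x.
Proof. by rewrite exprn_ge0// half_1Dcos_ge0. Qed.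

Lemma is_trig_peak x0 n : is_trig mu n.+1 (peak x0 n).
Proof.
have h1 : is_trig mu 2 (fun x => (1 + cos (mu * (x - x0))) / 2).
  have [c0 _] := @is_trig_mode R mu 0 2 isT; have [c1 s1] := @is_trig_mode R mu 1 2 isT.
  apply: eq_is_trig (is_trigD (is_trigZ 2^-1 c0) (is_trigD
    (is_trigZ (cos (mu * x0) / 2) c1) (is_trigZ (sin (mu * x0) / 2) s1))) => x.
  by rewrite !mul0r cos0 mul1r mulrBr cosB; field.
elim: n => [|n IH].
  have [c0 _] := @is_trig_mode R mu 0 1 isT.
  by apply: eq_is_trig c0 => x; rewrite !mul0r cos0 /peak expr0.
rewrite -addn1; apply: eq_is_trig (is_trigM IH h1) => x.
by rewrite /peak exprSr.
Qed.

Lemma cos_decreasing (a b : R) : 0 <= a -> a <= b -> b <= pi -> cos b <= cos a.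
Proof.
move=> a0 ab bpi.
have aI : a \in `[0, pi] by rewrite in_itv/= a0 (le_trans ab).
have bI : b \in `[0, pi] by rewrite in_itv/= bpi (le_trans a0).
by rewrite leNgt ltr_cos// -leNgt.
Qed.

Lemma peak_near x0 e x : 0 <= e -> mu * e <= pi -> `|x - x0| <= e ->
  cos (mu * e) <= cos (mu * (x - x0)).
Proof.
move=> e0 epi xe; rewrite -(cos_norm (mu * (x - x0))) normrM (gtr0_norm mu0).
by apply: cos_decreasing; rewrite ?mulr_ge0 ?(ltW mu0) ?ler_pM2l.
Qed.

Lemma peak_far x0 e x : 0 < e -> mu * e <= pi -> e <= `|x - x0| ->
  `|x - x0| <= L - e -> cos (mu * (x - x0)) <= cos (mu * e).
Proof.
move=> e0 epi xe xL'; rewrite -(cos_norm (mu * (x - x0))) normrM (gtr0_norm mu0).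
set y := `|x - x0| in xe xL' *.
have [ypi|ypi] := leP (mu * y) pi.
  by apply: cos_decreasing; rewrite ?mulr_ge0 ?(ltW mu0) ?(ltW e0)// ler_pM2l.
have -> : cos (mu * y) = cos (pi *+ 2 - mu * y).
  rewrite -(cosN (mu * y)) -(cosD2pi (- (mu * y))); congr cos; exact: addrC.
apply: cos_decreasing.
- by rewrite mulr_ge0// ltW.
- have : mu * y <= mu * (L - e) by rewrite ler_pM2l.
  rewrite mulrBr muL mulr2n; lra.
- rewrite mulr2n; lra.
Qed.

(** The coefficients of a nonnegative function are at most its mean, and the
    integral of v against a trigonometric polynomial is a combination of
    coefficients of v. *)
Lemma intg_peak_mul_le v S x0 n : itg v ->
  (forall n, \sum_(k < n) hw k * (`|fc v k| + `|fs v k|) <= S) ->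
  intg (fun x => v x * peak x0 n x) <= S * intg (peak x0 n).
Proof.
move=> vi vS; have pE := psum_trig (is_trig_peak x0 n).
have ci : continuous (peak x0 n) by rewrite (funext pE); exact: continuous_psum.
have pi_ := itg_cont ci.
have cle k : `|fc (peak x0 n) k| <= L^-1 * intg (peak x0 n) /\
             `|fs (peak x0 n) k| <= L^-1 * intg (peak x0 n).
  have LV : 0 <= L^-1 by rewrite invr_ge0 ltW.
  have mN f : itg f -> (forall x, `|f x| <= peak x0 n x) -> `|intg f| <= intg (peak x0 n).
    move=> fi fp; rewrite ler_norml; apply/andP; split.
      rewrite -mulN1r -intgZ//; apply: le_intg => // [|x _]; first exact: itgZ.
      by have := fp x; rewrite mulN1r ler_norml => /andP[].
    by apply: le_intg => // x _; have := fp x; rewrite ler_norml => /andP[].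
  rewrite /fc /fs !normrM !(ger0_norm LV); split; rewrite ler_wpM2l//; apply: mN.
  - exact: itg_fc.
  - by move=> x; rewrite normrM (ger0_norm (peak_ge0 _ _ _)) ler_piMr ?peak_ge0// cos_max.
  - exact: itg_fs.
  - by move=> x; rewrite normrM (ger0_norm (peak_ge0 _ _ _)) ler_piMr ?peak_ge0// sin_max.
rewrite (@eq_intg _ (fun x => v x * psum (peak x0 n) n.+1 x)); last first.
  by move=> x; rewrite -pE.
rewrite intg_mul_trig//.
have P0 : 0 <= L^-1 * intg (peak x0 n) by apply: le_trans (cle 0%N).1.
have -> : S * intg (peak x0 n) = L * ((L^-1 * intg (peak x0 n)) * S) by field.
rewrite ler_pM2l//; apply: le_trans (ler_wpM2l P0 (vS n.+1)).
rewrite mulr_sumr; apply: ler_sum => k _.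
have [c1 c2] := cle k; have h0 := ltW (hw_gt0 k).
rewrite -[X in X + _ <= _]mulrA -[X in _ + X <= _]mulrA -mulrDr [leRHS]mulrCA.
rewrite ler_wpM2l// mulrDr lerD//.
  by apply: le_trans (ler_norm _) _; rewrite normrM ler_wpM2r.
by apply: le_trans (ler_norm _) _; rewrite normrM ler_wpM2r.
Qed.

(** Testing against the concentrating kernels shows that a continuous function
    is bounded by the sum of the moduli of its Fourier coefficients. *)
Lemma le_coef_interior v S x0 : continuous v -> xL < x0 < xR ->
  (forall n, \sum_(k < n) hw k * (`|fc v k| + `|fs v k|) <= S) -> v x0 <= S.
Proof.
move=> cv /andP[x0L x0R] vS; rewrite leNgt; apply/negP => Sv.
pose eta := (v x0 - S) / 2; have eta0 : 0 < eta by rewrite divr_gt0// subr_gt0.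
have [d0 /= d0p hd] : exists2 d : R, 0 < d & forall x, `|x - x0| < d -> S + eta <= v x.
  have /cvgrPdist_lt/(_ eta eta0) := cv x0.
  move=> /nbhs_ballP[d /= dp hd]; exists d => // x xd.
  have := hd x; rewrite /ball/= distrC => /(_ xd).
  rewrite ltr_norml => /andP[h1 h2]; move: h2; rewrite /eta; lra.
pose d := Num.min d0 (Num.min (x0 - xL) (xR - x0)).
have dp : 0 < d by rewrite !lt_min d0p !subr_gt0 x0L.
have dd0 : d <= d0 by rewrite ge_min lexx.
have dL : d <= x0 - xL by rewrite !ge_min lexx orbT.
have dR : d <= xR - x0 by rewrite !ge_min lexx !orbT.
have dpi : mu * d <= pi.
  have : mu * d <= mu * (L / 2) by rewrite ler_pM2l//; lra.
  by rewrite mulrA muL; lra.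
have d2 : 0 < d / 2 by rewrite divr_gt0.
have d2pi : mu * (d / 2) <= pi.
  by apply: le_trans dpi; rewrite ler_pM2l//; lra.
pose al := (1 + cos (mu * d)) / 2; pose be := (1 + cos (mu * (d / 2))) / 2.
have al0 : 0 <= al := half_1Dcos_ge0 _.
have albe : al < be.
  have dI : mu * d \in `[0, pi] by rewrite in_itv/= dpi mulr_ge0 ?(ltW mu0) ?(ltW dp).
  have d2I : mu * (d / 2) \in `[0, pi].
    by rewrite in_itv/= d2pi mulr_ge0 ?(ltW mu0) ?(ltW d2).
  by rewrite ltr_pM2r// ltrD2l ltr_cos// ltr_pM2l//; lra.
have be0 : 0 < be := le_lt_trans al0 albe.
have vi := itg_cont cv.
have [B B0 hB] : exists2 B : R, 0 < B & forall x, xL <= x <= xR -> `|v x - S| <= B.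
  have cw : {within Om, continuous v} by exact: continuous_subspaceT.
  have /compact_bounded[M [_ hM]] := continuous_compact cw (@segment_compact _ xL xR).
  exists (`|M| + 1 + `|S|); first by rewrite ltr_pwDl ?normr_ge0// ltr_pwDr.
  move=> x xOm; apply: le_trans (ler_normB _ _) _; rewrite lerD2r.
  apply: hM; first by rewrite ltr_pwDr// ler_norm.
  by exists x.
pose I : set R := `[x0 - d / 2, x0 + d / 2]%classic.
have [Ii Ival] : itg (\1_I : R -> R) /\ intg (\1_I : R -> R) = d.
  have -> : d = (x0 + d / 2) - (x0 - d / 2) by field.
  by apply: intg_indic; lra.
(* On |x - x0| <= d/2 the kernel is at least be^n and v - S at least eta;
   for |x - x0| >= d the kernel is at most al^n, with al < be. *)
have key n : eta * be ^+ n * d <= B * L * al ^+ n.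
  have cp : continuous (peak x0 n).
    by rewrite (funext (psum_trig (is_trig_peak x0 n))); exact: continuous_psum.
  have pi_ := itg_cont cp.
  have vpi := itgM_cont vi cp.
  have lower : intg (fun x => eta * be ^+ n * \1_I x - B * al ^+ n) <=
      intg (fun x => v x * peak x0 n x - S * peak x0 n x).
    apply: le_intg.
    - by apply: itgB; [exact: itgZ|exact: itg_cst].
    - by apply: itgB => //; exact: itgZ.
    move=> x xOm; rewrite -mulrBl; set w := v x - S.
    have wB : `|w| <= B := hB x xOm.
    have p0 := peak_ge0 x0 n x.
    have an0 : 0 <= B * al ^+ n by rewrite mulr_ge0 ?exprn_ge0// ltW.
    have [near2|far2] := leP `|x - x0| (d / 2).
      have -> : \1_I x = 1 :> R.
        rewrite indicE mem_set// /I/= in_itv/=; move: near2; rewrite ler_norml.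
        by move=> /andP[h1 h2]; apply/andP; split; lra.
      have wge : eta <= w.
        by rewrite /w lerBrDl; apply: hd; apply: le_lt_trans near2 _; lra.
      have pge : be ^+ n <= peak x0 n x.
        apply: lerXn2r; rewrite ?nnegrE ?(ltW be0) ?half_1Dcos_ge0//.
        by rewrite ler_pM2r// lerD2l peak_near// ltW.
      have : eta * be ^+ n <= w * peak x0 n x.
        by rewrite ler_pM ?exprn_ge0 ?(ltW eta0) ?(ltW be0).
      by rewrite mulr1; lra.
    have -> : \1_I x = 0 :> R.
      rewrite indicE memNset// /I/= in_itv/= => /andP[h1 h2].
      by move: far2; rewrite ltNge ler_norml; apply/negP/negPn/andP; split; lra.
    rewrite mulr0 sub0r.
    have [near1|far1] := ltP `|x - x0| d.
      have wge : 0 <= w.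
        rewrite /w subr_ge0; apply: le_trans (hd _ (lt_le_trans near1 dd0)); lra.
      by apply: (@le_trans _ _ 0); [rewrite oppr_le0|rewrite mulr_ge0].
    have ple : peak x0 n x <= al ^+ n.
      apply: lerXn2r; rewrite ?nnegrE ?half_1Dcos_ge0//.
      rewrite ler_pM2r// lerD2l peak_far//.
      by move: xOm => /andP[h1 h2]; rewrite ler_norml; apply/andP; split; lra.
    rewrite lerNl -mulNr; apply: le_trans (_ : `|w| * peak x0 n x <= _).
      by rewrite ler_wpM2r// -normrN ler_norm.
    by rewrite ler_pM.
  have upper : intg (fun x => v x * peak x0 n x - S * peak x0 n x) <= 0.
    rewrite intgB//; last exact: itgZ.
    by rewrite intgZ// subr_le0; exact: intg_peak_mul_le.
  have := le_trans lower upper.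
  rewrite intgB; [|exact: itgZ|exact: itg_cst].
  by rewrite intgZ// intg_cst Ival subr_le0 [B * L * _]mulrAC.
have rlt1 : `|al / be| < 1.
  by rewrite ger0_norm ?divr_ge0 ?(ltW be0)// ltr_pdivrMr// mul1r.
have c0 : 0 < eta * d / (B * L) by rewrite divr_gt0// mulr_gt0.
have /cvgrPdist_lt/(_ _ c0) := cvg_expr rlt1.
move=> [n _ /(_ n (leqnn _))].
rewrite sub0r normrN ger0_norm ?exprn_ge0 ?divr_ge0 ?(ltW be0)//.
rewrite expr_div_n ltr_pdivrMr ?exprn_gt0// mulrAC ltr_pdivlMr ?mulr_gt0//.
have := key n; rewrite mulrAC [B * L * _]mulrC => h1 h2.
by have := le_lt_trans h1 h2; rewrite ltxx.
Qed.

(** Apply the one-sided bound to v and -v; the end points of the interval follow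
    by continuity. *)
Lemma norm_le_coef v S x0 : continuous v -> xL <= x0 <= xR ->
  (forall n, \sum_(k < n) hw k * (`|fc v k| + `|fs v k|) <= S) -> `|v x0| <= S.
Proof.
move=> cv x0Om vS.
have inter x : xL < x < xR -> `|v x| <= S.
  move=> xint; rewrite ler_norml; apply/andP; split; last exact: le_coef_interior.
  rewrite lerNl; have vi := itg_cont cv.
  have -> : - v x = - 1 * v x by rewrite mulN1r.
  apply: (@le_coef_interior (fun x => - 1 * v x)) => // [|n]; first exact: continuousMc.
  apply: le_trans (vS n); apply: ler_sum => k _.
  by rewrite fcZ// fsZ// !normrM normrN1 !mul1r.
rewrite leNgt; apply/negP => Sv.
have [d /= d0p hd] : exists2 d : R, 0 < d & forall x, `|x - x0| < d -> S < `|v x|.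
  have e0 : 0 < `|v x0| - S by rewrite subr_gt0.
  have /cvgrPdist_lt/(_ _ e0) := cv x0.
  move=> /nbhs_ballP[d /= dp hd]; exists d => // x xd.
  have := hd x; rewrite /ball/= distrC => /(_ xd) h.
  have := ler_normD (v x0 - v x) (v x); rewrite subrK; lra.
pose e := Num.min d L / 3.
have e0 : 0 < e by rewrite divr_gt0// lt_min d0p.
have ed : e < d.
  have mnd : Num.min d L <= d by rewrite ge_min lexx.
  apply: le_lt_trans (_ : d / 3 < d); first by rewrite ler_pM2r.
  by rewrite ltr_pdivrMr// ltr_pMr// ltr1n.
have eL : e <= L / 3 by rewrite /e ler_pM2r// ge_min lexx orbT.
have [x1 x1int x1d] : exists2 x1, xL < x1 < xR & `|x1 - x0| < d.
  move: x0Om => /andP[h1 h2]; have [hm|hm] := leP x0 (xL + L / 2).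
    exists (x0 + e); first by apply/andP; split; lra.
    by rewrite addrAC subrr add0r gtr0_norm.
  exists (x0 - e); first by apply/andP; split; lra.
  by rewrite addrAC subrr add0r normrN gtr0_norm.
by have := hd _ x1d; rewrite ltNge inter.
Qed.

End Coefficients.
(** * Sobolev norms *)

Section Sobolev.
Local Open Scope classical_set_scope.
Local Open Scope ring_scope.
Variables (R : realType) (xL xR mu : R).
Hypotheses (xLR : xL < xR) (muE : mu = wavenumber xL xR).
Implicit Types (f g : R -> R) (s B : R) (k n : nat).

Local Notation L := (xR - xL).
Local Notation fc := (fc xL xR mu).
Local Notation fs := (fs xL xR mu).
Local Notation itg := (itg xL xR).

Let L0 : 0 < L. Proof. by rewrite subr_gt0. Qed.
Let mu0 : 0 < mu. Proof. by rewrite muE divr_gt0 ?mulr_gt0 ?pi_gt0. Qed.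

Definition weight s k : R := (1 + (k%:R * mu) ^+ 2) `^ s.

(** Finite partial sums over k >= 0 in place of the extended-real sum over all
    integers, without the factor L. *)
Definition sobolev_bound s f B : Prop :=
  forall n, \sum_(k < n) weight s k * (fc f k ^+ 2 + fs f k ^+ 2) <= B.

Lemma weight_base_ge1 k : 1 <= 1 + (k%:R * mu) ^+ 2.
Proof. by rewrite lerDl sqr_ge0. Qed.

Lemma weight_ge0 s k : 0 <= weight s k. Proof. exact: powR_ge0. Qed.

Lemma weight_ge1 s k : 0 <= s -> 1 <= weight s k.
Proof. by move=> s0; rewrite -[leLHS](powRr0 (1 + (k%:R * mu) ^+ 2)) ler_powR// weight_base_ge1. Qed.

Lemma sqnorm_ge_sum s f n :
  ((L * \sum_(k < n) weight s k * (fc f k ^+ 2 + fs f k ^+ 2))%:E <=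
   sobolev_sqnorm xL xR s f)%E.
Proof.
rewrite /sobolev_sqnorm; apply: esum_ge.
exists [set` [seq Posz i | i <- iota 0 n]]; first by split => //; exact: finite_seq.
rewrite -fsbig_seq; last by rewrite map_inj_uniq ?iota_uniq// => i j [].
rewrite big_map -(big_mkord xpredT (fun k => weight s k * (fc f k ^+ 2 + fs f k ^+ 2))).
rewrite mulr_sumr -sumEFin /index_iota subn0 le_eqVlt; apply/orP; left; apply/eqP.
apply: eq_bigr => k _; congr EFin.
by rewrite /weight /fc /fs /intg muE /fourier_coef/= sqrrN mulrA.
Qed.

Lemma sobolev_bound_lt s f (e : R) :
  (sobolev_sqnorm xL xR s f < e%:E)%E -> sobolev_bound s f (e / L).
Proof.
move=> fe n; rewrite ler_pdivlMr// mulrC -lee_fin.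
exact: le_trans (sqnorm_ge_sum _ _ _) (ltW fe).
Qed.

Lemma sobolev_boundW s f B B' : B <= B' -> sobolev_bound s f B -> sobolev_bound s f B'.
Proof. by move=> BB' fB n; apply: le_trans (fB n) BB'. Qed.

Lemma sobolev_boundD s f g B B' : itg f -> itg g ->
  sobolev_bound s f B -> sobolev_bound s g B' ->
  sobolev_bound s (fun x => f x + g x) (2 * B + 2 * B').
Proof.
move=> fi gi fB gB n; apply: le_trans (lerD (ler_wpM2l (ler0n _ 2) (fB n))
  (ler_wpM2l (ler0n _ 2) (gB n))).
rewrite !mulr_sumr -big_split/=; apply: ler_sum => k _.
rewrite fcD// fsD//; have w0 := weight_ge0 s k.
have -> : 2 * (weight s k * (fc f k ^+ 2 + fs f k ^+ 2)) +
    2 * (weight s k * (fc g k ^+ 2 + fs g k ^+ 2)) = weight s k *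
    (2 * (fc f k ^+ 2 + fs f k ^+ 2) + 2 * (fc g k ^+ 2 + fs g k ^+ 2)) by ring.
rewrite ler_wpM2l//.
have := sqr_ge0 (fc f k - fc g k); have := sqr_ge0 (fs f k - fs g k).
rewrite !expr2; lra.
Qed.

Lemma square_integrable_itg f : square_integrable xL xR f -> itg f.
Proof.
move=> [mf sf]; rewrite /itg.
have h : itg (fun x => 1 + f x ^+ 2) by apply: itgD => //; exact: itg_cst.
apply: le_integrable h => //; first exact: measurable_itv.
  exact/measurable_EFinP.
move=> x _ /=; rewrite lee_fin [leRHS]ger0_norm ?addr_ge0 ?sqr_ge0//.
rewrite -(real_normK (num_real (f x))).
have := sqr_ge0 (`|f x| - 1); have := normr_ge0 (f x); rewrite !expr2; nra.
Qed.

Lemma smooth_periodic_derive (f : R -> R) : smooth_periodic L f -> smooth_periodic L (derive1 f).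
Proof.
move=> [pf df]; split; last first.
  by move=> n x; have := df n.+1 x; rewrite derive1Sn.
move=> x; rewrite /derive1.
have -> : (fun h : R => h^-1 *: (f (h + (x + L)) - f (x + L) : R^o)) =
          (fun h : R => h^-1 *: (f (h + x) - f x : R^o)).
  by apply/funext => h; rewrite addrA !pf.
by [].
Qed.

Lemma smooth_is_derive f (x : R) : smooth_periodic L f -> is_derive x 1 f (derive1 f x).
Proof. by move=> [_ df]; rewrite derive1E; apply: DeriveDef => //; exact: (df 0%N). Qed.

Lemma smooth_continuous f : smooth_periodic L f -> continuous f.
Proof.
move=> sf x; apply/differentiable_continuous/derivable1_diffP.
by have [] := smooth_is_derive x sf.
Qed.

(** Integration by parts; the boundary terms cancel by periodicity. *)
Lemma smooth_coef f k : smooth_periodic L f ->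
  k%:R * mu * fc f k = - fs (derive1 f) k /\ k%:R * mu * fs f k = fc (derive1 f) k.
Proof.
move=> sf; have cf := smooth_continuous sf.
have cdf := smooth_continuous (smooth_periodic_derive sf).
have fi := itg_cont xL xR cf; have dfi := itg_cont xL xR cdf.
have [pc ps] := mode_period xLR muE k.
have [cc cs] := continuous_mode mu k.
have fLR : f xR = f xL by have [pf _] := sf; rewrite -(pf xL) addrC subrK.
have cM g h : continuous g -> continuous h -> continuous (fun x => g x * h x : R).
  by move=> cg ch x; apply: cvgM; [exact: cg|exact: ch].
have ic g : itg g -> itg (fun x => g x * cos (k%:R * mu * x)) by move=> gi; exact: itg_fc.
have is_ g : itg g -> itg (fun x => g x * sin (k%:R * mu * x)) by move=> gi; exact: itg_fs.
have C1 : continuous (fun x => k%:R * mu * (f x * cos (k%:R * mu * x))).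
  by apply: (@continuousMc _ _ (fun x => f x * cos (k%:R * mu * x))); exact: cM.
have C2 : continuous (fun x => k%:R * mu * (f x * sin (k%:R * mu * x))).
  by apply: (@continuousMc _ _ (fun x => f x * sin (k%:R * mu * x))); exact: cM.
have H1 : intg xL xR (fun x => derive1 f x * sin (k%:R * mu * x) +
    k%:R * mu * (f x * cos (k%:R * mu * x))) = 0.
  apply: (etrans (@intg_derive _ _ _ xLR (fun x => f x * sin (k%:R * mu * x)) _ _ _)).
  - move=> x; have dfx := smooth_is_derive x sf; have [_ dsx] := is_derive_mode mu k x.
    apply: is_derive_eq; rewrite /GRing.scale/=; ring.
  - by move=> x; apply: cvgD; [exact: cM|exact: C1].
  by rewrite fLR ps subrr.
have H2 : intg xL xR (fun x => derive1 f x * cos (k%:R * mu * x) -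
    k%:R * mu * (f x * sin (k%:R * mu * x))) = 0.
  apply: (etrans (@intg_derive _ _ _ xLR (fun x => f x * cos (k%:R * mu * x)) _ _ _)).
  - move=> x; have dfx := smooth_is_derive x sf; have [dcx _] := is_derive_mode mu k x.
    apply: is_derive_eq; rewrite /GRing.scale/=; ring.
  - by move=> x; apply: cvgB; [exact: cM|exact: C2].
  by rewrite fLR pc subrr.
move: H1 H2; rewrite intgD ?intgB ?intgZ//; try by [apply: itgZ; auto|auto].
rewrite /fc /fs => H1 H2.
split; rewrite mulrCA.
  by apply/eqP; rewrite -addr_eq0 -mulrDr [_ + intg _ _ _]addrC H1 mulr0.
by apply/eqP; rewrite eq_sym -subr_eq0 -mulrBr H2 mulr0.
Qed.

Lemma smooth_coef_decay f m : smooth_periodic L f ->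
  exists2 C, 0 <= C & forall k, (0 < k)%N ->
    (k%:R * mu) ^+ m * `|fc f k| <= C /\ (k%:R * mu) ^+ m * `|fs f k| <= C.
Proof.
elim: m f => [|m IH] f sf.
  have cf := smooth_continuous sf.
  have cw : {within domain xL xR, continuous f} by exact: continuous_subspaceT.
  have /compact_bounded[M [_ hM]] := continuous_compact cw (@segment_compact _ xL xR).
  exists (`|M| + 1) => [|k _]; first by rewrite addr_ge0.
  rewrite expr0 !mul1r; apply: coef_le => //; first exact: itg_cont.
  move=> x xOm; apply: hM; first by rewrite ltr_pwDr// ler_norm.
  by exists x.
have [C C0 hC] := IH _ (smooth_periodic_derive sf).
exists C => // k k0; have [h1 h2] := hC k k0; have [e1 e2] := smooth_coef k sf.
have kmu : 0 <= k%:R * mu by rewrite mulr_ge0// ltW.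
rewrite exprSr -!mulrA.
have -> : k%:R * (mu * `|fc f k|) = `|fs (derive1 f) k|.
  by rewrite mulrA -{1}(ger0_norm kmu) -normrM e1 normrN.
have -> : k%:R * (mu * `|fs f k|) = `|fc (derive1 f) k|.
  by rewrite mulrA -{1}(ger0_norm kmu) -normrM e2.
by [].
Qed.

(** The weight of order s is a polynomial weight up to a constant, so decay of
    order |ceil s| + 1 leaves a multiple of 1/k^2. *)
Lemma smooth_sobolev_bound s f : smooth_periodic L f -> exists B, sobolev_bound s f B.
Proof.
move=> sf; pose m := `|Num.ceil s|%N.
have sm : s <= m%:R.
  rewrite /m natr_absz; apply: le_trans (ceil_ge s) _.
  by rewrite ler_int ler_norm.
have [C C0 hC] := smooth_coef_decay m.+1 sf.
pose c := 1 + (mu ^+ 2)^-1.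
have c0 : 0 <= c by rewrite addr_ge0// invr_ge0 sqr_ge0.
pose D := c ^+ m * (2 * C ^+ 2) / mu ^+ 2.
have D0 : 0 <= D by rewrite divr_ge0 ?sqr_ge0// mulr_ge0 ?exprn_ge0// mulr_ge0 ?sqr_ge0.
exists (weight s 0 * (fc f 0 ^+ 2 + fs f 0 ^+ 2) + D * 2) => -[|n].
  by rewrite big_ord0 addr_ge0// mulr_ge0 ?weight_ge0// addr_ge0 ?sqr_ge0.
rewrite big_ord_recl/= lerD2l.
apply: le_trans (_ : \sum_(k < n) D * (k.+1%:R ^+ 2)^-1 <= _); last first.
  rewrite -mulr_sumr ler_wpM2l//.
  have := @sum_inv_sqr_le R 1 n.+1 isT; rewrite big_add1/= big_mkord; lra.
apply: ler_sum => i _; rewrite /bump/= add1n; set k := i.+1.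
have k1 : (1 : R) <= k%:R by rewrite ler1n.
have k0 : (0 : R) < k%:R by apply: lt_le_trans k1.
have kmu : 0 < k%:R * mu by rewrite mulr_gt0.
have [h1 h2] := hC k isT.
have wle : weight s k <= c ^+ m * ((k%:R * mu) ^+ m) ^+ 2.
  apply: le_trans (_ : weight m%:R k <= _).
    by rewrite ler_powR// weight_base_ge1.
  rewrite /weight powR_mulrn ?(le_trans ler01 (weight_base_ge1 k))//.
  rewrite exprAC -exprMn lerXn2r ?nnegrE ?(le_trans ler01 (weight_base_ge1 k))//.
    by rewrite mulr_ge0// sqr_ge0.
  rewrite /c mulrDl mul1r addrC lerD2l mulrC exprMn mulfK ?expf_neq0 ?gt_eqF//.
  by rewrite expr_ge1// ltW.
have cle z : (k%:R * mu) ^+ m.+1 * `|z| <= C ->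
    ((k%:R * mu) ^+ m) ^+ 2 * z ^+ 2 <= C ^+ 2 / (k%:R * mu) ^+ 2.
  move=> hz; rewrite ler_pdivlMr ?exprn_gt0//.
  have -> : ((k%:R * mu) ^+ m) ^+ 2 * z ^+ 2 * (k%:R * mu) ^+ 2 =
     ((k%:R * mu) ^+ m.+1 * `|z|) ^+ 2.
    rewrite [_ ^+ m.+1]exprSr; set y := k%:R * mu; rewrite !exprMn real_normK ?num_real//; ring.
  by rewrite lerXn2r ?nnegrE// mulr_ge0 ?exprn_ge0// ltW.
have := cle _ h1; have := cle _ h2 => e2 e1.
apply: le_trans (_ : c ^+ m * ((k%:R * mu) ^+ m) ^+ 2 * (fc f k ^+ 2 + fs f k ^+ 2) <= _).
  by rewrite ler_wpM2r// addr_ge0 ?sqr_ge0.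
have -> : D * (k%:R ^+ 2)^-1 = c ^+ m * (C ^+ 2 / (k%:R * mu) ^+ 2 + C ^+ 2 / (k%:R * mu) ^+ 2).
  by rewrite /D; field; rewrite !gt_eqF.
by rewrite -mulrA ler_wpM2l ?exprn_ge0// mulrDr lerD.
Qed.

(** An element of the closure differs from a smooth function by a function of
    Sobolev norm less than 1. *)
Lemma sobolev_periodic_bound s f :
  sobolev_periodic xL xR s f -> exists B, sobolev_bound s f B.
Proof.
move=> [sqf dense]; have [phi [sphi close]] := dense 1 ltr01.
have fi := square_integrable_itg sqf.
have phii := itg_cont xL xR (smooth_continuous sphi).
have [B hB] := smooth_sobolev_bound s sphi.
exists (2 * (1 / L) + 2 * B) => n.
have := sobolev_boundD (itgB fi phii) phii (sobolev_bound_lt close) hB n.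
by rewrite (_ : (fun x => _) = f)//; apply/funext => x; rewrite subrK.
Qed.

End Sobolev.

(** * Differentiation in time *)

Section TimeCalculus.
Local Open Scope classical_set_scope.
Local Open Scope ring_scope.
Variables (R : realType) (T : R).
Hypothesis T0 : 0 < T.
Implicit Types (f g : R -> R) (t : R).

(** One-sided at 0 and T, like the derivatives of a curve in a Sobolev space. *)
Definition deriv_within f t (d : R) : Prop :=
  forall e : R, 0 < e -> exists2 del : R, 0 < del &
    forall t', 0 <= t' <= T -> t' != t -> `|t' - t| < del ->
      `|(f t' - f t) / (t' - t) - d| <= e.

Lemma within_dnbhsP (t : R) (P : R -> Prop) :
  (\forall t' \near within (times T) t^', P t') ->
  exists2 del : R, 0 < del &
    forall t', 0 <= t' <= T -> t' != t -> `|t' - t| < del -> P t'.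
Proof.
rewrite /within/= => /nbhs_ballP[del /= del0 h]; exists del => // t' t'T t't d.
by apply: (h t') => //; rewrite /ball/= distrC.
Qed.

Lemma within_nbhsP (t : R) (P : R -> Prop) :
  (\forall t' \near within (times T) (nbhs t), P t') ->
  exists2 del : R, 0 < del &
    forall t', 0 <= t' <= T -> `|t' - t| < del -> P t'.
Proof.
rewrite /within/= => /nbhs_ballP[del /= del0 h]; exists del => // t' t'T d.
by apply: (h t') => //; rewrite /ball/= distrC.
Qed.

Lemma deriv_within_unique f t d d' : 0 <= t <= T ->
  deriv_within f t d -> deriv_within f t d' -> d = d'.
Proof.
move=> /andP[t0 tT] fd fd'; apply/eqP; rewrite -subr_eq0 -normr_eq0.
rewrite eq_le normr_ge0 andbT; apply/ler_addgt0Pr => e e0; rewrite add0r.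
have e2 : 0 < e / 2 by rewrite divr_gt0.
have [a a0 ha] := fd _ e2; have [b b0 hb] := fd' _ e2.
pose c := Num.min (Num.min a b) T / 3.
have m0 : 0 < Num.min (Num.min a b) T by rewrite !lt_min a0 b0 T0.
have c0 : 0 < c by rewrite divr_gt0.
have mab : Num.min (Num.min a b) T <= Num.min a b by rewrite ge_min lexx.
have ma : Num.min (Num.min a b) T <= a by rewrite (le_trans mab)// ge_min lexx.
have mb : Num.min (Num.min a b) T <= b by rewrite (le_trans mab)// ge_min lexx orbT.
have mT : Num.min (Num.min a b) T <= T by rewrite ge_min lexx orbT.
have cm : c * 3 = Num.min (Num.min a b) T by rewrite /c; field.
have [t' t'T [t't t'c]] : exists2 t', 0 <= t' <= T & t' != t /\ `|t' - t| = c.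
  have [h|h] := leP t (T / 2).
    exists (t + c); first by apply/andP; split; lra.
    by rewrite addrAC subrr add0r gtr0_norm// -subr_eq0 addrAC subrr add0r gt_eqF.
  exists (t - c); first by apply/andP; split; lra.
  by rewrite addrAC subrr add0r normrN gtr0_norm// -subr_eq0 addrAC subrr add0r oppr_eq0 gt_eqF.
have h1 : `|(f t' - f t) / (t' - t) - d| <= e / 2 by apply: ha => //; rewrite t'c; lra.
have h2 : `|(f t' - f t) / (t' - t) - d'| <= e / 2 by apply: hb => //; rewrite t'c; lra.
set q := _ / _ in h1 h2.
have -> : d - d' = (q - d') - (q - d) by ring.
apply: le_trans (ler_normB _ _) _; lra.
Qed.

Lemma deriv_within_lin (n : nat) (c : nat -> R) (f d : nat -> R -> R) t :
  (forall k, deriv_within (f k) t (d k t)) ->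
  deriv_within (fun t => \sum_(k < n) c k * f k t) t (\sum_(k < n) c k * d k t).
Proof.
move=> fd; elim: n => [|n IH] e e0.
  exists 1 => // t' _ _ _.
  by rewrite !big_ord0 subrr mul0r subrr normr0 ltW.
have e2 : 0 < e / 2 by rewrite divr_gt0.
have [a a0 ha] := IH _ e2.
have ec : 0 < e / 2 / (`|c n| + 1) by rewrite divr_gt0// ltr_pwDr.
have [b b0 hb] := fd n _ ec.
exists (Num.min a b); first by rewrite lt_min a0.
move=> t' t'T t't; rewrite lt_min => /andP[ta tb].
have h1 := ha _ t'T t't ta; have h2 := hb _ t'T t't tb.
rewrite !big_ord_recr/=.
set S' := \sum_(k < n) _ in h1 *; set S := \sum_(k < n) _ in h1 *.
set dS := \sum_(k < n) _ in h1 *.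
have -> : (S' + c n * f n t' - (S + c n * f n t)) / (t' - t) - (dS + c n * d n t) =
  ((S' - S) / (t' - t) - dS) + c n * ((f n t' - f n t) / (t' - t) - d n t).
  by ring.
apply: le_trans (ler_normD _ _) _.
suff : `|c n * ((f n t' - f n t) / (t' - t) - d n t)| <= e / 2 by lra.
rewrite normrM; apply: le_trans (ler_wpM2l (normr_ge0 _) h2) _.
rewrite mulrCA ler_piMr ?(ltW e2)// ler_pdivrMr ?mul1r ?lerDl// ltr_pwDr//.
Qed.

Lemma deriv_withinB f g t d d' : deriv_within f t d -> deriv_within g t d' ->
  deriv_within (fun t => f t - g t) t (d - d').
Proof.
move=> fd gd e e0; have e2 : 0 < e / 2 by rewrite divr_gt0.
have [a a0 ha] := fd _ e2; have [b b0 hb] := gd _ e2.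
exists (Num.min a b); first by rewrite lt_min a0.
move=> t' t'T t't; rewrite lt_min => /andP[ta tb].
have h1 := ha _ t'T t't ta; have h2 := hb _ t'T t't tb.
have -> : (f t' - g t' - (f t - g t)) / (t' - t) - (d - d') =
  ((f t' - f t) / (t' - t) - d) - ((g t' - g t) / (t' - t) - d') by ring.
apply: le_trans (ler_normB _ _) _; lra.
Qed.

Lemma deriv_within_quad (a b c t0 t : R) :
  deriv_within (fun s => a + (s - t0) * b + (s - t0) ^+ 2 / 2 * c) t (b + (t - t0) * c).
Proof.
move=> e e0; have c1 : 0 < `|c| + 1 by rewrite ltr_pwDr.
exists (e / (`|c| + 1)); first by rewrite divr_gt0.
move=> t' _ t't h.
have tt0 : t' - t != 0 by rewrite subr_eq0.
have -> : (a + (t' - t0) * b + (t' - t0) ^+ 2 / 2 * c -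
   (a + (t - t0) * b + (t - t0) ^+ 2 / 2 * c)) / (t' - t) - (b + (t - t0) * c) =
   (t' - t) / 2 * c by field.
move: h; rewrite ltr_pdivlMr// => h.
rewrite !normrM (@ger0_norm _ 2^-1) ?invr_ge0//.
have := normr_ge0 (t' - t); have := normr_ge0 c; nra.
Qed.

Lemma deriv_within_is_derive f t d : 0 < t < T -> deriv_within f t d ->
  is_derive t 1 f d.
Proof.
move=> /andP[t0 tT] fd.
have cv : (fun h => h^-1 *: (f (h *: (1:R^o) + t) - f t : R^o)) @ 0^' --> (d : R^o).
  apply/cvgrPdist_le => e e0; have [a a0 ha] := fd _ e0.
  pose b := Num.min a (Num.min t (T - t)).
  have b0 : 0 < b by rewrite !lt_min a0 t0 subr_gt0 tT.
  have ba : b <= a by rewrite ge_min lexx.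
  have bt : b <= t by rewrite !ge_min lexx orbT.
  have bT : b <= T - t by rewrite !ge_min lexx !orbT.
  apply/nbhs_ballP; exists b => // h /=; rewrite /ball/= sub0r normrN => hb h0.
  have hlt : `|h| < a by apply: lt_le_trans hb ba.
  have := ha (t + h); rewrite addrAC subrr add0r => /(_ _ _ hlt).
  rewrite -(subr_eq0 (t + h)) addrAC subrr add0r => H.
  have hr : 0 <= t + h <= T.
    move: hb; rewrite ltr_norml => /andP[h1 h2]; apply/andP; split; lra.
  have := H hr h0.
  rewrite distrC /GRing.scale/= mulr1 (addrC h t) [h^-1 * _]mulrC; exact.
have dv : derivable f t 1 by apply/cvg_ex; exists d.
by apply: DeriveDef => //; exact: cvg_lim cv.
Qed.

Lemma deriv_within_continuous f t d : deriv_within f t d ->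
  forall e, 0 < e -> exists2 del : R, 0 < del &
    forall t', 0 <= t' <= T -> `|t' - t| < del -> `|f t' - f t| < e.
Proof.
move=> fd e e0; have [a a0 ha] := fd 1 ltr01.
have d2 : 0 < `|d| + 2 by rewrite ltr_pwDr.
exists (Num.min a (e / (`|d| + 2))); first by rewrite lt_min a0 divr_gt0.
move=> t' t'T; rewrite lt_min => /andP[h1]; rewrite ltr_pdivlMr// => h2.
have [->|t't] := eqVneq t' t; first by rewrite subrr normr0.
have tt0 : t' - t != 0 by rewrite subr_eq0.
have := ha _ t'T t't h1; set q := (f t' - f t) / _ => hq.
have -> : f t' - f t = (t' - t) * q by rewrite /q mulrC divfK.
rewrite normrM; apply: le_lt_trans h2; rewrite ler_wpM2l//.
have := ler_normD (q - d) d; rewrite subrK; lra.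
Qed.

Lemma within_mean_value f d B a b : 0 <= a -> a <= b -> b <= T ->
  (forall t, 0 <= t <= T -> deriv_within f t (d t)) ->
  (forall t, a <= t <= b -> `|d t| <= B) -> `|f b - f a| <= B * (b - a).
Proof.
move=> a0 ab bT fd dB.
have [c cab ->] : exists2 c, c \in `[a, b]%R & f b - f a = d c * (b - a).
  apply: MVT_segment => // [x|].
    rewrite in_itv/= => /andP[ax xb]; apply: deriv_within_is_derive.
      by rewrite (le_lt_trans a0 ax) (lt_le_trans xb bT).
    by apply: fd; rewrite (le_trans a0 (ltW ax)) (le_trans (ltW xb) bT).
  apply/subspace_continuousP => x xab; apply/cvgrPdist_lt => e e0.
  have xT : 0 <= x <= T.
    by move: xab; rewrite /= in_itv/= => /andP[h1 h2]; rewrite (le_trans a0 h1) (le_trans h2 bT).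
  have [del del0 h] := deriv_within_continuous (fd _ xT) e0.
  rewrite /within/=; apply/nbhs_ballP; exists del => // y; rewrite /ball/= => xy yab.
  rewrite distrC; apply: h; last by rewrite distrC.
  by move: yab; rewrite /= in_itv/= => /andP[h1 h2]; rewrite (le_trans a0 h1) (le_trans h2 bT).
rewrite normrM (ger0_norm (_ : 0 <= b - a)) ?subr_ge0// ler_wpM2r ?subr_ge0//.
by apply: dB; move: cab; rewrite in_itv.
Qed.

Lemma within_mean_value_sym f d B t t' (c : R) : 0 <= t <= T -> 0 <= t' <= T ->
  `|t' - t| <= c -> 0 <= B ->
  (forall t, 0 <= t <= T -> deriv_within f t (d t)) ->
  (forall s, 0 <= s <= T -> `|s - t| <= c -> `|d s| <= B) -> `|f t' - f t| <= B * c.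
Proof.
move=> /andP[t0 tT] /andP[t'0 t'T] tc B0 fd dB.
have c0 : 0 <= c := le_trans (normr_ge0 _) tc.
have [h|/ltW h] := leP t t'.
  apply: le_trans (_ : B * (t' - t) <= _).
    apply: (within_mean_value t0 h t'T fd) => s /andP[s1 s2].
    apply: dB; first by rewrite (le_trans t0 s1) (le_trans s2 t'T).
    move: tc; rewrite !ler_norml => /andP[h1 h2]; apply/andP; split; lra.
  by rewrite ler_wpM2l// (le_trans (ler_norm _) tc).
rewrite distrC; apply: le_trans (_ : B * (t - t') <= _).
  apply: (within_mean_value t'0 h tT fd) => s /andP[s1 s2].
  apply: dB; first by rewrite (le_trans t'0 s1) (le_trans s2 tT).
  move: tc; rewrite !ler_norml => /andP[h1 h2]; apply/andP; split; lra.
by rewrite ler_wpM2l// -opprB lerNl; move: tc; rewrite ler_norml => /andP[].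
Qed.

Section Taylor.
Variables (f f1 f2 f3 : R -> R) (M2 M3 : R).
Hypotheses (M20 : 0 <= M2) (M30 : 0 <= M3).
Hypothesis d1 : forall t, 0 <= t <= T -> deriv_within f t (f1 t).
Hypothesis d2 : forall t, 0 <= t <= T -> deriv_within f1 t (f2 t).
Hypothesis d3 : forall t, 0 <= t <= T -> deriv_within f2 t (f3 t).
Hypothesis f2M : forall t, 0 <= t <= T -> `|f2 t| <= M2.
Hypothesis f3M : forall t, 0 <= t <= T -> `|f3 t| <= M3.

(** Apply the mean value inequality to the remainder, as many times as there are
    derivatives; the constants are not optimal. *)
Lemma within_taylor2 t t' c : 0 <= t <= T -> 0 <= t' <= T -> `|t' - t| <= c ->
  `|f t' - f t - (t' - t) * f1 t| <= M2 * c ^+ 2.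
Proof.
move=> tT t'T tc; have c0 : 0 <= c := le_trans (normr_ge0 _) tc.
pose q s := f t + (s - t) * f1 t + (s - t) ^+ 2 / 2 * 0.
have -> : f t' - f t - (t' - t) * f1 t = (f t' - q t') - (f t - q t).
  by rewrite /q; ring.
rewrite expr2 mulrA.
apply: (@within_mean_value_sym (fun s => f s - q s) (fun s => f1 s - (f1 t + (s - t) * 0))) => //.
- by rewrite mulr_ge0.
- by move=> s sT; apply: deriv_withinB; [exact: d1|exact: deriv_within_quad].
move=> s sT sc; rewrite mulr0 addr0.
exact: (within_mean_value_sym tT sT sc M20 d2 (fun s' h _ => f2M h)).
Qed.

Lemma within_taylor3 t t' c : 0 <= t <= T -> 0 <= t' <= T -> `|t' - t| <= c ->
  `|f t' - f t - (t' - t) * f1 t - (t' - t) ^+ 2 / 2 * f2 t| <= M3 * c ^+ 3.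
Proof.
move=> tT t'T tc; have c0 : 0 <= c := le_trans (normr_ge0 _) tc.
pose q s := f t + (s - t) * f1 t + (s - t) ^+ 2 / 2 * f2 t.
have -> : f t' - f t - (t' - t) * f1 t - (t' - t) ^+ 2 / 2 * f2 t =
    (f t' - q t') - (f t - q t) by rewrite /q; ring.
rewrite exprSr mulrA.
apply: (@within_mean_value_sym (fun s => f s - q s) (fun s => f1 s - (f1 t + (s - t) * f2 t))) => //.
- by rewrite mulr_ge0 ?exprn_ge0.
- by move=> s sT; apply: deriv_withinB; [exact: d1|exact: deriv_within_quad].
move=> s sT sc.
pose q1 s := f1 t + (s - t) * f2 t + (s - t) ^+ 2 / 2 * 0.
have -> : f1 s - (f1 t + (s - t) * f2 t) = (f1 s - q1 s) - (f1 t - q1 t).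
  by rewrite /q1; ring.
rewrite expr2 mulrA.
apply: (@within_mean_value_sym (fun s => f1 s - q1 s) (fun s => f2 s - (f2 t + (s - t) * 0))) => //.
- by rewrite mulr_ge0.
- by move=> s' sT'; apply: deriv_withinB; [exact: d2|exact: deriv_within_quad].
move=> s' sT' sc'; rewrite mulr0 addr0.
exact: (within_mean_value_sym tT sT' sc' M30 d3 (fun s'' h _ => f3M h)).
Qed.

(** The terms of even order cancel by symmetry. *)
Lemma central_difference t h : 0 < h -> 0 <= t - h -> t + h <= T ->
  `|(2 * h)^-1 * (f (t + h) - f (t - h)) - f1 t| <= M3 * h ^+ 2.
Proof.
move=> h0 tm tp; have tT : 0 <= t <= T by apply/andP; split; lra.
have tpT : 0 <= t + h <= T by apply/andP; split; lra.
have tmT : 0 <= t - h <= T by apply/andP; split; lra.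
have ep : `|t + h - t| <= h by rewrite addrAC subrr add0r gtr0_norm.
have em : `|t - h - t| <= h by rewrite addrAC subrr add0r normrN gtr0_norm.
have := within_taylor3 tT tpT ep; have := within_taylor3 tT tmT em.
set X := (X in `|X|); set Y := (Y in _ -> `|Y| <= _ -> _) => hX hY.
have -> : (2 * h)^-1 * (f (t + h) - f (t - h)) - f1 t = (2 * h)^-1 * (Y - X).
  by rewrite /X /Y; field; rewrite gt_eqF.
rewrite normrM (ger0_norm (_ : 0 <= (2 * h)^-1)) ?invr_ge0 ?mulr_ge0 ?(ltW h0)//.
rewrite ler_pdivrMl ?mulr_gt0//.
have -> : 2 * h * (M3 * h ^+ 2) = 2 * (M3 * h ^+ 3) by ring.
apply: le_trans (ler_normB _ _) _; lra.
Qed.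

Lemma central_average t h : 0 < h -> 0 <= t - h -> t + h <= T ->
  `|2^-1 * (f (t + h) + f (t - h)) - f t| <= M2 * h ^+ 2.
Proof.
move=> h0 tm tp; have tT : 0 <= t <= T by apply/andP; split; lra.
have tpT : 0 <= t + h <= T by apply/andP; split; lra.
have tmT : 0 <= t - h <= T by apply/andP; split; lra.
have ep : `|t + h - t| <= h by rewrite addrAC subrr add0r gtr0_norm.
have em : `|t - h - t| <= h by rewrite addrAC subrr add0r normrN gtr0_norm.
have := within_taylor2 tT tpT ep; have := within_taylor2 tT tmT em.
set X := (X in `|X|); set Y := (Y in _ -> `|Y| <= _ -> _) => hX hY.
have -> : 2^-1 * (f (t + h) + f (t - h)) - f t = 2^-1 * (Y + X).
  by rewrite /X /Y; field.
rewrite normrM (ger0_norm (_ : 0 <= 2^-1)) ?invr_ge0//.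
have := ler_normD Y X; lra.
Qed.

End Taylor.
End TimeCalculus.

(** * Fourier coefficients of curves in Sobolev spaces *)

Section Curves.
Local Open Scope classical_set_scope.
Local Open Scope ring_scope.
Variables (R : realType) (xL xR mu T : R).
Hypotheses (xLR : xL < xR) (muE : mu = wavenumber xL xR) (T0 : 0 < T).
Implicit Types (v : R -> R -> R) (w : R -> R) (s t : R) (k : nat).

Local Notation L := (xR - xL).
Local Notation fc := (fc xL xR mu).
Local Notation fs := (fs xL xR mu).
Local Notation itg := (itg xL xR).
Local Notation sobolev_bound := (sobolev_bound xL xR mu).

Let L0 : 0 < L. Proof. by rewrite subr_gt0. Qed.

Lemma cvg0_near_lt (I : Type) (F : set_system I) (f : I -> \bar R) (e : R) :
  f i @[i --> F] --> 0%E -> 0 < e -> \forall i \near F, (f i < e%:E)%E.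
Proof.
move=> f0 e0; apply: (f0 [set x | (x < e%:E)%E]).
by apply: open_nbhs_nbhs; split; [exact: open_ereal_lt_ereal|rewrite /= lte_fin].
Qed.

(** Each coefficient is bounded by the Sobolev norm, of which the weights are at
    least 1, so that differentiability in norm passes to coefficients. *)
Lemma coef_deriv_within s v w t k : 0 <= s -> 0 <= t <= T ->
  (forall t, 0 <= t <= T -> itg (v t)) -> itg w ->
  sobolev_derivative_at xL xR s T v t w ->
  deriv_within T (fun t => fc (v t) k) t (fc w k) /\
  deriv_within T (fun t => fs (v t) k) t (fs w k).
Proof.
move=> s0 tT vi wi vw.
suff H e : 0 < e -> exists2 del : R, 0 < del &
    forall t', 0 <= t' <= T -> t' != t -> `|t' - t| < del ->
    `|(fc (v t') k - fc (v t) k) / (t' - t) - fc w k| <= e /\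
    `|(fs (v t') k - fs (v t) k) / (t' - t) - fs w k| <= e.
  by split=> e /H[del del0 h]; exists del => // t' a b c; have [] := h t' a b c.
move=> e0; have e2 : 0 < e ^+ 2 * L by rewrite mulr_gt0 ?exprn_gt0.
have /within_dnbhsP[del del0 h] := cvg0_near_lt vw e2.
exists del => // t' t'T t't td; have := sobolev_bound_lt xLR muE (h t' t'T t't td).
rewrite mulfK ?gt_eqF//; set q := fun x => _ => /(_ k.+1).
have qE : q = (fun x => (t' - t)^-1 * (v t' x - v t x) - w x).
  by apply/funext => x; rewrite /q mulrC.
have di : itg (fun x => v t' x - v t x) by apply: itgB; exact: vi.
have -> : (fc (v t') k - fc (v t) k) / (t' - t) - fc w k = fc q k.
  by rewrite qE fcB ?fcZ ?fcB//; [rewrite mulrC|exact: vi|exact: vi|exact: itgZ].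
have -> : (fs (v t') k - fs (v t) k) / (t' - t) - fs w k = fs q k.
  by rewrite qE fsB ?fsZ ?fsB//; [rewrite mulrC|exact: vi|exact: vi|exact: itgZ].
rewrite big_ord_recr/= => hq.
have sum0 : 0 <= \sum_(i < k) weight mu s i * (fc q i ^+ 2 + fs q i ^+ 2).
  by apply: sumr_ge0 => i _; rewrite mulr_ge0 ?weight_ge0// addr_ge0 ?sqr_ge0.
have w1 := weight_ge1 mu k s0.
have z0 : 0 <= fc q k ^+ 2 + fs q k ^+ 2 by rewrite addr_ge0 ?sqr_ge0.
have le2 : fc q k ^+ 2 + fs q k ^+ 2 <= e ^+ 2.
  apply: le_trans (_ : weight mu s k * (fc q k ^+ 2 + fs q k ^+ 2) <= _).
    by rewrite ler_peMl.
  by apply: le_trans hq; rewrite lerDr.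
have [c0 s0'] := (sqr_ge0 (fc q k), sqr_ge0 (fs q k)).
have aux z : z ^+ 2 <= e ^+ 2 -> `|z| <= e.
  by rewrite -(real_normK (num_real z)) ler_sqr ?nnegrE ?(ltW e0).
by split; apply: aux; lra.
Qed.

(** Continuity bounds the norm near each time, and the time interval is
    compact. *)
Lemma curve_bound s v : (forall t, 0 <= t <= T -> sobolev_periodic xL xR s (v t)) ->
  sobolev_continuous xL xR s T v ->
  exists2 B, 0 <= B & forall t, 0 <= t <= T -> sobolev_bound s (v t) B.
Proof.
move=> vp vc.
have vi t : 0 <= t <= T -> itg (v t).
  by move=> /vp[sq _]; exact: square_integrable_itg.
have /compact_near_coveringP/near_covering_withinP cov := @segment_compact R 0 T.
have [B [_ hB]] : \forall B \near +oo, `[0, T]%classic `<=` (fun t => sobolev_bound s (v t) B).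
  apply: (cov _ _ (fun B t => sobolev_bound s (v t) B)) => t; rewrite /= in_itv/= => tT.
  have [B0 hB0] := sobolev_periodic_bound xLR muE (vp t tT).
  have /within_nbhsP[del del0 h] := cvg0_near_lt (vc t tT) ltr01.
  near=> t' B => /=; rewrite in_itv/= => t'T.
  have tt' : `|t' - t| < del.
    by near: t'; apply/nbhs_ballP; exists del => // z; rewrite /ball/= distrC.
  have hd := sobolev_bound_lt xLR muE (h t' t'T tt').
  apply: (@sobolev_boundW _ _ _ _ _ _ (2 * (1 / L) + 2 * B0)).
    by near: B; apply: nbhs_pinfty_ge; exact: num_real.
  move=> n; have := sobolev_boundD (itgB (vi _ t'T) (vi _ tT)) (vi _ tT) hd hB0 n.
  by rewrite (_ : (fun x => _) = v t')//; apply/funext => x; rewrite subrK.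
exists (`|B| + 1) => [|t tT]; first by rewrite addr_ge0.
apply: (hB (`|B| + 1)) => //; first by rewrite ltr_pwDr// ler_norm.
Unshelve. all: by end_near.
Qed.

End Curves.

(** * Fourier coefficients of the solution *)

Section Solution.
Local Open Scope classical_set_scope.
Local Open Scope ring_scope.
Variables (R : realType) (xL xR mu T : R).
Hypotheses (xLR : xL < xR) (muE : mu = wavenumber xL xR) (T0 : 0 < T).
Implicit Types (v : R -> R -> R) (w : R -> R) (s t : R) (k : nat).

Local Notation L := (xR - xL).
Local Notation fc := (fc xL xR mu).
Local Notation fs := (fs xL xR mu).
Local Notation itg := (itg xL xR).
Local Notation sobolev_bound := (sobolev_bound xL xR mu).

Let L0 : 0 < L. Proof. by rewrite subr_gt0. Qed.

(** The successive derivatives collected in one family, with one bound for all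
    of them. *)
Lemma sobolev_Ck_coef n s v : 0 <= s -> sobolev_Ck n xL xR s T v ->
  exists (w : nat -> R -> R -> R) (B : R), [/\ w 0%N = v, 0 <= B,
    forall i t, (i <= n)%N -> 0 <= t <= T -> itg (w i t) /\ sobolev_bound s (w i t) B &
    forall i t k, (i < n)%N -> 0 <= t <= T ->
      deriv_within T (fun t => fc (w i t) k) t (fc (w i.+1 t) k) /\
      deriv_within T (fun t => fs (w i t) k) t (fs (w i.+1 t) k)].
Proof.
move=> s0; have timesE t : times T t = (0 <= t <= T) :> Prop by rewrite /times/= in_itv.
elim: n v => [|n IH] v /= [vp vc hk].
  have vp' t : 0 <= t <= T -> sobolev_periodic xL xR s (v t) by rewrite -timesE; exact: vp.
  have [B B0 hB] := curve_bound xLR muE vp' vc.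
  exists (fun=> v), B; split=> // i t _ tT.
  by split; [apply: square_integrable_itg; have [] := vp' t tT|exact: hB].
have vp' t : 0 <= t <= T -> sobolev_periodic xL xR s (v t) by rewrite -timesE; exact: vp.
have vi t : 0 <= t <= T -> itg (v t).
  by move=> /vp'[sq _]; exact: square_integrable_itg.
have [B B0 hB] := curve_bound xLR muE vp' vc.
have [w1 [vw /IH[w [B' [w0 B'0 wB wd]]]]] := hk.
exists (fun i => if i is i'.+1 then w i' else v), (Num.max B B'); split=> //.
- by rewrite le_max B0.
- case=> [|i] t; first by move=> _ tT; split; [exact: vi|
    apply: sobolev_boundW (hB t tT); rewrite le_max lexx].
  move=> iN tT; have [wi wb] := wB i t iN tT; split=> //.
  by apply: sobolev_boundW wb; rewrite le_max lexx orbT.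
case=> [|i] t k; last exact: wd.
move=> _ tT; rewrite w0; apply: (@coef_deriv_within _ _ _ _ _ xLR muE s) => //.
  by rewrite -w0; have [] := wB 0%N t isT tT.
by have := vw t; rewrite timesE => /(_ tT).
Qed.

(** The weak equation tested with a combination of cos and sin of frequency k.
    The time derivative in L2 given by the weak equation has the same
    coefficients as any derivative of the coefficients, by uniqueness. *)
Lemma rlw_coef (a sigma gamma : R) (u0 : R -> R) (u : R -> R -> R) t k (dc ds : R) :
  RLW_solution a sigma gamma xL xR T u0 u -> 0 <= t <= T ->
  deriv_within T (fun t => fc (u^~ t) k) t dc ->
  deriv_within T (fun t => fs (u^~ t) k) t ds ->
  (1 + sigma * (k%:R * mu) ^+ 2) * dc +
     k%:R * mu * fs (fun x => a * u x t + gamma / 2 * u x t ^+ 2) k = 0 /\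
  (1 + sigma * (k%:R * mu) ^+ 2) * ds -
     k%:R * mu * fc (fun x => a * u x t + gamma / 2 * u x t ^+ 2) k = 0.
Proof.
move=> [cu _ _ weak] tT hdc hds.
have timesE t' : times T t' = (0 <= t' <= T) :> Prop by rewrite /times/= in_itv.
have [ut [sqt dut eqn]] : exists ut : R -> R,
        [/\ square_integrable xL xR ut,
            sobolev_derivative_at xL xR 0 T (fun t x => u x t) t ut &
            forall phi : R -> R, smooth_periodic (xR - xL) phi ->
              intg xL xR (fun x => ut x * phi x - a * u x t * derive1n 1 phi x
                 - sigma * ut x * derive1n 2 phi x
                 - gamma / 2 * u x t ^+ 2 * derive1n 1 phi x) = 0].
  by apply: weak; rewrite timesE.
have cut t' : 0 <= t' <= T -> continuous (u^~ t') by move=> h; apply: cu; rewrite timesE.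
have uti := square_integrable_itg sqt.
have [hdc' hds'] := @coef_deriv_within _ _ _ _ _ xLR muE 0 (fun t x => u x t) ut t k (lexx 0) tT
  (fun t' h => itg_cont xL xR (cut t' h)) uti dut.
rewrite (deriv_within_unique T0 tT hdc hdc') (deriv_within_unique T0 tT hds hds').
set F := fun x => _.
have cF : continuous F.
  have cM (g h : R -> R) : continuous g -> continuous h -> continuous (fun x => g x * h x : R).
    by move=> cg ch x; apply: cvgM; [exact: cg|exact: ch].
  have c1 := cut t tT.
  have cA : continuous (fun x => a * u x t) by apply: (@continuousMc _ a (u^~ t)).
  have cB : continuous (fun x => gamma / 2 * u x t ^+ 2).
    apply: (@continuousMc _ (gamma / 2) (fun x => u x t ^+ 2)).
    have -> : (fun x => u x t ^+ 2) = (fun x => u x t * u x t) by apply/funext.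
    exact: cM.
  by move=> x; apply: cvgD; [exact: cA|exact: cB].
have Fi := itg_cont xL xR cF.
have L1 : L^-1 != 0 by rewrite invr_eq0 gt_eqF.
have per x : cos (k%:R * mu * (x + L)) = cos (k%:R * mu * x) /\
             sin (k%:R * mu * (x + L)) = sin (k%:R * mu * x).
  have -> : k%:R * mu * (x + L) = k%:R * mu * x + k%:R * (2 * pi).
    by rewrite muE /wavenumber; field; rewrite gt_eqF.
  rewrite [2 * pi]mulr_natl [k%:R * (pi *+ 2)]mulr_natl.
  by rewrite (periodicn (@cosD2pi R)) (periodicn (@sinD2pi R)).
pose md (p q x : R) := p * cos (k%:R * mu * x) + q * sin (k%:R * mu * x).
have mdE p q : md p q = trig mu (fun i => (i == k)%:R * p) (fun i => (i == k)%:R * q) k.+1.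
  apply/funext => x; rewrite /trig (bigD1 (Ordinal (ltnSn k)))//= eqxx !mul1r.
  rewrite big1 ?addr0// => i.
  by rewrite -val_eqE/= => /negbTE ->; rewrite !mul0r addr0.
have dmd p q : derive1 (md p q) = md (k%:R * mu * q) (- (k%:R * mu * p)).
  rewrite !mdE derive1_trig; apply/funext => x; apply: eq_trig => i _.
    by case: eqP => [->|_]; rewrite ?mul1r ?mul0r ?mulr0.
  by case: eqP => [->|_]; rewrite ?mul1r ?mul0r ?mulr0 ?oppr0.
have smd p q : smooth_periodic L (md p q).
  split=> [x|j x]; first by rewrite /md; have [-> ->] := per x.
  rewrite mdE; have [A' [B' ->]] := derive1n_trig mu (fun i => (i == k)%:R * p)
    (fun i => (i == k)%:R * q) k.+1 j.
  exact: derivable_trig.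
have main p q : (1 + sigma * (k%:R * mu) ^+ 2) * (p * fc ut k + q * fs ut k) +
    k%:R * mu * (p * fs F k - q * fc F k) = 0.
  have := eqn _ (smd p q); rewrite /= !dmd.
  rewrite (@eq_intg _ _ _ _ (fun x => (1 + sigma * (k%:R * mu) ^+ 2) *
     (p * (ut x * cos (k%:R * mu * x)) + q * (ut x * sin (k%:R * mu * x))) +
     k%:R * mu * (p * (F x * sin (k%:R * mu * x)) - q * (F x * cos (k%:R * mu * x))))); last first.
    by move=> x; rewrite /md /F; ring.
  have uc := itg_fc mu k uti; have us := itg_fs mu k uti.
  have Fc := itg_fc mu k Fi; have Fs := itg_fs mu k Fi.
  have i1 : itg (fun x => p * (ut x * cos (k%:R * mu * x)) + q * (ut x * sin (k%:R * mu * x))).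
    by apply: itgD; exact: itgZ.
  have i2 : itg (fun x => p * (F x * sin (k%:R * mu * x)) - q * (F x * cos (k%:R * mu * x))).
    by apply: itgB; exact: itgZ.
  rewrite intgD; [|exact: itgZ|exact: itgZ].
  rewrite !intgZ// intgD; [|exact: itgZ|exact: itgZ].
  rewrite intgB; [|exact: itgZ|exact: itgZ].
  rewrite !intgZ// => E; rewrite -[RHS](mulr0 L^-1) -E /fc /fs; ring.
split.
  by have := main 1 0; rewrite !mul1r !mul0r addr0 subr0.
by have := main 0 1; rewrite !mul1r !mul0r !add0r mulrN.
Qed.

End Solution.
(** * Decay of Fourier coefficients *)

Section Decay.
Variables (R : realType) (xL xR mu r B : R).
Hypotheses (xLR : xL < xR) (muE : mu = wavenumber xL xR) (r0 : 0 <= r) (B0 : 0 <= B).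
Implicit Types (f : R -> R) (k n j N : nat) (x X : R).

Local Notation fc := (fc xL xR mu).
Local Notation fs := (fs xL xR mu).
Local Notation sobolev_bound := (sobolev_bound xL xR mu).
Local Notation psum := (psum xL xR mu).

Let mu0 : 0 < mu.
Proof. by rewrite muE divr_gt0 ?mulr_gt0 ?pi_gt0 ?subr_gt0. Qed.

Definition h1_weight k : R := 1 + (k%:R * mu) ^+ 2.

Definition h1_term f k : R := h1_weight k * (fc f k ^+ 2 + fs f k ^+ 2).

Definition decay_const : R := ((mu / 4) ^+ 2) `^ (- r).

Lemma h1_term_ge0 f k : 0 <= h1_term f k.
Proof. by rewrite mulr_ge0 ?addr_ge0 ?sqr_ge0. Qed.

Lemma weightD1 k : weight mu (r + 1) k = h1_weight k * h1_weight k `^ r.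
Proof.
have h := weight_base_ge1 mu k.
rewrite /weight powRD; last first.
  by rewrite (gt_eqF (lt_le_trans ltr01 h)) implybT.
by rewrite powRr1 ?(le_trans ler01 h)// mulrC.
Qed.

Lemma sum_h1_le f n : sobolev_bound (r + 1) f B -> \sum_(k < n) h1_term f k <= B.
Proof.
move=> fB; apply: le_trans (fB n); apply: ler_sum => k _.
rewrite /h1_term weightD1 ler_wpM2r ?addr_ge0 ?sqr_ge0// ler_peMr ?addr_ge0 ?sqr_ge0//.
by rewrite -[leLHS](powRr0 (h1_weight k)) ler_powR// weight_base_ge1.
Qed.

(** The order r + 1 of the Sobolev space pays for one derivative and r powers
    of the number N of grid points. *)
Lemma tail_h1_le f N n : (0 < N)%N -> sobolev_bound (r + 1) f B ->
  \sum_(k < n | (N <= 4 * k)%N) h1_term f k <= B * decay_const * (N%:R `^ (- r)) ^+ 2.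
Proof.
move=> N0 fB; have N0' : (0 : R) < N%:R by rewrite ltr0n.
set d := decay_const * (N%:R `^ (- r)) ^+ 2.
have dE : d = (((N%:R * (mu / 4)) ^+ 2) `^ r)^-1.
  have h : (N%:R `^ (- r)) ^+ 2 = (N%:R ^+ 2 : R) `^ (- r) by rewrite !expr2 powRM.
  by rewrite /d /decay_const h -powRM ?sqr_ge0// -exprMn mulrC powRN.
have d0 : 0 <= d by rewrite dE invr_ge0 powR_ge0.
apply: le_trans (_ : d * B <= _); last by rewrite /d mulrC mulrA.
apply: le_trans (ler_wpM2l d0 (fB n)); rewrite mulr_sumr big_mkcond.
apply: ler_sum => k _; have c0 : 0 <= fc f k ^+ 2 + fs f k ^+ 2 by rewrite addr_ge0 ?sqr_ge0.
case: ifP => [Nk|_]; last by rewrite mulr_ge0// mulr_ge0// weight_ge0.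
rewrite /h1_term mulrA ler_wpM2r// weightD1 mulrCA ler_peMr ?addr_ge0 ?sqr_ge0//.
rewrite dE mulrC ler_pdivlMr ?mul1r; last by rewrite powR_gt0 ?exprn_gt0 ?mulr_gt0 ?divr_gt0.
apply: ge0_ler_powR; rewrite ?nnegrE ?sqr_ge0 ?addr_ge0 ?sqr_ge0//.
apply: le_trans (_ : (k%:R * mu) ^+ 2 <= _); last by rewrite lerDr.
rewrite lerXn2r ?nnegrE ?mulr_ge0 ?divr_ge0 ?(ltW mu0)//.
have -> : N%:R * (mu / 4) = N%:R / 4 * mu by field.
by rewrite ler_wpM2r ?(ltW mu0)// ler_pdivrMr// -natrM ler_nat mulnC.
Qed.

(** Cauchy-Schwarz against 1 / (k mu). *)
Lemma l1_coef_le f j n X : (0 < j)%N ->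
  \sum_(k < n | (j <= k)%N) h1_term f k <= X ->
  \sum_(k < n | (j <= k)%N) hw R k * (`|fc f k| + `|fs f k|) <=
  Num.sqrt (16 * X / (mu ^+ 2 * j%:R)).
Proof.
move=> j0 fX; have j0' : (0 : R) < j%:R by rewrite ltr0n.
apply: le_trans (ler_norm _) _; rewrite -sqrtr_sqr ler_sqrt; last first.
  rewrite divr_ge0 ?(mulr_ge0 (sqr_ge0 mu) (ltW j0'))// mulr_ge0//.
  by apply: le_trans fX; apply: sumr_ge0 => k _; exact: h1_term_ge0.
have k0 (k : nat) : (j <= k)%N -> (0 : R) < k%:R.
  by move=> jk; rewrite ltr0n; exact: leq_trans jk.
rewrite (eq_bigr (fun k : 'I_n => 1 * (hw R k / (k%:R * mu) * (k%:R * mu * `|fc f k|) +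
     hw R k / (k%:R * mu) * (k%:R * mu * `|fs f k|)))); last first.
  by move=> k /k0 kp; field; rewrite !gt_eqF.
apply: le_trans (cauchy_schwarz_sum _ _ _ _ _ _) _; first by [].
have -> : 16 * X / (mu ^+ 2 * j%:R) = (8 / mu ^+ 2 * (2 / j%:R)) * X.
  by field; rewrite !gt_eqF.
apply: ler_pM.
- by apply: sumr_ge0 => k _; rewrite mul1r addr_ge0 ?sqr_ge0.
- by apply: sumr_ge0 => k _; rewrite mul1r addr_ge0 ?sqr_ge0.
- apply: le_trans (_ : \sum_(j <= k < n) 8 / mu ^+ 2 * (k%:R ^+ 2)^-1 <= _); last first.
    rewrite -mulr_sumr ler_wpM2l ?divr_ge0 ?sqr_ge0//; exact: sum_inv_sqr_le.
  rewrite [leRHS]big_geq_mkord/=; apply: ler_sum => k /k0 kp.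
  have -> : 8 / mu ^+ 2 * (k%:R ^+ 2)^-1 = 2 * (2 / (k%:R * mu)) ^+ 2.
    by field; rewrite !gt_eqF.
  have h : (hw R k / (k%:R * mu)) ^+ 2 <= (2 / (k%:R * mu)) ^+ 2.
    rewrite lerXn2r ?nnegrE ?divr_ge0 ?(ltW (hw_gt0 _ _)) ?mulr_ge0 ?(ltW mu0)//.
    by rewrite ler_wpM2r ?hw_le2// invr_ge0 mulr_ge0// ltW.
  by rewrite mul1r; lra.
apply: le_trans fX; apply: ler_sum => k _; rewrite mul1r !exprMn !real_normK ?num_real//.
by rewrite -mulrDr ler_wpM2r ?addr_ge0 ?sqr_ge0// -exprMn lerDr.
Qed.

Lemma sobolev_bound_psum s f b n :
  sobolev_bound s f b -> sobolev_bound s (psum f n) b.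
Proof.
move=> fb j; apply: le_trans (fb j); apply: ler_sum => k _.
have [-> ->] := coef_psum xLR muE f n k.
rewrite ler_wpM2l ?weight_ge0//.
by case: (k < n)%N; rewrite ?mul1r// !mul0r expr0n addr0 addr_ge0 ?sqr_ge0.
Qed.

Definition coef_sum_const : R := Num.sqrt B + Num.sqrt (16 * B / mu ^+ 2).

Lemma coef_sum_le f n : sobolev_bound (r + 1) f B ->
  \sum_(k < n) hw R k * (`|fc f k| + `|fs f k|) <= coef_sum_const.
Proof.
move=> fB; rewrite (bigID (fun k : 'I_n => (1 <= k)%N))/= addrC lerD//.
  case: n => [|n]; first by rewrite big_ord0 sqrtr_ge0.
  rewrite (big_pred1 ord0); last by case=> -[|k].
  rewrite /hw mul1r fs0 normr0 addr0 -sqrtr_sqr ler_sqrt//.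
  apply: le_trans (sum_h1_le 1 fB); rewrite big_ord1 /h1_term.
  rewrite fs0 expr0n addr0 ler_peMl ?sqr_ge0//; exact: weight_base_ge1.
have := @l1_coef_le f 1 n B isT; rewrite mulr1; apply.
apply: le_trans (sum_h1_le n fB); rewrite big_mkcond; apply: ler_sum => k _.
by case: ifP => // _; exact: h1_term_ge0.
Qed.

Lemma continuous_norm_le f x : continuous f -> xL <= x <= xR ->
  sobolev_bound (r + 1) f B -> `|f x| <= coef_sum_const.
Proof.
by move=> cf xOm fB; apply: (norm_le_coef xLR muE cf xOm) => n; exact: coef_sum_le.
Qed.

(** The difference of f and its partial sum is continuous, and its coefficients
    are those of f beyond the cutoff. *)
Lemma psum_tail_le f j X x : continuous f -> xL <= x <= xR -> (0 < j)%N ->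
  (forall n, \sum_(k < n | (j <= k)%N) h1_term f k <= X) ->
  `|f x - psum f j x| <= Num.sqrt (16 * X / (mu ^+ 2 * j%:R)).
Proof.
move=> cf xOm j0 fX.
have cp : continuous (psum f j) by exact: continuous_psum.
have cv : continuous (fun x => f x - psum f j x).
  by move=> y; apply: cvgB; [exact: cf|exact: cp].
apply: (norm_le_coef xLR muE cv xOm) => n.
apply: le_trans (l1_coef_le j0 (fX n)); rewrite [leRHS]big_mkcond.
apply: ler_sum => k _.
rewrite fcB ?fsB; try exact: itg_cont.
have [-> ->] := coef_psum xLR muE f j k.
by rewrite ltnNge; case: (j <= k)%N; rewrite ?mul0r ?subr0// !mul1r !subrr normr0 addr0 mulr0.
Qed.

End Decay.

(** * Consistency *)

Section Consistency.
Variables (R : realType) (a sigma gamma xL xR mu r B : R) (N m : nat).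
Hypotheses (xLR : xL < xR) (muE : mu = wavenumber xL xR) (r0 : 0 <= r) (B0 : 0 <= B).
Hypotheses (a0 : 0 < a) (sigma0 : 0 < sigma) (gamma0 : 0 < gamma).
Hypotheses (NE : N = m.*2) (m0 : (0 < m)%N).
Implicit Types (f : R -> R) (k n j : nat).

Local Notation fc := (fc xL xR mu).
Local Notation fs := (fs xL xR mu).
Local Notation sobolev_bound := (sobolev_bound xL xR mu).
Local Notation psum := (psum xL xR mu).
Local Notation omega := (omega mu sigma).
Local Notation D1 := (fourier_D xL xR N 1).
Local Notation A := (opA xL xR sigma N).
Local Notation D := (LLF_D a gamma xL xR).
Local Notation nE := (nE xL xR sigma).
Local Notation sample := (sample xL xR N).
Local Notation x_ := (grid xL xR N).
Let delta : R := N%:R `^ (- r).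
Let cr : R := decay_const mu r.

Let mu0 : 0 < mu.
Proof. by rewrite muE divr_gt0 ?mulr_gt0 ?pi_gt0 ?subr_gt0. Qed.
Let N0 : (0 < N)%N. Proof. by rewrite NE double_gt0. Qed.
Let N0' : (0 : R) < N%:R. Proof. by rewrite ltr0n. Qed.
Let delta_ge0 : 0 <= delta. Proof. exact: powR_ge0. Qed.
Let cr_ge0 : 0 <= cr. Proof. exact: powR_ge0. Qed.

(** Number of modes kept in the comparison function: its square is then free
    of aliasing on the grid. *)
Definition cutoff : nat := (N.-1 %/ 4).+1.

Let n0 := cutoff.
(** Number of modes of the square of a polynomial with n0 modes. *)
Let n1 : nat := (N.-1 %/ 4 + N.-1 %/ 4).+1.

Lemma cutoff_ge k : (cutoff <= k)%N = (N <= 4 * k)%N.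
Proof. by rewrite /cutoff ltn_divLR// prednK// mulnC. Qed.

Lemma square_cutoff_le : (n1 <= m)%N.
Proof.
rewrite /n1 -(@ltn_pmul2r 2)// [(m * 2)%N]muln2 -NE -[in ltnRHS](prednK N0) ltnS.
by rewrite addnn -muln2 -mulnA leq_divM.
Qed.

Lemma cutoff_le : (n0 <= n1)%N. Proof. by rewrite ltnS leq_addr. Qed.

Lemma grid_domain (j : 'I_N) : xL <= x_ j <= xR.
Proof.
have L0 : 0 < xR - xL by rewrite subr_gt0.
rewrite /grid lerDl mulr_ge0 ?divr_ge0 ?(ltW L0)//= mulrCA -lerBrDl.
rewrite ger_pMr// ler_pdivrMr// mul1r ler_nat ltnW//.
Qed.

Lemma omega_le k : omega k <= (1 + sigma) * h1_weight mu k.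
Proof.
rewrite /omega /h1_weight; have := sqr_ge0 (k%:R * mu); have := sigma0; nra.
Qed.

Lemma sum_omega_le f n : sobolev_bound (r + 1) f B ->
  \sum_(k < n) omega k * (fc f k ^+ 2 + fs f k ^+ 2) <= (1 + sigma) * B.
Proof.
move=> fB; apply: le_trans (ler_wpM2l _ (sum_h1_le r0 n fB)).
  rewrite mulr_sumr; apply: ler_sum => k _; rewrite mulrA ler_wpM2r ?omega_le//.
  by rewrite addr_ge0 ?sqr_ge0.
by rewrite addr_ge0// ltW.
Qed.

Lemma tail_omega_le f n : sobolev_bound (r + 1) f B ->
  \sum_(k < n | (cutoff <= k)%N) omega k * (fc f k ^+ 2 + fs f k ^+ 2) <=
  (1 + sigma) * (B * cr * delta ^+ 2).
Proof.
move=> fB; apply: le_trans (ler_wpM2l _ (tail_h1_le xLR muE r0 n N0 fB)).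
  rewrite mulr_sumr; under eq_bigl do rewrite cutoff_ge.
  apply: ler_sum => k _; rewrite mulrA ler_wpM2r ?omega_le//.
  by rewrite addr_ge0 ?sqr_ge0.
by rewrite addr_ge0// ltW.
Qed.

Definition energy_const : R := Num.sqrt (4 * ((1 + sigma) * B)).

Lemma nE_psum_le f : sobolev_bound (r + 1) f B ->
  nE (sample (psum f n0)) <= energy_const.
Proof.
move=> fB; apply: le_trans (nE_sample_le xLR muE sigma0 NE m0 _ _
  (leq_trans cutoff_le square_cutoff_le)) _.
rewrite ler_sqrt; last by rewrite mulr_ge0// mulr_ge0// addr_ge0// ltW.
apply: le_trans (ler_wpM2l _ (sum_omega_le n0 fB)) => //.
rewrite mulr_sumr; apply: ler_sum => k _.
have h2 : hw R k ^+ 2 <= 4.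
  have := hw_le2 R k; have := hw_gt0 R k; rewrite expr2; nra.
have -> : omega k * ((hw R k * fc f k) ^+ 2 + (hw R k * fs f k) ^+ 2) =
  hw R k ^+ 2 * (omega k * (fc f k ^+ 2 + fs f k ^+ 2)) by ring.
by rewrite ler_wpM2r// mulr_ge0 ?(omega_ge0 mu sigma0)// addr_ge0 ?sqr_ge0.
Qed.

Definition tail_const : R := Num.sqrt (64 * (B * cr) / mu ^+ 2).

Lemma psum_cutoff_le f x : continuous f -> xL <= x <= xR -> sobolev_bound (r + 1) f B ->
  `|f x - psum f n0 x| <= tail_const * (delta / Num.sqrt N%:R).
Proof.
move=> cf xOm fB.
apply: le_trans (psum_tail_le xLR muE cf xOm (ltn0Sn _)
  (X := B * cr * delta ^+ 2) _) _ => [n|].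
  by under eq_bigl do rewrite cutoff_ge; exact: tail_h1_le.
have -> : tail_const * (delta / Num.sqrt N%:R) =
    Num.sqrt (64 * (B * cr) / mu ^+ 2 * (delta ^+ 2 / N%:R)).
  rewrite sqrtrM; last by rewrite divr_ge0 ?sqr_ge0// !mulr_ge0.
  by rewrite [Num.sqrt (delta ^+ 2 / _)]sqrtrM ?sqr_ge0// sqrtrV ?ler0n// sqrtr_sqr ger0_norm.
rewrite ler_sqrt; last by rewrite mulr_ge0 ?divr_ge0 ?sqr_ge0// !mulr_ge0.
have n0' : (0 : R) < n0%:R by rewrite ltr0n.
have -> : 64 * (B * cr) / mu ^+ 2 * (delta ^+ 2 / N%:R) =
   16 * (B * cr * delta ^+ 2) / (mu ^+ 2 * (N%:R / 4)).
  by field; rewrite !gt_eqF.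
rewrite ler_wpM2l//; first by rewrite !mulr_ge0 ?sqr_ge0.
rewrite lef_pV2 ?posrE ?mulr_gt0 ?exprn_gt0 ?divr_gt0//.
rewrite ler_pM2l ?exprn_gt0// ler_pdivrMr// -natrM ler_nat mulnC.
by rewrite -cutoff_ge.
Qed.

(** The numerical flux of the truncated function is the exact derivative of its
    flux: the square of a trigonometric polynomial of degree at most (N-1)/4 has
    degree below N/2, so that D1 differentiates it without aliasing, and the
    split form collapses by the product rule. *)
Lemma LLF_D_psum f (G := fun x => a * psum f n0 x + gamma / 2 * psum f n0 x ^+ 2) :
  is_trig mu n1 G /\
  D (sample (psum f n0)) *m sample (psum f n0) = sample (derive1 (psum G n1)).
Proof.
set p := psum f n0; have pt : is_trig mu n0 p by eexists; eexists => x.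
have pM : is_trig mu n1 (fun x => p x * p x) by exact: is_trigM.
have Gt : is_trig mu n1 G.
  apply: eq_is_trig (is_trigD (is_trigZ a (is_trigW cutoff_le pt)) (is_trigZ (gamma / 2) pM)) => x.
  by rewrite /G expr2.
split=> //; have dp x := is_derive_trig mu (fun k => hw R k * fc f k) (fun k => hw R k * fs f k) n0 x.
rewrite -/(psum f n0) -/p in dp; set p' := trig _ _ _ _ in dp.
have GE : psum G n1 = G by apply/funext => x; rewrite -(psum_trig xLR muE Gt).
apply/colP => j; rewrite LLF_DE [RHS]mxE GE.
have D1p i : (D1 *m sample p) i 0 = p' (x_ i).
  rewrite (D1_sample xLR muE sigma0 NE m0); last exact: leq_trans cutoff_le square_cutoff_le.
  by rewrite derive1_trig.
have D1pp i : (D1 *m had (sample p) (sample p)) i 0 = 2 * p (x_ i) * p' (x_ i).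
  have [A' [B' pME]] := pM.
  have -> : had (sample p) (sample p) = sample (trig mu A' B' n1).
    by apply/colP => l; rewrite hadE !mxE -pME.
  rewrite (D1_sample xLR muE sigma0 NE m0 _ _ _ square_cutoff_le).
  have -> : trig mu A' B' n1 = p * p by apply/funext => x; rewrite -pME.
  rewrite derive1E; have h := dp (x_ i).
  have h2 : is_derive (x_ i) (1 : R) (p * p) (2 * p (x_ i) * p' (x_ i)).
    by apply: is_derive_eq; rewrite /GRing.scale/=; ring.
  exact: (@derive_val _ _ _ _ _ _ _ h2).
have dG : derive1 G (x_ j) = a * p' (x_ j) + gamma * p (x_ j) * p' (x_ j).
  rewrite derive1E; have h := dp (x_ j).
  have -> : G = a *: p + (gamma / 2) *: (p * p).
    by apply/funext => x; rewrite /G expr2.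
  have hM : is_derive (x_ j) (1 : R) (p * p) (2 * p (x_ j) * p' (x_ j)).
    by apply: is_derive_eq; rewrite /GRing.scale/=; ring.
  have h2 := is_deriveD (is_deriveZ a h) (is_deriveZ (gamma / 2) hM).
  rewrite (@derive_val _ _ _ _ _ _ _ h2) /GRing.scale/=; by field.
transitivity (a * p' (x_ j) + gamma / 3 * (p (x_ j) * p' (x_ j) + 2 * p (x_ j) * p' (x_ j))).
  rewrite mxE; congr (_ + _); rewrite mxE ?D1p//; congr (_ * _).
  by rewrite mxE hadE D1p D1pp mxE.
by rewrite dG; field.
Qed.

Definition flux_const : R := (a + gamma * coef_sum_const mu B) * tail_const.

Definition spatial_const : R :=
  Num.sqrt (16 * flux_const ^+ 2 / sigma + 8 * ((1 + sigma) * (B * cr))).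

(** The truncated solution satisfies the semi-discrete equation up to O(N^-r) in
    the dual of the energy norm.  In each mode k below 2(N-1)/4 + 1 the defect is
    k times a Fourier coefficient of the difference of the two fluxes, which is
    O(N^-1/2 N^-r) uniformly, plus for the discarded modes a coefficient of the
    time derivative. *)
Lemma spatial_residual_le f f' w : continuous f ->
  sobolev_bound (r + 1) f B -> sobolev_bound (r + 1) f' B ->
  (forall k, omega k * fc f' k + k%:R * mu * fs (fun x => a * f x + gamma / 2 * f x ^+ 2) k = 0 /\
     omega k * fs f' k - k%:R * mu * fc (fun x => a * f x + gamma / 2 * f x ^+ 2) k = 0) ->
  `|ip (A *m sample (psum f' n0) + D (sample (psum f n0)) *m sample (psum f n0)) w|
    <= spatial_const * delta * nE w.
Proof.
move=> cf fB fB' ode; set F := fun x => a * f x + _ in ode.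
have [Gt ->] := LLF_D_psum f; set G := fun x => a * psum f n0 x + _ in Gt *.
rewrite (opA_sample xLR muE sigma0 NE m0); last exact: leq_trans cutoff_le square_cutoff_le.
rewrite {1}/psum derive1_trig.
pose lo k : R := (k < n0)%N%:R.
have b1 : true%:R = 1 :> R by [].
have b0 : false%:R = 0 :> R by [].
have -> : sample (trig mu (fun k => omega k * (hw R k * fc f' k)) (fun k => omega k * (hw R k * fs f' k)) n0) +
   sample (trig mu (fun k => k%:R * mu * (hw R k * fs G k)) (fun k => - (k%:R * mu * (hw R k * fc G k))) n1) =
   sample (trig mu (fun k => hw R k * (k%:R * mu * (fs G k - fs F k) - (1 - lo k) * (omega k * fc f' k)))
     (fun k => - (hw R k * (k%:R * mu * (fc G k - fc F k) + (1 - lo k) * (omega k * fs f' k)))) n1).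
  apply/colP => j; rewrite !mxE (trig_widen _ _ _ _ cutoff_le) trigD.
  apply: eq_trig => k _; have [e1 e2] := ode k; rewrite /lo.
    have -> : k%:R * mu * (fs G k - fs F k) = k%:R * mu * fs G k + omega k * fc f' k.
      by rewrite mulrBr; move: e1 => /eqP; rewrite addrC addr_eq0 => /eqP ->; rewrite opprK.
    by case: (k < n0)%N; rewrite ?b1 ?b0; ring.
  have -> : k%:R * mu * (fc G k - fc F k) = k%:R * mu * fc G k - omega k * fs f' k.
    by rewrite mulrBr; move: e2 => /eqP; rewrite subr_eq0 => /eqP ->.
  by case: (k < n0)%N; rewrite ?b1 ?b0; ring.
apply: le_trans (ip_trig_le xLR muE sigma0 NE m0 _ _ _ (leqW square_cutoff_le)) _.
rewrite ler_wpM2r ?nE_ge0//.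
have S0 : 0 <= 16 * flux_const ^+ 2 / sigma + 8 * ((1 + sigma) * (B * cr)).
  apply: addr_ge0; first by apply: divr_ge0; [rewrite mulr_ge0// sqr_ge0|exact: ltW].
  by rewrite mulr_ge0// mulr_ge0// ?addr_ge0 ?mulr_ge0// ltW.
have -> : spatial_const * delta = Num.sqrt ((16 * flux_const ^+ 2 / sigma +
    8 * ((1 + sigma) * (B * cr))) * delta ^+ 2).
  by rewrite sqrtrM// sqrtr_sqr (ger0_norm delta_ge0).
rewrite ler_sqrt; last by rewrite mulr_ge0// sqr_ge0.
pose eta := flux_const * (delta / Num.sqrt N%:R).
have cp : continuous (psum f n0) by exact: continuous_psum.
have cflux (g : R -> R) : continuous g -> continuous (fun x => a * g x + gamma / 2 * g x ^+ 2 : R).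
  move=> cg; have c2 : continuous (fun x => g x ^+ 2 : R).
    have -> : (fun x => g x ^+ 2) = (fun x => g x * g x) by apply/funext.
    by move=> x; apply: cvgM; exact: cg.
  have cA : continuous (fun x => a * g x : R) by exact: (@continuousMc _ a g).
  have cB : continuous (fun x => gamma / 2 * g x ^+ 2 : R).
    exact: (@continuousMc _ (gamma / 2) (fun x => g x ^+ 2)).
  by move=> x; apply: cvgD; [exact: cA|exact: cB].
have FG x : xL <= x <= xR -> `|G x - F x| <= eta.
  move=> xOm; have fx := continuous_norm_le xLR muE r0 B0 cf xOm fB.
  have px := continuous_norm_le xLR muE r0 B0 cp xOm (sobolev_bound_psum xLR muE n0 fB).
  have d := psum_cutoff_le cf xOm fB.
  have -> : G x - F x = - ((f x - psum f n0 x) * (a + gamma / 2 * (f x + psum f n0 x))).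
    by rewrite /G /F; ring.
  rewrite normrN normrM /eta /flux_const -[leRHS]mulrA [leLHS]mulrC ler_pM//.
  apply: le_trans (ler_normD _ _) _; rewrite (ger0_norm (ltW a0)) lerD2l normrM.
  rewrite (ger0_norm (_ : 0 <= gamma / 2)) ?divr_ge0 ?(ltW gamma0)//.
  rewrite -mulrA ler_wpM2l ?(ltW gamma0)// ler_pdivrMl//.
  by apply: le_trans (ler_normD _ _) _; rewrite mulr_natl mulr2n lerD.
have iG := itg_cont xL xR (cflux _ cp); have iF := itg_cont xL xR (cflux _ cf).
have coefs k : `|fs G k - fs F k| <= eta /\ `|fc G k - fc F k| <= eta.
  have [h1 h2] := coef_le mu xLR k (itgB iG iF) FG.
  by rewrite -fsB// -fcB.
apply: le_trans (_ : \sum_(k < n1) (8 * (2 * eta ^+ 2 / sigma) +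
   8 * (if (cutoff <= k)%N then omega k * (fc f' k ^+ 2 + fs f' k ^+ 2) else 0)) <= _).
  apply: ler_sum => k _; have [c1 c2] := coefs k.
  have om0 := omega_gt0 mu sigma0 k.
  have loE : 1 - lo k = (cutoff <= k)%N%:R by rewrite /lo ltnNge; case: (cutoff <= k)%N; rewrite /= ?subr0 ?subrr.
  have sq z : `|z| <= eta -> z ^+ 2 <= eta ^+ 2.
    by move=> h; rewrite -(real_normK (num_real z)) lerXn2r ?nnegrE// (le_trans _ h).
  have h2 : hw R k ^+ 2 <= 4.
    have := hw_le2 R k; have := hw_gt0 R k; rewrite expr2; nra.
  have kom : (k%:R * mu) ^+ 2 / omega k <= sigma^-1.
    rewrite ler_pdivrMr// /omega mulrDr mulr1 mulKf ?gt_eqF// lerDr invr_ge0 ltW//.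
  have s1 := sq _ c1; have s2 := sq _ c2.
  set y1 := fs G k - fs F k in s1 *; set y2 := fc G k - fc F k in s2 *.
  set b := (cutoff <= k)%N in loE *.
  have b2 : (b%:R : R) ^+ 2 = b%:R by case: (b); rewrite ?expr1n ?expr0n.
  rewrite loE.
  have -> : (if b then omega k * (fc f' k ^+ 2 + fs f' k ^+ 2) else 0) =
     b%:R * omega k * (fc f' k ^+ 2 + fs f' k ^+ 2) by case: (b); rewrite ?mul1r ?mul0r.
  set z1 := fc f' k; set z2 := fs f' k.
  have -> : ((hw R k * (k%:R * mu * y1 - b%:R * (omega k * z1))) ^+ 2 +
     (- (hw R k * (k%:R * mu * y2 + b%:R * (omega k * z2)))) ^+ 2) / omega k =
     hw R k ^+ 2 * (((k%:R * mu * y1 - b%:R * (omega k * z1)) ^+ 2 +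
      (k%:R * mu * y2 + b%:R * (omega k * z2)) ^+ 2) / omega k) by ring.
  apply: le_trans (ler_wpM2r _ h2) _.
    by rewrite divr_ge0 ?(ltW om0)// addr_ge0 ?sqr_ge0.
  have q (s t : R) : (s - t) ^+ 2 <= 2 * s ^+ 2 + 2 * t ^+ 2.
    by have := sqr_ge0 (s + t); rewrite !expr2; lra.
  have q1 := q (k%:R * mu * y1) (b%:R * (omega k * z1)).
  have q2 := q (k%:R * mu * y2) (- (b%:R * (omega k * z2))).
  rewrite opprK sqrrN in q2.
  apply: le_trans (_ : 4 * ((2 * ((k%:R * mu) ^+ 2 * (y1 ^+ 2 + y2 ^+ 2)) +
     2 * (b%:R * omega k ^+ 2 * (z1 ^+ 2 + z2 ^+ 2))) / omega k) <= _).
    rewrite ler_wpM2l// ler_wpM2r ?invr_ge0 ?(ltW om0)//.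
    move: q1 q2; rewrite !exprMn b2; lra.
  have -> : 4 * ((2 * ((k%:R * mu) ^+ 2 * (y1 ^+ 2 + y2 ^+ 2)) +
     2 * (b%:R * omega k ^+ 2 * (z1 ^+ 2 + z2 ^+ 2))) / omega k) =
     8 * ((k%:R * mu) ^+ 2 / omega k * (y1 ^+ 2 + y2 ^+ 2)) +
     8 * (b%:R * omega k * (z1 ^+ 2 + z2 ^+ 2)) by field; rewrite gt_eqF.
  rewrite lerD2r ler_wpM2l//.
  have -> : 2 * eta ^+ 2 / sigma = sigma^-1 * (eta ^+ 2 + eta ^+ 2) by ring.
  by apply: ler_pM; rewrite ?(divr_ge0 (sqr_ge0 _) (ltW om0)) ?addr_ge0 ?sqr_ge0 ?lerD.
rewrite big_split/= sumr_const card_ord -mulr_sumr -big_mkcond/= [leRHS]mulrDl lerD//.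
  have -> : 8 * (2 * eta ^+ 2 / sigma) *+ n1 = 16 * flux_const ^+ 2 / sigma * delta ^+ 2 * (n1%:R / N%:R).
    have -> : eta ^+ 2 = flux_const ^+ 2 * (delta ^+ 2 / N%:R).
      rewrite /eta; move: flux_const => c.
      by rewrite exprMn [(delta / _) ^+ 2]exprMn exprVn sqr_sqrtr ?ler0n.
    by rewrite -[_ *+ n1]mulr_natr; field; rewrite !gt_eqF.
  rewrite ler_piMr//.
    apply: mulr_ge0; last exact: sqr_ge0.
    by apply: divr_ge0; [rewrite mulr_ge0// sqr_ge0|exact: ltW].
  rewrite ler_pdivrMr// mul1r ler_nat (leq_trans square_cutoff_le)//.
  by rewrite NE -addnn leq_addr.
rewrite -mulrA ler_wpM2l// -mulrA; exact: tail_omega_le.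
Qed.

Lemma n2_sample_le (g : R -> R) c : 0 <= c -> (forall j : 'I_N, `|g (x_ j)| <= c) ->
  n2 (sample g) <= c.
Proof.
move=> c0 gc; rewrite -(ger0_norm c0) -sqrtr_sqr /n2 ler_sqrt ?sqr_ge0//.
rewrite /ip ler_pdivrMl//; apply: le_trans (_ : \sum_(j < N) c ^+ 2 <= _).
  apply: ler_sum => j _; rewrite mxE -expr2 -(real_normK (num_real (g _))).
  by rewrite lerXn2r ?nnegrE.
by rewrite sumr_const card_ord mulr_natl.
Qed.

Definition initial_const : R :=
  Num.sqrt (1 + sigma * mu ^+ 2) * (Num.sqrt (288 * (B * cr) / mu ^+ 2) + 1).

(** The interpolation error in the energy norm, by an inverse inequality: the
    modes lost by the truncation are aliased to low frequencies and of size
    O(N^-1 N^-r) in the discrete L2 norm. *)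
Lemma initial_error_le f : continuous f -> sobolev_bound (r + 1) f B ->
  nE (sample (psum f n0) - sample f) <= initial_const * delta.
Proof.
move=> cf fB.
have delta0 : 0 < delta by rewrite powR_gt0.
pose e := delta / N%:R; have e0 : 0 < e by rewrite divr_gt0.
pose b := 16 * B / (mu ^+ 2 * e ^+ 2).
have b0 : 0 <= b by rewrite divr_ge0 ?mulr_ge0 ?exprn_ge0 ?(ltW mu0) ?(ltW e0).
pose n := maxn n0 (Num.bound b).
have n0n : (n0 <= n)%N by rewrite leq_maxl.
have npos : (0 < n)%N by apply: leq_trans n0n.
have bn : b <= n%:R.
  by apply: le_trans (ltW (archi_boundP b0)) _; rewrite ler_nat leq_maxr.
have far x : xL <= x <= xR -> `|f x - psum f n x| <= e.
  move=> xOm; apply: le_trans (psum_tail_le xLR muE cf xOm npos (X := B) _) _.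
    move=> j; apply: le_trans (sum_h1_le r0 j fB); rewrite big_mkcond.
    by apply: ler_sum => k _; case: ifP => // _; exact: h1_term_ge0.
  rewrite -[leRHS](gtr0_norm e0) -sqrtr_sqr ler_sqrt ?sqr_ge0//.
  have np' : (0 : R) < n%:R by rewrite ltr0n.
  rewrite ler_pdivrMr ?mulr_gt0 ?exprn_gt0//.
  have -> : e ^+ 2 * (mu ^+ 2 * n%:R) = n%:R * (mu ^+ 2 * e ^+ 2) by ring.
  by rewrite -ler_pdivrMr// mulr_gt0 ?exprn_gt0.
pose hi k : R := (cutoff <= k)%N%:R.
pose v := sample (trig mu (fun k => hi k * (hw R k * fc f k)) (fun k => hi k * (hw R k * fs f k)) n).
have eE : sample (psum f n0) - sample f = - (v + sample (fun x => f x - psum f n x)).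
  apply/colP => j; rewrite !mxE.
  have -> : psum f n0 (x_ j) = psum f n (x_ j) - trig mu (fun k => hi k * (hw R k * fc f k))
     (fun k => hi k * (hw R k * fs f k)) n (x_ j).
    rewrite -mulN1r trigZ /psum (trig_widen _ _ _ _ n0n) trigD.
    have b1 : true%:R = 1 :> R by [].
    have b0' : false%:R = 0 :> R by [].
    by apply: eq_trig => k _; rewrite /hi ltnNge -/cutoff -/n0; case: (n0 <= k)%N; rewrite ?b1 ?b0' /=; ring.
  by ring.
have h2 k : hw R k ^+ 2 <= 4.
  have := hw_le2 R k; have := hw_gt0 R k; rewrite expr2; nra.
have X0 : 0 <= 288 * (B * cr) / mu ^+ 2.
  exact: divr_ge0 (mulr_ge0 (ler0n _ _) (mulr_ge0 B0 cr_ge0)) (sqr_ge0 _).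
have n2v : n2 v <= Num.sqrt (288 * (B * cr) / mu ^+ 2) * e.
  rewrite -[X in _ * X](gtr0_norm e0) -sqrtr_sqr -sqrtrM//.
  rewrite /n2 ler_sqrt; last exact: mulr_ge0 X0 (sqr_ge0 _).
  apply: le_trans (ip_alias_le xLR muE sigma0 NE m0 n _) _.
    by move=> k; rewrite ltnNge -cutoff_ge /hi => /negbTE ->; rewrite !mul0r.
  have -> : 288 * (B * cr) / mu ^+ 2 * e ^+ 2 =
    72 / N%:R ^+ 2 * (4 / mu ^+ 2 * (B * cr * delta ^+ 2)).
    by rewrite /e; field; rewrite !gt_eqF.
  rewrite ler_wpM2l ?divr_ge0 ?sqr_ge0//.
  apply: le_trans (ler_wpM2l _ (tail_h1_le xLR muE r0 n N0 fB)); last first.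
    by rewrite divr_ge0 ?sqr_ge0.
  rewrite mulr_sumr [leRHS]big_mkcond; apply: ler_sum => k _.
  rewrite -cutoff_ge /hi; case: (cutoff <= k)%N; last first.
    by rewrite !mul0r expr0n/= addr0 mulr0.
  rewrite !mul1r /h1_term.
  have -> : k%:R ^+ 2 * ((hw R k * fc f k) ^+ 2 + (hw R k * fs f k) ^+ 2) =
    (hw R k ^+ 2 * k%:R ^+ 2) * (fc f k ^+ 2 + fs f k ^+ 2) by ring.
  rewrite [leRHS]mulrA ler_wpM2r ?addr_ge0 ?sqr_ge0//.
  apply: le_trans (ler_wpM2r (sqr_ge0 _) (h2 k)) _.
  have -> : 4 * k%:R ^+ 2 = 4 / mu ^+ 2 * (k%:R * mu) ^+ 2 by field; rewrite gt_eqF.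
  by rewrite ler_wpM2l ?divr_ge0 ?sqr_ge0// lerDr.
have n2e : n2 (sample (psum f n0) - sample f) <= (Num.sqrt (288 * (B * cr) / mu ^+ 2) + 1) * e.
  rewrite eE.
  have -> : n2 (- (v + sample (fun x => f x - psum f n x))) = n2 (v + sample (fun x => f x - psum f n x)).
    by rewrite /n2 ipNl ipC ipNl opprK.
  apply: le_trans (n2D xLR muE sigma0 NE m0 _ _) _; rewrite mulrDl mul1r lerD//.
  by apply: n2_sample_le => [|j]; [exact: ltW|apply: far; exact: grid_domain].
apply: le_trans (nE_le_n2 xLR muE sigma0 NE m0 _) _.
have som : Num.sqrt (omega m) <= Num.sqrt (1 + sigma * mu ^+ 2) * N%:R.
  have s0 : 0 <= 1 + sigma * mu ^+ 2 by rewrite addr_ge0// mulr_ge0 ?sqr_ge0// ltW.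
  rewrite -[X in _ * X](gtr0_norm N0') -sqrtr_sqr -sqrtrM// ler_sqrt; last first.
    by rewrite mulr_ge0 ?sqr_ge0.
  rewrite /omega mulrDl mul1r lerD//.
    by rewrite expr_ge1// ler1n.
  rewrite -mulrA ler_wpM2l ?(ltW sigma0)// exprMn mulrC ler_wpM2l ?sqr_ge0//.
  by rewrite lerXn2r ?nnegrE// ler_nat NE -addnn leq_addr.
rewrite /initial_const.
have -> : Num.sqrt (1 + sigma * mu ^+ 2) * (Num.sqrt (288 * (B * cr) / mu ^+ 2) + 1) * delta =
  Num.sqrt (1 + sigma * mu ^+ 2) * N%:R * ((Num.sqrt (288 * (B * cr) / mu ^+ 2) + 1) * e).
  by rewrite /e; field; rewrite gt_eqF.
by apply: ler_pM; rewrite ?sqrtr_ge0.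
Qed.

(** * Consistency in time *)

Variables (T : R) (w : nat -> R -> R -> R).
Hypothesis T0 : 0 < T.
Hypothesis wB : forall i t, (i <= 3)%N -> 0 <= t <= T -> sobolev_bound (r + 1) (w i t) B.
Hypothesis wd : forall i t k, (i < 3)%N -> 0 <= t <= T ->
  deriv_within T (fun t => fc (w i t) k) t (fc (w i.+1 t) k) /\
  deriv_within T (fun t => fs (w i t) k) t (fs (w i.+1 t) k).

Let M := energy_const.
Let M0 : 0 <= M. Proof. exact: sqrtr_ge0. Qed.

Definition comparison i t : 'cV[R]_N := sample (psum (w i t) n0).

Lemma comparison_le i t : (i <= 3)%N -> 0 <= t <= T -> nE (comparison i t) <= M.
Proof. by move=> i3 tT; apply: nE_psum_le; exact: wB. Qed.

(** Only the scalars obtained by pairing are differentiated. *)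
Lemma ip_comparison_deriv i t (y : 'cV[R]_N) : (i < 3)%N -> 0 <= t <= T ->
  deriv_within T (fun s => ip (A *m comparison i s) y) t (ip (A *m comparison i.+1 t) y).
Proof.
move=> i3 tT.
have E j s : ip (A *m comparison j s) y =
   \sum_(k < n0) (N%:R^-1 * (hw R k * dcos xL xR mu (A *m y) k)) * fc (w j s) k -
   \sum_(k < n0) (- (N%:R^-1 * (hw R k * dsin xL xR mu (A *m y) k))) * fs (w j s) k.
  rewrite (ip_opA_sym xLR muE sigma0 NE m0) ipC.
  rewrite (@ip_trig _ xL xR mu _ _ _ (fun k => hw R k * fc (w j s) k) (fun k => hw R k * fs (w j s) k) n0); last first.
    by move=> l; rewrite mxE.
  rewrite mulr_sumr -sumrB; apply: eq_bigr => k _; ring.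
rewrite E (funext (E i)).
apply: deriv_withinB.
  apply: (@deriv_within_lin R T n0 (fun k => N%:R^-1 * (hw R k * dcos xL xR mu (A *m y) k))
    (fun k s => fc (w i s) k) (fun k s => fc (w i.+1 s) k)) => k.
  by have [] := wd k i3 tT.
apply: (@deriv_within_lin R T n0 (fun k => - (N%:R^-1 * (hw R k * dsin xL xR mu (A *m y) k)))
  (fun k s => fs (w i s) k) (fun k s => fs (w i.+1 s) k)) => k.
by have [] := wd k i3 tT.
Qed.

(** Duality: the scalar estimate for the pairing with the error x itself reads
    nE x ^+ 2 <= M * nE x * h ^+ 2. *)
Lemma comparison_difference t h : 0 < h -> 0 <= t - h -> t + h <= T ->
  nE ((2 * h)^-1 *: (comparison 0 (t + h) - comparison 0 (t - h)) - comparison 1 t)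
    <= M * h ^+ 2.
Proof.
move=> h0 tm tp; set x := _ - comparison 1 t.
have := @central_difference R T (fun s => ip (A *m comparison 0 s) x)
  (fun s => ip (A *m comparison 1 s) x) (fun s => ip (A *m comparison 2 s) x)
  (fun s => ip (A *m comparison 3 s) x) (M * nE x)
  (mulr_ge0 M0 (nE_ge0 _ _ _ _))
  (fun s h => @ip_comparison_deriv 0 s x isT h)
  (fun s h => @ip_comparison_deriv 1 s x isT h)
  (fun s h => @ip_comparison_deriv 2 s x isT h) _ t h h0 tm tp.
have -> : (2 * h)^-1 * (ip (A *m comparison 0 (t + h)) x - ip (A *m comparison 0 (t - h)) x) -
    ip (A *m comparison 1 t) x = nE x ^+ 2.
  rewrite (nE_sqr xLR muE sigma0 NE m0) {3}/x mulmxBr -scalemxAr mulmxBr.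
  by rewrite ipBl ipZl ipBl.
rewrite (ger0_norm (sqr_ge0 _)) => hx.
have {hx} : nE x ^+ 2 <= M * nE x * h ^+ 2.
  apply: hx => s sT; apply: le_trans (ipE_le xLR muE sigma0 NE m0 _ _) _.
  by rewrite ler_wpM2r ?nE_ge0// comparison_le.
rewrite mulrAC expr2; have [->|x0] := eqVneq (nE x) 0.
  by move=> _; rewrite mulr_ge0 ?sqr_ge0.
by rewrite ler_pM2r// lt_neqAle eq_sym x0 nE_ge0.
Qed.

Lemma comparison_average t h : 0 < h -> 0 <= t - h -> t + h <= T ->
  nE (2^-1 *: (comparison 0 (t + h) + comparison 0 (t - h)) - comparison 0 t)
    <= M * h ^+ 2.
Proof.
move=> h0 tm tp; set x := _ - comparison 0 t.
have := @central_average R T (fun s => ip (A *m comparison 0 s) x)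
  (fun s => ip (A *m comparison 1 s) x) (fun s => ip (A *m comparison 2 s) x)
  (M * nE x) (mulr_ge0 M0 (nE_ge0 _ _ _ _))
  (fun s h => @ip_comparison_deriv 0 s x isT h)
  (fun s h => @ip_comparison_deriv 1 s x isT h) _ t h h0 tm tp.
have -> : 2^-1 * (ip (A *m comparison 0 (t + h)) x + ip (A *m comparison 0 (t - h)) x) -
    ip (A *m comparison 0 t) x = nE x ^+ 2.
  rewrite (nE_sqr xLR muE sigma0 NE m0) {4}/x mulmxBr -scalemxAr mulmxDr.
  by rewrite ipBl ipZl ipDl.
rewrite (ger0_norm (sqr_ge0 _)) => hx.
have {hx} : nE x ^+ 2 <= M * nE x * h ^+ 2.
  apply: hx => s sT; apply: le_trans (ipE_le xLR muE sigma0 NE m0 _ _) _.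
  by rewrite ler_wpM2r ?nE_ge0// comparison_le.
rewrite mulrAC expr2; have [->|x0] := eqVneq (nE x) 0.
  by move=> _; rewrite mulr_ge0 ?sqr_ge0.
by rewrite ler_pM2r// lt_neqAle eq_sym x0 nE_ge0.
Qed.

Let Ks : R := Kstab sigma gamma mu M.
Let s1 : R := (Num.sqrt sigma)^-1.
Let s1_ge0 : 0 <= s1. Proof. by rewrite invr_ge0 sqrtr_ge0. Qed.
Let Ks_ge0 : 0 <= Ks. Proof. exact: Kstab_ge0. Qed.

Lemma LLF_D_le (P v y : 'cV[R]_N) : nE P <= M ->
  `|ip (D P *m v) y| <= (a * s1 + Ks) * nE v * nE y.
Proof.
move=> PM; rewrite LLF_DE ipDl !ipZl ipDl -/(trilin xL xR P v y).
have g0 : 0 <= gamma / 3 by rewrite divr_ge0// ltW.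
apply: le_trans (ler_normD _ _) _; rewrite [`|a * _|]normrM [`|gamma / 3 * _|]normrM.
rewrite (ger0_norm (ltW a0)) (ger0_norm g0).
have h1 : `|ip (D1 *m v) y| <= s1 * nE v * nE y.
  apply: le_trans (ip_D1_le xLR muE sigma0 NE m0 _ _) _.
  rewrite ler_wpM2l ?(n2_le_nE xLR muE sigma0 NE m0)//.
  by rewrite mulr_ge0 ?nE_ge0.
have h2 := trilin_le xLR muE sigma0 NE m0 P y (lexx (nE v)).
have C0 : 0 <= 2 * sup_const mu sigma * s1 * nE v * nE y.
  by rewrite !mulr_ge0 ?nE_ge0 ?sqrtr_ge0.
have h3 : `|trilin xL xR P v y| <= 2 * sup_const mu sigma * s1 * nE v * nE y * M.
  apply: le_trans h2 _; rewrite -/s1.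
  have -> : 2 * sup_const mu sigma * s1 * nE v * nE P * nE y =
     2 * sup_const mu sigma * s1 * nE v * nE y * nE P by ring.
  by rewrite ler_wpM2l.
have -> : (a * s1 + Ks) * nE v * nE y = a * (s1 * nE v * nE y) +
   gamma / 3 * (2 * sup_const mu sigma * s1 * nE v * nE y * M).
  by rewrite /Ks /Kstab -/s1; ring.
by rewrite lerD// ler_wpM2l// ltW.
Qed.

Definition time_const : R := M + (a * s1 + Ks) * M + Ks * M.

Hypothesis wc : forall t, 0 <= t <= T -> continuous (w 0 t).
Hypothesis w_ode : forall t k, 0 <= t <= T ->
  omega k * fc (w 1 t) k + k%:R * mu * fs (fun x => a * w 0 t x + gamma / 2 * w 0 t x ^+ 2) k = 0 /\
  omega k * fs (w 1 t) k - k%:R * mu * fc (fun x => a * w 0 t x + gamma / 2 * w 0 t x ^+ 2) k = 0.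

(** P stands for the argument of D in the scheme: the comparison function itself
    for n >= 1, and the average of its first two values in the first step, which
    is centered at tau / 2 with half the step. *)
Lemma residual_le t h (P y : 'cV[R]_N) : 0 < h -> 0 <= t - h -> t + h <= T ->
  nE P <= M -> nE (P - comparison 0 t) <= M * h ^+ 2 ->
  `|ip (A *m ((2 * h)^-1 *: (comparison 0 (t + h) - comparison 0 (t - h))) +
        D P *m (2^-1 *: (comparison 0 (t + h) + comparison 0 (t - h)))) y| <=
  (time_const * h ^+ 2 + spatial_const * delta) * nE y.
Proof.
move=> h0 tm tp PM Pt; have tT : 0 <= t <= T by apply/andP; split; lra.
set d := _ *: (_ - _); set av := _ *: (_ + _).
set p := comparison 0 t; set p1 := comparison 1 t; rewrite -/p in Pt.
have -> : A *m d + D P *m av = A *m (d - p1) + D P *m (av - p) +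
    (gamma / 3) *: (had (P - p) (D1 *m p) + D1 *m had (P - p) p) + (A *m p1 + D p *m p).
  rewrite !mulmxBr.
  have -> : (gamma / 3) *: (had (P - p) (D1 *m p) + D1 *m had (P - p) p) = D P *m p - D p *m p.
    rewrite !LLF_DE !hadBl mulmxBr.
    by apply/colP => j; rewrite !mxE; ring.
  move: (A *m d) (A *m p1) (D P *m av) (D P *m p) (D p *m p) => x1 x2 x3 x4 x5.
  by apply/colP => j; rewrite !mxE; ring.
rewrite 3!ipDl ipZl ipDl -/(trilin xL xR (P - p) p y).
have e1 := comparison_difference h0 tm tp; rewrite -/d -/p1 in e1.
have e2 := comparison_average h0 tm tp; rewrite -/av -/p in e2.
have y0 := nE_ge0 xL xR sigma y.
have g0 : 0 <= gamma / 3 by rewrite divr_ge0// ltW.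
have t1 : `|ip (A *m (d - p1)) y| <= M * h ^+ 2 * nE y.
  exact: le_trans (ipE_le xLR muE sigma0 NE m0 _ _) (ler_wpM2r y0 e1).
have t2 : `|ip (D P *m (av - p)) y| <= (a * s1 + Ks) * (M * h ^+ 2) * nE y.
  apply: le_trans (LLF_D_le _ _ PM) _; rewrite ler_wpM2r// ler_wpM2l//.
  by rewrite addr_ge0// mulr_ge0// ltW.
have t3 : `|gamma / 3 * trilin xL xR (P - p) p y| <= Ks * (M * h ^+ 2) * nE y.
  have pM : nE p <= M by exact: comparison_le.
  rewrite normrM (ger0_norm g0).
  have h3 := trilin_le xLR muE sigma0 NE m0 (P - p) y pM.
  apply: le_trans (ler_wpM2l g0 h3) _; rewrite -/s1.
  have -> : gamma / 3 * (2 * sup_const mu sigma * s1 * M * nE (P - p) * nE y) =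
     Ks * nE (P - p) * nE y by rewrite /Ks /Kstab -/s1; ring.
  by apply: (ler_wpM2r y0); apply: (ler_wpM2l Ks_ge0).
have t4 : `|ip (A *m p1 + D p *m p) y| <= spatial_const * delta * nE y.
  apply: spatial_residual_le; [exact: wc|exact: wB|exact: wB|].
  by move=> k; exact: w_ode.
apply: le_trans (ler_normD _ _) _; rewrite mulrDl lerD//.
apply: le_trans (ler_normD _ _) _.
have -> : time_const * h ^+ 2 * nE y = M * h ^+ 2 * nE y + (a * s1 + Ks) * (M * h ^+ 2) * nE y +
   Ks * (M * h ^+ 2) * nE y by rewrite /time_const; ring.
rewrite lerD//; apply: le_trans (ler_normD _ _) _; exact: lerD.
Qed.

(** N enters none of the ingredients: the bound is uniform in the grid. *)
Definition convergence_const : R := tail_const + sup_const mu sigma *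
  ((3 * initial_const + 4 * T * (time_const + spatial_const) + 2 * M * Ks ^+ 2) *
   expR (2 * T * Ks)).

Let time_const_ge0 : 0 <= time_const.
Proof.
have h : 0 <= a * s1 + Ks := addr_ge0 (mulr_ge0 (ltW a0) s1_ge0) Ks_ge0.
exact: addr_ge0 (addr_ge0 M0 (mulr_ge0 h M0)) (mulr_ge0 Ks_ge0 M0).
Qed.
Let spatial_const_ge0 : 0 <= spatial_const. Proof. exact: sqrtr_ge0. Qed.
Let initial_const_ge0 : 0 <= initial_const.
Proof. exact: mulr_ge0 (sqrtr_ge0 _) (addr_ge0 (sqrtr_ge0 _) ler01). Qed.

Lemma convergence_const_ge0 : 0 <= convergence_const.
Proof.
apply: addr_ge0; first exact: sqrtr_ge0.
apply: mulr_ge0; first exact: sqrtr_ge0.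
apply: mulr_ge0 (expR_ge0 _).
apply: addr_ge0; last exact: mulr_ge0 (mulr_ge0 (ler0n _ 2) M0) (sqr_ge0 _).
apply: addr_ge0; first exact: mulr_ge0.
exact: mulr_ge0 (mulr_ge0 (ler0n _ 4) (ltW T0)) (addr_ge0 time_const_ge0 spatial_const_ge0).
Qed.

(** The truncation error of u, plus the error of the scheme with respect to the
    truncated solution. *)
Theorem convergence (Nt : nat) (U : nat -> 'cV[R]_N) (tau := T / Nt%:R) :
  (0 < Nt)%N ->
  LLF_MP_scheme a sigma gamma xL xR tau Nt U ->
  (forall j : 'I_N, U 0%N j 0 = w 0 0 (x_ j)) ->
  forall (n : nat) (j : 'I_N), (n <= Nt)%N ->
    `|w 0 (n%:R * tau) (x_ j) - U n j 0| <= convergence_const * (tau ^+ 2 + delta).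
Proof.
move=> Nt0 sch U0 n j nNt; have Nt0' : (0 : R) < Nt%:R by rewrite ltr0n.
have tau0 : 0 < tau by rewrite divr_gt0.
have NtT : Nt%:R * tau = T by rewrite /tau mulrC divfK ?gt_eqF.
have tn k : (k <= Nt)%N -> 0 <= k%:R * tau <= T.
  by move=> kN; rewrite mulr_ge0 ?(ltW tau0)//= -NtT ler_wpM2r ?(ltW tau0)// ler_nat.
pose p k := comparison 0 (k%:R * tau).
pose Rs := time_const * tau ^+ 2 + spatial_const * delta.
have Rs0 : 0 <= Rs by rewrite addr_ge0// mulr_ge0// sqr_ge0.
have pM k : (k <= Nt)%N -> nE (p k) <= M by move=> kN; apply: comparison_le => //; exact: tn.
have res k y : (1 <= k < Nt)%N ->
    `|ip (A *m ((2 * tau)^-1 *: (p k.+1 - p k.-1)) +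
          D (p k) *m (2^-1 *: (p k.+1 + p k.-1))) y| <= Rs * nE y.
  case: k => [//|k] /= kN.
  have eS : k.+2%:R * tau = k.+1%:R * tau + tau by rewrite -[k.+2%:R]natr1 mulrDl mul1r.
  have eP : k%:R * tau = k.+1%:R * tau - tau by rewrite -[k.+1%:R]natr1 mulrDl mul1r addrK.
  have := @residual_le (k.+1%:R * tau) tau (p k.+1) y tau0; rewrite -eS -eP; apply.
  - by have /andP[] := tn k (ltnW (ltnW kN)).
  - by have /andP[] := tn k.+2 kN.
  - exact/pM/ltnW.
  rewrite subrr /p; have -> : nE (0 : 'cV[R]_N) = 0 by exact: nE0.
  by rewrite mulr_ge0 ?sqr_ge0.
have res0 y : `|ip (A *m (tau^-1 *: (p 1%N - p 0%N)) +
          D (2^-1 *: (p 1%N + p 0%N)) *m (2^-1 *: (p 1%N + p 0%N))) y| <= Rs * nE y.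
  (* The first step is a central difference around tau / 2. *)
  pose h := tau / 2; have h0 : 0 < h by rewrite divr_gt0.
  have e1 : h + h = 1%:R * tau by rewrite /h; field.
  have e0 : h - h = 0%:R * tau by rewrite subrr mul0r.
  have eh : 2 * h = tau by rewrite /h; field.
  have hp : h + h <= T by rewrite e1; have /andP[] := tn 1%N Nt0.
  have hm : 0 <= h - h by rewrite subrr.
  have av := comparison_average h0 hm hp; rewrite e1 e0 in av.
  have PM : nE (2^-1 *: (p 1%N + p 0%N)) <= M.
    rewrite nEZ ger0_norm ?invr_ge0//.
    have := nED xLR muE sigma0 NE m0 (p 1%N) (p 0%N).
    have := pM 1%N Nt0; have := pM 0%N (leq0n _); lra.
  have := @residual_le h h (2^-1 *: (p 1%N + p 0%N)) y h0 hm hp PM av.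
  rewrite e1 e0 eh => /le_trans; apply.
  rewrite ler_wpM2r ?nE_ge0// lerD2r ler_wpM2l//.
  by apply: lerXn2r; rewrite ?nnegrE ?(ltW h0) ?(ltW tau0)// -eh; lra.
have main := scheme_stability xLR muE sigma0 gamma0 NE m0 tau0 M0 Rs0 Nt0 sch pM res res0 nNt.
rewrite NtT -/Ks in main.
have err0 : nE (p 0%N - U 0%N) <= initial_const * delta.
  have tT0 : 0 <= (0 : R) <= T by rewrite lexx ltW.
  have -> : U 0%N = sample (w 0 0).
    by apply/colP => i; rewrite mxE U0.
  rewrite /p mul0r; apply: initial_error_le; [exact: wc|exact: wB].
have tauT : tau <= T by rewrite /tau ler_pdivrMr// ler_peMr ?ler1n// ltW.
have t2 : 0 <= tau ^+ 2 by rewrite sqr_ge0.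
have RsE : Rs <= (time_const + spatial_const) * (tau ^+ 2 + delta).
  have := mulr_ge0 time_const_ge0 delta_ge0; have := mulr_ge0 spatial_const_ge0 t2.
  rewrite /Rs; lra.
have sE : nE (p n - U n) <=
    (3 * initial_const + 4 * T * (time_const + spatial_const) + 2 * M * Ks ^+ 2) *
    expR (2 * T * Ks) * (tau ^+ 2 + delta).
  apply: le_trans main _; rewrite [leRHS]mulrAC ler_wpM2r ?expR_ge0//.
  have i1 : nE (p 0%N - U 0%N) <= initial_const * (tau ^+ 2 + delta).
    by apply: le_trans err0 _; rewrite ler_wpM2l// lerDr.
  have i2 : tau * Rs <= T * ((time_const + spatial_const) * (tau ^+ 2 + delta)).
    by rewrite ler_pM// ltW.
  have i3 : T * Rs <= T * ((time_const + spatial_const) * (tau ^+ 2 + delta)).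
    by rewrite ler_wpM2l// ltW.
  have i4 : 2 * M * (Ks * tau) ^+ 2 <= 2 * M * Ks ^+ 2 * (tau ^+ 2 + delta).
    rewrite exprMn mulrA ler_wpM2l ?lerDl//.
    by apply: mulr_ge0; [rewrite mulr_ge0|exact: sqr_ge0].
  lra.
have tnT := tn n nNt; have xOm := grid_domain j.
have wpj : `|w 0 (n%:R * tau) (x_ j) - psum (w 0 (n%:R * tau)) n0 (x_ j)| <=
    tail_const * (tau ^+ 2 + delta).
  have tc0 : 0 <= tail_const by exact: sqrtr_ge0.
  apply: le_trans (psum_cutoff_le (wc tnT) xOm (wB _ tnT)) _ => //.
  rewrite ler_wpM2l//; apply: le_trans (_ : delta <= _); last by rewrite lerDr.
  by rewrite ler_pdivrMr ?sqrtr_gt0// ler_peMr// -[leLHS]sqrtr1 ler_wsqrtr// (ler_nat R 1).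
have ej : `|psum (w 0 (n%:R * tau)) n0 (x_ j) - U n j 0| <= sup_const mu sigma * nE (p n - U n).
  have := grid_le_nE xLR muE sigma0 NE m0 (p n - U n) j.
  by rewrite [X in `|X|]mxE [X in X + _]mxE [X in _ + X]mxE.
have Cs0 : 0 <= sup_const mu sigma by exact: sqrtr_ge0.
have -> : w 0 (n%:R * tau) (x_ j) - U n j 0 =
  (w 0 (n%:R * tau) (x_ j) - psum (w 0 (n%:R * tau)) n0 (x_ j)) +
  (psum (w 0 (n%:R * tau)) n0 (x_ j) - U n j 0) by rewrite addrA subrK.
apply: le_trans (ler_normD _ _) _.
rewrite /convergence_const mulrDl lerD//.
by apply: le_trans ej _; rewrite -mulrA; apply: (ler_wpM2l Cs0).
Qed.

End Consistency.
Theorem theorem4p3 (R : realType) (a sigma gamma T xL xR r : R)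
    (u0 : R -> R) (u : R -> R -> R) :
  0 < a -> 0 < sigma -> 0 < gamma -> 0 < T -> xL < xR -> 1 / 2 < r ->
  RLW_solution a sigma gamma xL xR T u0 u ->
  sobolev_Ck 3 xL xR (r + 1) T (fun t x => u x t) ->
  exists C : R, 0 < C /\
    forall (N Nt : nat) (U : nat -> 'cV[R]_N),
      (0 < N)%N -> ~~ odd N -> (0 < Nt)%N ->
      let tau := T / Nt%:R in
      LLF_MP_scheme a sigma gamma xL xR tau Nt U ->
      (forall j : 'I_N, U 0%N j 0 = u0 (grid xL xR N j)) ->
      forall n : nat, (n <= Nt)%N ->
        norm_infty_h (\col_(j < N) u (grid xL xR N j) (n%:R * tau) - U n)
          <= C * (tau ^+ 2 + N%:R `^ (- r)).
Proof.
move=> a0 sigma0 gamma0 T0 xLR r12 sol reg.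
have r0 : 0 <= r by apply: le_trans (ltW r12); rewrite divr_ge0.
pose mu := wavenumber xL xR; have muE : mu = wavenumber xL xR by [].
have [w [B [w0 B0 wB wd]]] := sobolev_Ck_coef xLR muE (addr_ge0 r0 ler01) reg.
have w_ode t k : 0 <= t <= T ->
    omega mu sigma k * fc xL xR mu (w 1%N t) k + k%:R * mu *
      fs xL xR mu (fun x => a * w 0%N t x + gamma / 2 * w 0%N t x ^+ 2) k = 0 /\
    omega mu sigma k * fs xL xR mu (w 1%N t) k - k%:R * mu *
      fc xL xR mu (fun x => a * w 0%N t x + gamma / 2 * w 0%N t x ^+ 2) k = 0.
  move=> tT; have [dc ds] := wd 0%N t k isT tT; rewrite w0 in dc ds *.
  exact: (rlw_coef xLR muE T0 sol tT dc ds).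
have wc t : 0 <= t <= T -> continuous (w 0%N t).
  by move=> tT; rewrite w0; have [cu _ _ _] := sol; apply: cu; rewrite /times/= in_itv.
have C0 := convergence_const_ge0 sigma mu r B a0 gamma0 T0.
exists (convergence_const a sigma gamma mu r B T + 1); split; first by rewrite ltr_wpDl.
move=> N Nt U N0 Nev Nt0 tau sch U0 n nNt.
have NE : N = N./2.*2 by rewrite -[LHS]odd_double_half (negbTE Nev).
have m0 : (0 < N./2)%N by rewrite -double_gt0 -NE.
have rate0 : 0 <= tau ^+ 2 + N%:R `^ (- r) by rewrite addr_ge0 ?sqr_ge0 ?powR_ge0.
have C1 : 0 <= convergence_const a sigma gamma mu r B T + 1 by rewrite addr_ge0.
apply: bigmax_le => [|j _]; first exact: mulr_ge0.
have U0w (i : 'I_N) : U 0%N i 0 = w 0%N 0 (grid xL xR N i).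
  by rewrite U0 w0; have [_ _ <- _] := sol.
have main := convergence xLR muE r0 B0 a0 sigma0 gamma0 NE m0 T0
  (fun i t iN tT => proj2 (wB i t iN tT)) wd wc w_ode Nt0 sch U0w j nNt.
rewrite !mxE; rewrite w0 in main; apply: le_trans main _.
by rewrite ler_wpM2r// lerDl.
Qed.
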